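(* Let $\Omega\subset\mathbb R^d$ be a bounded smooth domain, $\alpha\in(0,1)$, $T>0$, and let $\mathrm L$ be an operator with Green operator $\mathcal G=\mathrm L^{-1}$ and heat semigroup $\mathcal S(t)$ as in the context. Assume: (1) $\mathcal G$ has a symmetric kernel $\mathbb G(x,y)=\mathbb G(y,x)$ and, for some $s,\gamma\in(0,1]$, $$\mathbb G(x,y)\asymp \frac{1}{|x-y|^{d-2s}}\Big(1\wedge\frac{\delta(x)}{|x-y|}\Big)^{\gamma}\Big(1\wedge\frac{\delta(y)}{|x-y|}\Big)^{\gamma},\qquad x,y\in\Omega,\ x\ne y;$$ (2) the limit $D_\gamma\mathbb G(x,\zeta):=\lim_{\Omega\ni y\to\zeta}\mathbb G(x,y)/\delta(y)^\gamma$ exists and $D_\gamma\mathbb G(x,\zeta)\asymp \delta(x)^\gamma/|x-\zeta|^{d-2s+2\gamma}$ for $x\in\Omega$, $\zeta\in\partial\Omega$; (3) $\mathcal G$ maps $\delta^\gamma L^\infty(\Omega)$ into $\delta^\gamma C(\overline\Omega)$; (4) $0\le v\le 1$ implies $0\le \mathcal S(t)[v]\le 1$ for all $t\geq 0$. Let $u_0\in \mathrm H(\Omega)$ and $f\in C^1([0,T];L^2(\Omega))$. Then: (C) (Caputo derivative) There is a unique function $$u\in C([0,T];L^2(\Omega))\cap C((0,T];\mathrm H(\Omega))\cap C^1((0,T];L^2(\Omega))$$ which satisfies ${}^{C}\partial_t^\alpha u+\mathrm L u=f$ in the spectral sense on $(0,T)$, together with the initial condition $u(0,\cdot)=u_0$.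 It is given by $$u(t)=\mathcal H_C[u_0,f,0](t)=\mathcal S_\alpha(t)[u_0]+\int_0^t\mathcal P_\alpha(t-\tau)[f(\tau)]\,d\tau .$$ (R) (Riemann--Liouville derivative) There is a unique function $u$ such that $$t^{1-\alpha}u\in C([0,T];L^2(\Omega))\cap C((0,T];\mathrm H(\Omega))\cap C^1((0,T];L^2(\Omega))$$ and $u$ satisfies ${}^{R}\partial_t^\alpha u+\mathrm L u=f$ in the spectral sense on $(0,T)$, together with the initial condition $\lim_{h\to0^+}{}^{R}\partial_t^{\alpha-1}u(h,\cdot)=u_0$ in $\Omega$. It is given by $$u(t)=\mathcal H_R[u_0,f,0](t)=\mathcal P_\alpha(t)[u_0]+\int_0^t\mathcal P_\alpha(t-\tau)[f(\tau)]\,d\tau .$$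
   Context: Notation: $\delta(x)=\mathrm{dist}(x,\partial\Omega)$; $a\wedge b=\min\{a,b\}$; $a\asymp b$ means $C^{-1}a\le b\le Ca$ for a constant $C>0$ independent of the points involved; $\delta^\gamma X=\{v: v/\delta^\gamma\in X\}$. Operator: $\mathrm L$ is a self-adjoint integro-differential elliptic operator of order $2s$, determined by its Green operator: for every $f\in L^\infty(\Omega)$ the problem $\mathrm LU=f$ in $\Omega$ with $U=0$ on $\partial\Omega$ (resp. on $\mathbb R^d\setminus\overline\Omega$) has a unique bounded solution $U(x)=\mathcal G[f](x)=\int_\Omega\mathbb G(x,y)f(y)\,dy$, and $\mathcal G=\mathrm L^{-1}$. Let $(\varphi_j)_{j\ge1}$ be an orthonormal basis of $L^2(\Omega)$ of eigenfunctions of $\mathcal G$, $\mathcal G\varphi_j=\lambda_j^{-1}\varphi_j$, $0<\lambda_1\le\lambda_2\le\dots$, so that $\mathrm L\varphi_j=\lambda_j\varphi_j$. The energy space is $\mathrm H(\Omega)=\{u\in L^2(\Omega):\|\mathrm Lu\|_{L^2(\Omega)}^2=\sum_j\lambda_j^2\langle u,\varphi_j\rangle^2<\infty\}$. The heat semigroup is $\mathcal S(t)[v]=\sum_j e^{-\lambda_jt}\langle v,\varphi_j\rangle\varphi_j$, with heat kernel $\mathbb S(t,x,y)$, i.e. $\mathcal S(t)[v](x)=\int_\Omega\mathbb S(t,x,y)v(y)\,dy$. Fractional time derivatives ($0<\alpha<1$): ${}^{C}\partial_t^\alpha w(t)=\frac1{\Gamma(1-\alpha)}\int_0^t\frac{w'(\tau)}{(t-\tau)^\alpha}d\tau$,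 $\ {}^{R}\partial_t^\alpha w(t)=\frac1{\Gamma(1-\alpha)}\frac{d}{dt}\int_0^t\frac{w(\tau)}{(t-\tau)^\alpha}d\tau$, $\ {}^{R}\partial_t^{\alpha-1}w(t)=\frac1{\Gamma(1-\alpha)}\int_0^t(t-\xi)^{-\alpha}w(\xi)\,d\xi$. Spectral sense: with $u_j(t)=\langle u(t,\cdot),\varphi_j\rangle$ and $f_j(t)=\langle f(t,\cdot),\varphi_j\rangle$, the equation ${}^{\bullet}\partial_t^\alpha u+\mathrm Lu=f$ ($\bullet\in\{C,R\}$) holds in the spectral sense if ${}^{\bullet}\partial_t^\alpha u_j(t)+\lambda_ju_j(t)=f_j(t)$ for every $j\ge1$. In the Riemann--Liouville case the initial condition for the coefficients is $\lim_{h\to0^+}{}^{R}\partial_t^{\alpha-1}u_j(h)=\langle u_0,\varphi_j\rangle$. Solution operators: $E_{\alpha,\beta}(z)=\sum_{k\ge0}z^k/\Gamma(\alpha k+\beta)$, $E_\alpha=E_{\alpha,1}$, and $\Phi_\alpha(t)=\sum_{k\ge0}\frac{(-t)^k}{k!\,\Gamma(1-\alpha(k+1))}$ (Mainardi function). Then $\mathcal S_\alpha(t)$ and $\mathcal P_\alpha(t)$ are the integral operators on $\Omega$ with kernels $\mathbb S_\alpha(t,x,y)=\int_0^\infty\Phi_\alpha(\tau)\mathbb S(\tau t^\alpha,x,y)\,d\tau$ and $\mathbb P_\alpha(t,x,y)=\alpha t^{\alpha-1}\int_0^\infty\tau\Phi_\alpha(\tau)\mathbb S(\tau t^\alpha,x,y)\,d\tau$;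 equivalently $\mathcal S_\alpha(t)[v]=\sum_jE_\alpha(-\lambda_jt^\alpha)\langle v,\varphi_j\rangle\varphi_j$ and $\mathcal P_\alpha(t)[v]=\sum_jt^{\alpha-1}E_{\alpha,\alpha}(-\lambda_jt^\alpha)\langle v,\varphi_j\rangle\varphi_j$. *)

(* Defs.v *)
From HB Require Import structures.
From mathcomp Require Import all_boot all_order all_algebra.
From mathcomp Require Import all_classical all_reals all_analysis.

Set Implicit Arguments.
Unset Strict Implicit.
Unset Printing Implicit Defensive.
Import Order.TTheory GRing.Theory Num.Theory.
Import numFieldNormedType.Exports.

Local Open Scope classical_set_scope.
Local Open Scope ring_scope.

(* 'rV[R]_n gets the sigma-algebra generated by the coordinates, that is the
   Borel one. *)

Definition rV_display : measure_display.
Proof. exact: default_measure_display. Qed.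

Section measurable_rV.
Context (R : realType) (n : nat).

Let coors (i : 'I_n) (x : 'rV[R]_n) : measurableTypeR R := x ord0 i.

Let rV_set0 : g_sigma_preimage coors set0.
Proof. exact: sigma_algebra0. Qed.

Let rV_setC A : g_sigma_preimage coors A -> g_sigma_preimage coors (~` A).
Proof. exact: sigma_algebraC. Qed.

Let rV_bigcup (F : _^nat) : (forall i, g_sigma_preimage coors (F i)) ->
  g_sigma_preimage coors (\bigcup_i (F i)).
Proof. exact: sigma_algebra_bigcup. Qed.

HB.instance Definition _ := @isMeasurable.Build rV_display
  'rV[R]_n (g_sigma_preimage coors) rV_set0 rV_setC rV_bigcup.

Lemma measurable_coord (i : 'I_n) : measurable_fun [set: 'rV[R]_n]
  (fun x : 'rV[R]_n => x ord0 i : measurableTypeR R).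
Proof.
move=> _ Y mY; rewrite setTI; apply: sub_sigma_algebra => /=.
rewrite -bigcup_seq/=; exists i => /=; first by rewrite mem_index_enum.
by exists Y => //; rewrite setTI.
Qed.

Lemma measurable_fun_coordP d (T : measurableType d) (f : T -> 'rV[R]_n) :
  (forall i, measurable_fun [set: T]
     (fun x => f x ord0 i : measurableTypeR R)) ->
  measurable_fun [set: T] f.
Proof.
move=> mf _ Y; rewrite setTI => mY.
suff : g_sigma_preimage coors `<=` [set Y | measurable (f @^-1` Y)] by apply.
apply: smallest_sub.
  split => /=.
  - by rewrite preimage_set0; exact: measurable0.
  - by move=> A mA; rewrite setTD preimage_setC; exact: measurableC.
  - by move=> F mF; rewrite preimage_bigcup; exact: bigcupT_measurable.
rewrite -bigcup_seq => A [i _] [B mB <-] /=.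
rewrite setTI -[X in measurable X]setTI -comp_preimage.
exact: (mf i measurableT B mB).
Qed.

End measurable_rV.

(* Lebesgue measure on R^n is the n-fold product measure, transported to
   'rV[R]_n by prepending coordinates; see lebesgue_rV_box. *)
Definition cons_rV (R : realType) (n : nat) (p : R * 'rV[R]_n) : 'rV[R]_n.+1 :=
  \row_j oapp (p.2 ord0) p.1 (unlift ord0 j).

Section lebesgue_step.
Context (R : realType) (n : nat).
Variable m : {sigma_finite_measure set 'rV[R]_n -> \bar R}.

Lemma measurable_cons_rV : measurable_fun setT
  (@cons_rV R n : measurableTypeR R * 'rV[R]_n -> 'rV[R]_n.+1).
Proof.
apply: measurable_fun_coordP => i.
under eq_fun do rewrite mxE.
case: unliftP => [j|] _ /=; last exact: measurable_fst.
apply: (@measurableT_comp _ _ _ _ _ _ (fun v : 'rV[R]_n => v ord0 j)) => //.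
exact: measurable_coord.
Qed.

Definition lebesgue_step : set 'rV[R]_n.+1 -> \bar R :=
  pushforward (@lebesgue_measure R \x m)%E
    (@cons_rV R n : measurableTypeR R * 'rV[R]_n -> 'rV[R]_n.+1).

Let lebesgue_step0 : lebesgue_step set0 = 0%E.
Proof. by rewrite /lebesgue_step /pushforward preimage_set0 measure0. Qed.

Let lebesgue_step_ge0 A : (0 <= lebesgue_step A)%E.
Proof. by rewrite /lebesgue_step /pushforward measure_ge0. Qed.

Let lebesgue_step_sigma_additive : semi_sigma_additive lebesgue_step.
Proof.
move=> F mF tF mUF; rewrite /lebesgue_step /pushforward preimage_bigcup.
apply: measure_semi_sigma_additive.
- by move=> k; rewrite -[X in measurable X]setTI; exact: measurable_cons_rV.
- apply/trivIsetP => /= i j _ _ ij; rewrite -preimage_setI.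
  by move/trivIsetP : tF => /(_ _ _ _ _ ij) ->//; rewrite preimage_set0.
- rewrite -preimage_bigcup -[X in measurable X]setTI.
  exact: measurable_cons_rV.
Qed.

HB.instance Definition _ := isMeasure.Build _ _ _ lebesgue_step
  lebesgue_step0 lebesgue_step_ge0 lebesgue_step_sigma_additive.

Let cons_rVK : forall p : R * 'rV[R]_n,
  ((cons_rV p) ord0 ord0, \row_j (cons_rV p) ord0 (lift ord0 j)) = p.
Proof.
move=> [x v]; congr pair; first by rewrite mxE unlift_none.
by apply/rowP => j; rewrite !mxE liftK.
Qed.

Let lebesgue_step_sigma_finite : sigma_finite setT lebesgue_step.
Proof.
have /sigma_finiteP[F [TF ndF Foo]] := sigma_finiteT (@lebesgue_measure R).
have /sigma_finiteP[G [TG ndG Goo]] := sigma_finiteT m.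
pose g (x : 'rV[R]_n.+1) : measurableTypeR R * 'rV[R]_n :=
  (x ord0 ord0, \row_j x ord0 (lift ord0 j)).
have mg : measurable_fun setT g.
  apply: measurable_fun_pair; first exact: measurable_coord.
  apply: measurable_fun_coordP => i.
  under eq_fun do rewrite mxE.
  exact: measurable_coord.
exists (fun k => g @^-1` (F k `*` G k)).
  rewrite -preimage_bigcup (_ : \bigcup_k _ = setT) ?preimage_setT//.
  rewrite -subTset => -[x v] _.
  have [i _ Fx] : (\bigcup_k F k) x by rewrite -TF.
  have [k _ Gv] : (\bigcup_k G k) v by rewrite -TG.
  exists (maxn i k) => //; split => /=.
    by move: x Fx; exact/subsetPset/ndF/leq_maxl.
  by move: v Gv; exact/subsetPset/ndG/leq_maxr.
move=> k; have [mF Fk] := Foo k; have [mG Gk] := Goo k; split.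
  rewrite -[X in measurable X]setTI; apply: mg => //.
  exact: measurableX.
rewrite /lebesgue_step /pushforward -comp_preimage.
have -> : g \o (@cons_rV R n) = id by apply/funext => p; exact: cons_rVK.
by rewrite preimage_id product_measure1E// lte_mul_pinfty// ge0_fin_numE.
Qed.

HB.instance Definition _ := Measure_isSigmaFinite.Build _ _ _ lebesgue_step
  lebesgue_step_sigma_finite.

End lebesgue_step.

Fixpoint lebesgue_rV (R : realType) (n : nat) :
    {sigma_finite_measure set 'rV[R]_n -> \bar R} :=
  if n is k.+1 then lebesgue_step (lebesgue_rV R k)
  else \d_(0 : 'rV[R]_0).

Lemma lebesgue_rV_box (R : realType) (n : nat) (a b : 'I_n -> R) :
  (forall i, a i <= b i) ->
  lebesgue_rV R n [set x : 'rV[R]_n | forall i, x ord0 i \in `[a i, b i]] =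
  (\prod_i (b i - a i))%:E.
Proof.
elim: n a b => [|n IH] a b ab.
  by rewrite big_ord0 /= diracE mem_set// => -[].
rewrite big_ord_recl EFinM /= /lebesgue_step /pushforward.
rewrite (_ : _ @^-1` _ = `[a ord0, b ord0]%classic `*`
  [set x : 'rV[R]_n | forall i, x ord0 i \in
    `[a (lift ord0 i), b (lift ord0 i)]]); last first.
  apply/seteqP; split => -[x v] /=.
    move=> h; split; first by have := h ord0; rewrite mxE unlift_none.
    by move=> i; have := h (lift ord0 i); rewrite mxE liftK.
  move=> [hx hv] i; rewrite mxE; case: unliftP => [j ->|->] //=.
rewrite product_measure1E//; last first.
  rewrite (_ : [set x : 'rV[R]_n | _] = \bigcap_(i : 'I_n)
    ((fun x : 'rV[R]_n => x ord0 i : measurableTypeR R) @^-1`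
       `[a (lift ord0 i), b (lift ord0 i)]%classic)); last first.
    apply/seteqP; split => x /= h i; [by move=> _; exact: h|exact: (h i I)].
  apply: fin_bigcap_measurable => // i _.
  by rewrite -[X in measurable X]setTI; exact: measurable_coord.
congr (_ * _)%E; last exact: IH.
transitivity (lebesgue_measure `[a ord0, b ord0]%classic) => //.
rewrite lebesgue_measure_itv/= lte_fin.
by case: ltgtP (ab ord0) => // -> _; rewrite subrr.
Qed.

Section domain.
Context (R : realType) (d : nat).
Implicit Types (x y : 'rV[R]_d) (A Omega : set 'rV[R]_d).

(* The library norm on 'rV[R]_d is the sup norm; this is the Euclidean one. *)
Definition enorm x : R := Num.sqrt (\sum_i x ord0 i ^+ 2).

Definition bdry A : set 'rV[R]_d := closure A `\` interior A.

Definition dist_bdry Omega x : R := inf [set enorm (x - y) | y in bdry Omega].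

Fixpoint Ck (k : nat) (f : 'rV[R]_d -> R) : Prop :=
  continuous f /\
  if k is l.+1 then forall v, (forall x, derivable f x v) /\ Ck l ('D_v f)
  else True.

(* C^oo boundary, through local defining functions: near each boundary point,
   Omega is a sublevel set of a C^oo function with nonzero gradient. *)
Definition smooth_bdry Omega : Prop := forall z, bdry Omega z ->
  exists (U : set 'rV[R]_d) (rho : 'rV[R]_d -> R),
    [/\ nbhs z U, forall k, Ck k rho, exists v, 'D_v rho z != 0 &
        forall x, U x -> (Omega x <-> rho x < 0)].

Definition bounded_smooth_domain Omega : Prop :=
  [/\ open Omega, Omega !=set0, connected Omega, bounded_set Omega &
      smooth_bdry Omega].

End domain.

Definition comparable_on (R : realType) (X : Type) (D : set X) (a b : X -> R)
  : Prop := exists2 C : R, 0 < C & forall p, D p -> C^-1 * b p <= a p <= C * b p.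

Section fractional_calculus.
Context (R : realType).
Local Notation leb := (@lebesgue_measure R).
Implicit Types (w : R -> R) (alpha t l : R).

(* Only used at arguments x > 0, where the integral converges. *)
Definition Gamma (x : R) : R :=
  \int[leb]_(t in `]0, +oo[%classic) (t `^ (x - 1) * expR (- t)).

Definition mittag_leffler (alpha beta z : R) : R :=
  limn (series (fun k : nat => z ^+ k / Gamma (alpha * k%:R + beta))).

(* Fractional derivatives are relations: the derivative exists at t (the
   integrals converge, the functions are differentiable) and equals l. *)
Definition caputo_deriv alpha w t l : Prop :=
  [/\ forall tau, 0 < tau < t -> derivable w tau 1,
      leb.-integrable `]0, t[%classic
        (EFin \o (fun tau => derive1 w tau / (t - tau) `^ alpha)) &
      l = (Gamma (1 - alpha))^-1 *
          \int[leb]_(tau in `]0, t[%classic) (derive1 w tau / (t - tau) `^ alpha)].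

(* The Riemann-Liouville derivative of w of order alpha - 1 at t, that is the
   fractional integral of order 1 - alpha. *)
Definition RL_integral alpha w t : R :=
  (Gamma (1 - alpha))^-1 *
  \int[leb]_(tau in `]0, t[%classic) (w tau / (t - tau) `^ alpha).

Definition RL_deriv alpha w t l : Prop :=
  (\forall r \near t, leb.-integrable `]0, r[%classic
     (EFin \o (fun tau => w tau / (r - tau) `^ alpha))) /\
  is_derive t 1 (RL_integral alpha w) l.

End fractional_calculus.

Section L2.
Context (R : realType) (d : nat) (Omega : set 'rV[R]_d).
Local Notation mu := (lebesgue_rV R d).
Local Notation leb := (@lebesgue_measure R).
Implicit Types (v w : 'rV[R]_d -> R) (u g : R -> 'rV[R]_d -> R) (I : set R).

(* Elements of L^2(Omega) are represented by functions on R^d of which only the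
   values on Omega matter. *)
Definition L2 v : Prop := v \_ Omega \in Lfun mu 2%:E.

Definition L2norm v : \bar R := 'N[mu]_2%:E [EFin \o (v \_ Omega)]%E.

Definition inner v w : R := \int[mu]_(x in Omega) (v x * w x).

(* w is the sum in L^2(Omega) of the series of the c_j phi_j. *)
Definition L2_series (phi : nat -> 'rV[R]_d -> R) (c : nat -> R) w : Prop :=
  L2 w /\
  L2norm (fun x => \sum_(j < n) c j * phi j x - w x) @[n --> \oo] --> 0%E.

Definition L2_continuous I u : Prop := forall t, I t ->
  L2 (u t) /\
  L2norm (fun x => u r x - u t x) @[r --> within I (nbhs t)] --> 0%E.

Definition L2_C1 I u : Prop := exists u' : R -> 'rV[R]_d -> R,
  [/\ L2_continuous I u, L2_continuous I u' &
      forall t, I t ->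
        L2norm (fun x => (u r x - u t x) / (r - t) - u' t x)
          @[r --> within I (dnbhs t)] --> 0%E].

(* w is the L^2(Omega)-valued integral of g over ]a, b[, defined by duality;
   with the integrability of the norm, this is the Bochner integral. *)
Definition L2_integral (a b : R) g w : Prop :=
  [/\ L2 w, forall t, a < t < b -> L2 (g t),
      leb.-integrable `]a, b[%classic (fun t => L2norm (g t)) &
      forall psi, L2 psi ->
        leb.-integrable `]a, b[%classic (EFin \o (fun t => inner (g t) psi)) /\
        inner w psi = \int[leb]_(t in `]a, b[%classic) inner (g t) psi].

End L2.

Section setting.
Context (R : realType) (d : nat) (Omega : set 'rV[R]_d).
Local Notation mu := (lebesgue_rV R d).
Local Notation delta := (dist_bdry Omega).
Variables (G : 'rV[R]_d -> 'rV[R]_d -> R).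

Definition green_op (v : 'rV[R]_d -> R) (x : 'rV[R]_d) : R :=
  \int[mu]_(y in Omega) (G x y * v y).

Definition measurable_symmetric_kernel : Prop :=
  measurable_fun (Omega `*` Omega) (fun p => G p.1 p.2) /\
  forall x y, Omega x -> Omega y -> G x y = G y x.

Definition green_estimate (s gamma : R) : Prop :=
  comparable_on [set p | [/\ Omega p.1, Omega p.2 & p.1 != p.2]]
    (fun p => G p.1 p.2)
    (fun p => let r := enorm (p.1 - p.2) in
       (r `^ (d%:R - 2 * s))^-1 *
       (Num.min 1 (delta p.1 / r)) `^ gamma *
       (Num.min 1 (delta p.2 / r)) `^ gamma).

Definition green_normal_derivative (s gamma : R) : Prop :=
  exists DG : 'rV[R]_d -> 'rV[R]_d -> R,
    (forall x z, Omega x -> bdry Omega z ->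
       G x y / (delta y) `^ gamma @[y --> within Omega (nbhs z)] --> DG x z) /\
    comparable_on [set p | Omega p.1 /\ bdry Omega p.2]
      (fun p => DG p.1 p.2)
      (fun p => (delta p.1) `^ gamma /
                (enorm (p.1 - p.2)) `^ (d%:R - 2 * s + 2 * gamma)).

(* green_op maps delta^gamma L^oo(Omega) into delta^gamma C(closure Omega):
   green_op v / delta^gamma extends continuously to the closure. *)
Definition green_regularizing (gamma : R) : Prop :=
  forall v : 'rV[R]_d -> R, measurable_fun Omega v ->
  (exists M : R, \forall x \ae mu, Omega x ->
     `|v x / (delta x) `^ gamma| <= M) ->
  exists2 g : 'rV[R]_d -> R, {within closure Omega, continuous g} &
    forall x, Omega x -> green_op v x / (delta x) `^ gamma = g x.

Variables (lam : nat -> R) (phi : nat -> 'rV[R]_d -> R).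

(* Indices start at 0. *)
Definition eigenbasis : Prop :=
  [/\ forall j, L2 Omega (phi j),
      forall i j, inner Omega (phi i) (phi j) = (i == j)%:R,
      forall v, L2 Omega v ->
        L2_series Omega phi (fun j => inner Omega v (phi j)) v,
      0 < lam 0 /\ {homo lam : i j / (i <= j)%N >-> i <= j} &
      forall j, green_op (phi j) = (fun x => (lam j)^-1 * phi j x)
                  %[ae mu in Omega]].

(* The square of the L^2(Omega)-norm of L v. *)
Definition Lsqnorm (v : 'rV[R]_d -> R) : \bar R :=
  (\sum_(0 <= j <oo) (lam j ^+ 2 * inner Omega v (phi j) ^+ 2)%:E)%E.

Definition energy_space (v : 'rV[R]_d -> R) : Prop :=
  L2 Omega v /\ (Lsqnorm v < +oo)%E.

Definition energy_continuous (I : set R) (u : R -> 'rV[R]_d -> R) : Prop :=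
  forall t, I t -> energy_space (u t) /\
    Lsqnorm (fun x => u r x - u t x) @[r --> within I (nbhs t)] --> 0%E.

(* The operators S(t), S_alpha(t), P_alpha(t) are relations "w is the value at
   v", which include the convergence of the series in L^2(Omega). *)
Definition heat_semigroup (t : R) (v w : 'rV[R]_d -> R) : Prop :=
  L2_series Omega phi
    (fun j => expR (- lam j * t) * inner Omega v (phi j)) w.

Definition submarkovian : Prop :=
  forall (t : R) (v w : 'rV[R]_d -> R), 0 <= t -> L2 Omega v ->
  (\forall x \ae mu, Omega x -> 0 <= v x <= 1) -> heat_semigroup t v w ->
  \forall x \ae mu, Omega x -> 0 <= w x <= 1.

Variable alpha : R.

Definition S_op (t : R) (v w : 'rV[R]_d -> R) : Prop :=
  L2_series Omega phi (fun j =>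
    mittag_leffler alpha 1 (- lam j * t `^ alpha) * inner Omega v (phi j)) w.

Definition P_op (t : R) (v w : 'rV[R]_d -> R) : Prop :=
  L2_series Omega phi (fun j =>
    t `^ (alpha - 1) * mittag_leffler alpha alpha (- lam j * t `^ alpha) *
    inner Omega v (phi j)) w.

(* w is the integral of P_alpha(t - tau)[f(tau)] over 0 < tau < t *)
Definition duhamel (f : R -> 'rV[R]_d -> R) (t : R) (w : 'rV[R]_d -> R)
  : Prop := exists2 g : R -> 'rV[R]_d -> R,
    forall tau, 0 < tau < t -> P_op (t - tau) (f tau) (g tau) &
    L2_integral Omega 0 t g w.

(* w = H_C[u0, f, 0](t), resp. w = H_R[u0, f, 0](t) *)
Definition H_C u0 f (t : R) (w : 'rV[R]_d -> R) : Prop :=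
  exists a b : 'rV[R]_d -> R, [/\ S_op t u0 a, duhamel f t b &
    w = (fun x => a x + b x) %[ae mu in Omega]].

Definition H_R u0 f (t : R) (w : 'rV[R]_d -> R) : Prop :=
  exists a b : 'rV[R]_d -> R, [/\ P_op t u0 a, duhamel f t b &
    w = (fun x => a x + b x) %[ae mu in Omega]].

Definition solution_class (T : R) (u : R -> 'rV[R]_d -> R) : Prop :=
  [/\ L2_continuous Omega `[0, T]%classic u,
      energy_continuous `]0, T]%classic u &
      L2_C1 Omega `]0, T]%classic u].

Definition spectral_equation (deriv : (R -> R) -> R -> R -> Prop) (T : R)
    (f u : R -> 'rV[R]_d -> R) : Prop :=
  forall (t : R) (j : nat), 0 < t < T ->
  exists2 l : R, deriv (fun tau => inner Omega (u tau) (phi j)) t l &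
    l + lam j * inner Omega (u t) (phi j) = inner Omega (f t) (phi j).

Definition caputo_solution (T : R) (u0 : 'rV[R]_d -> R)
    (f u : R -> 'rV[R]_d -> R) : Prop :=
  [/\ solution_class T u, spectral_equation (caputo_deriv alpha) T f u &
      u 0 = u0 %[ae mu in Omega]].

(* The value u 0 is irrelevant: the function t^(1 - alpha) u(t) on ]0, T] is
   extended to t = 0 by v. *)
Definition RL_solution (T : R) (u0 : 'rV[R]_d -> R)
    (f u : R -> 'rV[R]_d -> R) : Prop :=
  [/\ exists2 v : R -> 'rV[R]_d -> R, solution_class T v &
        forall t x, 0 < t <= T -> Omega x -> v t x = t `^ (1 - alpha) * u t x,
      spectral_equation (RL_deriv alpha) T f u &
      forall j, RL_integral alpha (fun tau => inner Omega (u tau) (phi j)) h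
                  @[h --> 0^'+] --> inner Omega u0 (phi j)].

End setting.

(* Main.v *)
From HB Require Import structures.
From mathcomp Require Import all_boot all_order all_algebra.
From mathcomp Require Import all_classical all_reals all_analysis.
From mathcomp Require Import measurable_realfun ring lra.
Require Import Defs.

(** In the eigenbasis the problem decouples into the scalar equations
    D^alpha u_j + lam_j u_j = f_j. Their solutions are built from the kernels
    K_j(t) = t^(alpha-1) E_(alpha,alpha)(- lam_j t^alpha) and e_j(t) = E_(alpha,1)(- lam_j t^alpha):
    with * the convolution on the half-line, and u0_j the coefficients of u_0, the solution is
    u0_j e_j + K_j * f_j in the Caputo case and u0_j K_j + K_j * f_j in the Riemann-Liouville case.
    The proof consists of the scalar theory and of bounds which are uniform in j.

    Scalar theory. Let g_p(t) = t^(p-1) / Gamma(p), for t > 0. Both fractional derivatives are made of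
    the convolution with g_(1-alpha) and of an ordinary derivative. Everything follows from the
    semigroup law g_p * g_q = g_(p+q), that is Euler's Beta integral (conv_gk), and from the resolvent
    identities K_j = g_alpha - lam_j g_alpha * K_j and e_j = g_(1-alpha) * K_j = 1 - lam_j g_1 * K_j,
    which are read off the series (conv_gk_mlk, mlk_rec). For uniqueness, the difference of two
    solutions, or its primitive in the Riemann-Liouville case, solves W = - lam_j g_alpha * W;
    convolving with K_j yields W = 0 (volterra_unique, caputo_unique, RL_unique).

    Uniform bounds. One needs 0 <= K_j <= g_alpha and 0 <= e_j <= 1, and a bound on the derivative of
    E_(alpha,alpha) on the negative half-line. These are instances of complete monotonicity; here they
    follow from a positivity principle for Volterra equations with a log-convex kernel
    (volterra_positivity). Since f is continuously differentiable, f_j is the primitive of a continuous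
    function h_j, and then lam_j K_j * f_j = f_j - f_j(0) e_j - e_j * h_j (lam_duhamel). So the energy
    norm of the Duhamel term is controlled by kernels which do not depend on j.

    Passage to L^2(Omega). A family of square-summable sequences depending on t is called equi-tailed
    when its tails are small uniformly in t (equi_tails). A continuous curve in L^2(Omega) has this
    property by Dini's argument, and it is inherited by convolutions with the kernels above
    (equi_tails_conv). For such a family, convergence of each coefficient is convergence in l^2, and a
    mean value inequality gives differentiability (equi_tails_cvg, l2_derive). The Riesz-Fischer theorem
    then produces the solutions (riesz_fischer, solution_class_coef), and dominated convergence identifies
    the Duhamel term with the L^2(Omega)-valued integral of P_alpha(t - tau)[f(tau)] (L2_integral_coef).
    Uniqueness holds because two curves with the same coefficients agree almost everywhere. *)

Set Implicit Arguments.
Unset Strict Implicit.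
Unset Printing Implicit Defensive.
Import Order.TTheory GRing.Theory Num.Theory.
Import numFieldNormedType.Exports.

Local Open Scope classical_set_scope.
Local Open Scope ring_scope.

(** * Changes of variable on the line *)

Section invariance.
Context {R : realType}.
Local Notation leb := (@lebesgue_measure R).

Let reflect (t x : R) : measurableTypeR R := t - x.

Lemma measurable_reflect (t : R) : measurable_fun setT (reflect t).
Proof. exact: measurable_funB. Qed.

Let scale (c x : R) : measurableTypeR R := c * x.

Lemma measurable_scale (c : R) : measurable_fun setT (scale c).
Proof. exact: measurable_funM. Qed.

Local Open Scope ereal_scope.

Lemma lebesgue_measure_reflect (t : R) (A : set R) : measurable A ->
  pushforward leb (reflect t) A = leb A.
Proof.
move=> mA; apply/esym.
apply: (@lebesgue_measure_unique R (pushforward leb (reflect t))) => //=.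
  exact: measurable_reflect.
move=> _ _ [[a b]] _ <-; rewrite /pushforward /=.
rewrite (_ : _ @^-1` _ = `[t - b, t - a[%classic)%R; last first.
  by apply/seteqP; split => x /=; rewrite /reflect !in_itv/=; lra.
rewrite !lebesgue_measure_itv/= !lte_fin.
rewrite (_ : (t - b < t - a)%R = (a < b)%R); last by apply/idP/idP; lra.
by case: ifP => // _; rewrite -!EFinD; congr EFin; lra.
Qed.

Lemma lebesgue_measure_scale (c : R) (A : set R) : (0 < c)%R -> measurable A ->
  pushforward leb (scale c) A = c^-1%:E * leb A.
Proof.
move=> c0 mA.
have c0' : (0 <= c)%R by exact: ltW.
suff : leb A = c%:E * pushforward leb (scale c) A.
  by move=> ->; rewrite muleA -EFinM mulVf ?mul1e// gt_eqF.
apply: (@lebesgue_measure_unique R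
  (mscale (NngNum c0') (pushforward leb (scale c)))) => //=.
  exact: measurable_scale.
move=> mc _ [[a b]] _ <-.
rewrite /mscale/= /pushforward /=.
rewrite (_ : _ @^-1` _ = `]c^-1 * a, c^-1 * b]%classic)%R; last first.
  apply/seteqP; split => x /=; rewrite /scale !in_itv/= ltr_pdivrMl//.
    by rewrite ler_pdivlMl.
  by rewrite ler_pdivlMl.
rewrite !lebesgue_measure_itv/= !lte_fin ltr_pM2l ?invr_gt0//.
case: ifP => _; last by rewrite mule0.
by rewrite -!EFinD -EFinM -mulrBr mulrA divff ?mul1r// gt_eqF.
Qed.

Lemma ge0_integral_reflect (f : R -> \bar R) t :
  measurable_fun setT f -> (forall x, 0 <= f x) ->
  \int[leb]_x f (t - x)%R = \int[leb]_x f x.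
Proof.
move=> mf f0.
transitivity (\int[pushforward leb (reflect t)]_y f y).
  by rewrite ge0_integral_pushforward//; exact: measurable_reflect.
apply: eq_measure_integral; first exact: measurable_reflect.
by move=> mr A mA _; exact: lebesgue_measure_reflect.
Qed.

Lemma ge0_integral_scale (f : R -> \bar R) c : (0 < c)%R ->
  measurable_fun setT f -> (forall x, 0 <= f x) ->
  \int[leb]_x f (c * x)%R = c^-1%:E * \int[leb]_x f x.
Proof.
move=> c0 mf f0.
have ic0 : (0 <= c^-1)%R by rewrite invr_ge0 ltW.
transitivity (\int[pushforward leb (scale c)]_y f y).
  by rewrite ge0_integral_pushforward//; exact: measurable_scale.
rewrite -(ge0_integral_mscale leb measurableT (NngNum ic0))//.
apply: eq_measure_integral; first exact: measurable_scale.
by move=> ms A mA _; exact: lebesgue_measure_scale.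
Qed.

Lemma integral_reflect (f : R -> \bar R) t : measurable_fun setT f ->
  \int[leb]_x f (t - x)%R = \int[leb]_x f x.
Proof.
move=> mf; rewrite [LHS]integralE [RHS]integralE.
rewrite -(ge0_integral_reflect t (f := f^\+))//; last exact: measurable_funepos.
rewrite -(ge0_integral_reflect t (f := f^\-))//; last exact: measurable_funeneg.
by congr (_ - _); apply: eq_integral => x _; rewrite ?funeposE ?funenegE.
Qed.

Lemma integral_translate (f : R -> \bar R) t : measurable_fun setT f ->
  \int[leb]_x f (x - t)%R = \int[leb]_x f x.
Proof.
move=> mf; rewrite -(integral_reflect 0 (f := f))//.
rewrite -(integral_reflect t (f := fun x => f (0 - x)%R)); last first.
  by apply: measurableT_comp => //; exact: measurable_funB.
by apply: eq_integral => x _; rewrite sub0r opprB.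
Qed.

End invariance.

(** * Convolution *)

Section convolution.
Context {R : realType}.
Local Notation leb := (@lebesgue_measure R).
Implicit Types (a b c : R -> R) (t : R).

(** All functions to which it is applied vanish on the negative half-line, so that the
    integral runs over ]0, t[. *)
Definition conv a b t : R := \int[leb]_x (a (t - x) * b x).

Lemma convE a b t :
  conv a b t = \int[leb]_x (a (t - x) * b x).
Proof. by []. Qed.

Lemma measurable_conv_integrand a b t :
  measurable_fun setT a -> measurable_fun setT b ->
  measurable_fun setT (fun x : R => a (t - x) * b x).
Proof.
move=> ma mb; apply: measurable_funM => //.
by apply: measurableT_comp => //; exact: measurable_funB.
Qed.

Lemma convC a b t : measurable_fun setT a -> measurable_fun setT b ->
  conv a b t = conv b a t.
Proof.
move=> ma mb; rewrite /conv /Rintegral; congr fine.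
rewrite -(integral_reflect t); last first.
  by apply/measurable_EFinP; exact: measurable_conv_integrand.
by apply: eq_integral => x _; rewrite opprB addrC subrK mulrC.
Qed.

Lemma measurable_Rintegral1 (f : R * R -> R) : measurable_fun setT f ->
  measurable_fun setT (fun x : R => \int[leb]_y f (x, y)).
Proof.
move=> mf; apply: measurableT_comp => //.
have mf' : measurable_fun setT (EFin \o f) by exact/measurable_EFinP.
rewrite (_ : (fun x => _) = fun x =>
   (\int[leb]_y (EFin \o f)^\+ (x, y) - \int[leb]_y (EFin \o f)^\- (x, y)))%E.
  apply: emeasurable_funB.
    apply: (@measurable_fun_fubini_tonelli_F _ _ _ _ _ leb) => //.
    exact: measurable_funepos.
  apply: (@measurable_fun_fubini_tonelli_F _ _ _ _ _ leb) => //.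
  exact: measurable_funeneg.
apply/funext => x; rewrite integralE.
by congr (_ - _)%E; apply: eq_integral => y _; rewrite ?funeposE ?funenegE.
Qed.

Lemma measurable_conv_kernel a b :
  measurable_fun setT a -> measurable_fun setT b ->
  measurable_fun setT (fun z : R * R => a (z.1 - z.2) * b z.2).
Proof.
move=> ma mb; apply: measurable_funM; last exact: measurableT_comp.
by apply: measurableT_comp => //; apply: measurable_funB.
Qed.

Lemma measurable_conv a b : measurable_fun setT a -> measurable_fun setT b ->
  measurable_fun setT (conv a b).
Proof.
by move=> ma mb; exact: measurable_Rintegral1 (measurable_conv_kernel ma mb).
Qed.

(** Fubini's theorem, with the translation x |-> x - y in the inner integral. Where the
    outer factor vanishes the inner integral may diverge, hence the case distinctions. *)
Lemma conv_assoc a b c t :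
  measurable_fun setT a -> measurable_fun setT b -> measurable_fun setT c ->
  (leb \x leb)%E.-integrable setT
    (EFin \o (fun z : R * R => a (t - z.1) * (b (z.1 - z.2) * c z.2))) ->
  conv a (conv b c) t = conv (conv a b) c t.
Proof.
move=> ma mb mc iabc; rewrite /conv /Rintegral; congr fine.
set F := (fun z : R * R => _) in iabc.
have mF : measurable_fun setT (EFin \o F) by exact: measurable_int iabc.
have mat : measurable_fun setT (fun x : R => a (t - x)).
  by apply: measurableT_comp => //; exact: measurable_funB.
have L : (\int[leb]_x \int[leb]_y (EFin \o F) (x, y) =
  \int[leb]_x (a (t - x) * fine (\int[leb]_y (b (x - y) * c y)%:E))%:E)%E.
  apply: ae_eq_integral => //.
  - exact: (measurable_fubini_F iabc).
  - apply/measurable_EFinP; apply: measurable_funM => //.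
    exact: measurable_conv.
  have := ae_integrable1 iabc; apply: filterS => x ix _ /=.
  have [a0|a0] := eqVneq (a (t - x)) 0.
    by rewrite a0 mul0r integral0_eq// => y _ /=; rewrite /F/= a0 mul0r.
  have ibc : leb.-integrable setT (EFin \o (fun y => b (x - y) * c y)).
    have := integrableZl measurableT (a (t - x))^-1 ix.
    apply: eq_integrable => // y _ /=.
    by rewrite /F/= -EFinM mulKf.
  rewrite EFinM fineK ?integrable_fin_num// -integralZl//.
rewrite -L (Fubini iabc); apply: ae_eq_integral => //.
- exact: (measurable_fubini_G iabc).
- apply/measurable_EFinP.
  exact: (measurable_conv_integrand t (measurable_conv ma mb) mc).
have := ae_integrable2 iabc; apply: filterS => y iy _ /=.
have E z : (a (t - y - (z - y)) * b (z - y) = a (t - z) * b (z - y))%R.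
  by congr (a _ * _); lra.
have [c0|c0] := eqVneq (c y) 0.
  by rewrite c0 mulr0 integral0_eq// => x _ /=; rewrite /F/= c0 !mulr0.
rewrite -(integral_translate (f := fun x => (a (t - y - x) * b x)%:E) y);
  last by apply/measurable_EFinP; exact: measurable_conv_integrand.
under [in RHS]eq_integral do rewrite E.
have iab : leb.-integrable setT (EFin \o (fun x => a (t - x) * b (x - y))).
  have := integrableZl measurableT (c y)^-1 iy.
  apply: eq_integrable => // x _ /=.
  by rewrite /F/= -EFinM mulrC; congr EFin; field.
rewrite EFinM fineK ?integrable_fin_num// -integralZr//.
by apply: eq_integral => x _ /=; rewrite /F/= -EFinM mulrA.
Qed.

End convolution.

(** * The Gamma function and the kernels of fractional integration *)

Section gamma.
Context {R : realType}.
Local Notation leb := (@lebesgue_measure R).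
Implicit Types p q t x : R.

(** The power t^(p - 1), extended by 0 to the negative half-line. *)
Definition pk p t : R := if 0 < t then t `^ (p - 1) else 0.

Lemma pk_ge0 p t : 0 <= pk p t.
Proof. by rewrite /pk; case: ifP => // _; exact: powR_ge0. Qed.

Lemma pk_gt0 p t : 0 < t -> 0 < pk p t.
Proof. by move=> t0; rewrite /pk t0 powR_gt0. Qed.

Lemma pk_le0 p t : t <= 0 -> pk p t = 0.
Proof. by rewrite /pk leNgt; case: ifP. Qed.

Lemma pkE p t : 0 < t -> pk p t = t `^ (p - 1).
Proof. by move=> t0; rewrite /pk t0. Qed.

Lemma measurable_pk p : measurable_fun setT (pk p).
Proof.
apply: measurable_fun_ifT => //; exact: measurable_fun_ltr.
Qed.

Lemma pk_scale p c t : 0 < c -> pk p (c * t) = c `^ (p - 1) * pk p t.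
Proof.
move=> c0; rewrite /pk pmulr_rgt0//; case: ifP => t0; last by rewrite mulr0.
by rewrite powRM// ltW.
Qed.

Lemma GammaE p : Gamma p = \int[leb]_x (pk p x * expR (- x)).
Proof.
rewrite /Gamma Rintegral_mkcond; apply: eq_Rintegral => x _.
rewrite patchE /pk; case: ifPn => [/set_mem|/negP].
  by rewrite /= in_itv/= andbT => ->.
by rewrite inE /= in_itv/= andbT => /negP/negbTE ->; rewrite mul0r.
Qed.

Let gamma_integrand p := (fun x => (pk p x * expR (- x))%:E).

Lemma measurable_gamma_integrand p : measurable_fun setT (gamma_integrand p).
Proof.
apply/measurable_EFinP; apply: measurable_funM; first exact: measurable_pk.
apply: measurableT_comp => //; exact: oppr_measurable.
Qed.

Lemma gamma_integrand_ge0 p x : (0 <= gamma_integrand p x)%E.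
Proof. by rewrite lee_fin mulr_ge0 ?pk_ge0 ?expR_ge0. Qed.

(** Compare with one term of the exponential series for x >= 1, with 1 for x < 1. *)
Lemma powR_le_expR p : 0 <= p -> exists2 C : R, 0 < C &
  forall x, 0 < x -> x `^ p <= C * expR x.
Proof.
move=> p0; pose n := Num.Def.truncn p; exists n.+1`!%:R => [|y y0].
  by rewrite ltr0n fact_gt0.
have F1 : 1 <= (n.+1`!)%:R :> R by rewrite ler1n fact_gt0.
have [y1|y1] := leP 1 y.
  have : y `^ p <= y ^+ n.+1.
    by rewrite -powR_mulrn ?(ltW y0)// ler_powR// ltW// truncnS_gt.
  move/le_trans; apply; rewrite mulrC -ler_pdivrMr ?ltr0n ?fact_gt0//.
  by rewrite (le_trans _ (expR_ge1Dxn n (ltW y0)))// lerDr.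
apply: (@le_trans _ _ 1).
  by rewrite -(powRr0 y) ger_powR// y0 ltW.
have e1 : 1 <= expR y by rewrite (le_trans _ (expR_ge1Dx y))// lerDl ltW.
by rewrite (le_trans F1)// ler_peMr// ltW// (lt_le_trans _ F1).
Qed.

(** Monotone convergence along the intervals [1/n, n]. *)
Lemma ge0_integral_le_itv (f : R -> \bar R) (M : \bar R) :
  measurable_fun setT f -> (forall x, 0 <= f x)%E ->
  (forall a b : R, (0 < a)%R -> (a < b)%R -> \int[leb]_(x in `[a, b]) f x <= M)%E ->
  (\int[leb]_(x in `]0%R, +oo[) f x <= M)%E.
Proof.
move=> mf f0 fM.
pose F n := `[n.+2%:R^-1 : R, n.+2%:R]%classic.
have FE : \bigcup_n F n = `]0, +oo[%classic.
  apply/seteqP; split => x /=.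
    move=> [n _]; rewrite /F/= !in_itv/= andbT => /andP[+ _].
    by apply: lt_le_trans; rewrite invr_gt0.
  rewrite in_itv/= andbT => x0; exists (Num.bound (x + x^-1)) => //.
  have xb : x + x^-1 < (Num.bound (x + x^-1))%:R.
    by rewrite archi_boundP// addr_ge0 ?invr_ge0 ?(ltW x0).
  have ix0 : 0 < x^-1 by rewrite invr_gt0.
  have lb : (Num.bound (x + x^-1))%:R <= (Num.bound (x + x^-1)).+2%:R :> R.
    by rewrite ler_nat -addn2 leq_addr.
  rewrite /F/= in_itv/=; apply/andP; split; last by lra.
  by rewrite -[leRHS]invrK lef_pV2 ?posrE//; lra.
have := @ge0_nondecreasing_set_cvg_integral _ (measurableTypeR R) R F f leb.
rewrite FE => H; apply: (cvge_le _ (H _ _ _ _)) => //.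
- apply: nearW => n; apply: fM; first by rewrite invr_gt0.
  by rewrite (@lt_trans _ _ 1)// ?invf_lt1// ?ltr1n.
- move=> n m nm; apply/subsetPset => x; rewrite /F/= !in_itv/=.
  have : n.+2%:R <= m.+2%:R :> R by rewrite ler_nat.
  have : m.+2%:R^-1 <= n.+2%:R^-1 :> R by rewrite lef_pV2 ?posrE ?ltr0n// ler_nat.
  move=> h1 h2 /andP[h3 h4]; apply/andP.
  by split; [exact: le_trans h1 h3|exact: le_trans h4 h2].
- by move=> i; exact: measurable_itv.
- by move=> i; exact: measurable_funTS.
Qed.

Lemma integral_halfline (f : R -> R) : (forall x, x <= 0 -> f x = 0) ->
  (\int[leb]_x (f x)%:E = \int[leb]_(x in `]0%R, +oo[) (f x)%:E)%E.
Proof.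
move=> f0; rewrite [RHS]integral_mkcond; apply: eq_integral => x _.
rewrite patchE; case: ifPn; rewrite ?notin_setE//= in_itv/= andbT => /negP.
by rewrite -leNgt => /f0 ->.
Qed.

(** The integrand is at most a multiple of x^(p - 1) / (1 + x^p)^2, whose primitive
    - p^-1 / (1 + x^p) is bounded: this controls the singularity at 0 and the decay at
    infinity at the same time. *)
Lemma gamma_integrand_lty p : 0 < p -> (\int[leb]_x gamma_integrand p x < +oo)%E.
Proof.
move=> p0; rewrite integral_halfline; last first.
  by move=> x x0; rewrite pk_le0// mul0r.
have [|C C0 HC] := @powR_le_expR (p + p); first by rewrite addr_ge0 ?ltW.
pose g x := x `^ (p - 1) / (1 + x `^ p) ^+ 2.
pose G x := - p^-1 / (1 + x `^ p).
have x1 x : 0 < 1 + x `^ p by rewrite ltr_pwDl ?powR_ge0.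
have dG x : 0 < x -> is_derive x 1 G (g x).
  move=> x0; rewrite /G.
  have dV : is_derive x 1 (fun x => (1 + x `^ p)^-1) 
      (- (1 + x `^ p) ^- 2 *: (0 + p * x `^ (p - 1))).
    have D1 : is_derive x 1 (fun x => 1 + x `^ p) (0 + p * x `^ (p - 1)).
      exact: (is_deriveD (is_derive_cst (1 : R) x (1 : R)) (is_derive1_powR p x0)).
    by apply: is_deriveV => //; rewrite gt_eqF.
  apply: is_derive_eq; rewrite /g add0r /GRing.scale/=.
  by field; rewrite !gt_eqF.
have gintg x : 0 < x -> (gamma_integrand p x <= ((2 + 2 * C) * g x)%:E)%E.
  move=> x0; rewrite lee_fin /pk x0 /g mulrCA ler_pM2l ?powR_gt0//.
  rewrite expRN -[leLHS]mul1r ler_pdivrMr ?expR_gt0// mulrAC.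
  rewrite ler_pdivlMr ?exprn_gt0// mul1r.
  have := HC x x0; rewrite powRD; last by rewrite (gt_eqF x0) implybT.
  have : 1 <= expR x by rewrite (le_trans _ (expR_ge1Dx x))// lerDl ltW.
  set y := x `^ p => e1 yC; apply: (@le_trans _ _ (2 + 2 * (y * y))).
    by have := sqr_ge0 (1 - y); nra.
  by lra.
apply: (@le_lt_trans _ _ ((2 + 2 * C) / p)%:E); last exact: ltry.
apply: ge0_integral_le_itv; [exact: measurable_gamma_integrand|exact: gamma_integrand_ge0|].
move=> a b a0 ab.
have cg : {within `[a, b], continuous (fun x => (2 + 2 * C) * g x)}.
  apply: continuous_in_subspaceT => x; rewrite inE/= in_itv/= => /andP[ax _].
  have x0 : 0 < x by exact: lt_le_trans ax.
  have dp q : {for x, continuous (fun x => x `^ q)}.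
    apply: differentiable_continuous; apply/derivable1_diffP.
    by apply: derivable_powR; rewrite in_itv/= x0.
  apply: cvgM; first exact: cvg_cst.
  apply: cvgM; first exact: dp.
  apply: cvgV; first by rewrite expf_neq0// gt_eqF.
  by apply: cvgM; apply: cvgD; [exact: cvg_cst|exact: dp|exact: cvg_cst|exact: dp].
have dCG x : 0 < x -> is_derive x 1 (fun x => (2 + 2 * C) * G x) ((2 + 2 * C) * g x).
  by move=> x0; have := dG x x0 => ?; apply: is_deriveZ.
apply: (@le_trans _ _ (\int[leb]_(x in `[a, b]) ((2 + 2 * C) * g x)%:E)%E).
  apply: ge0_le_integral => //.
  - by move=> x _; exact: gamma_integrand_ge0.
  - by apply: measurable_funTS; exact: measurable_gamma_integrand.
  - by apply/measurable_EFinP; apply: subspace_continuous_measurable_fun.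
  - move=> x /=; rewrite in_itv/= => /andP[ax _]; apply: gintg.
    exact: lt_le_trans ax.
rewrite (@continuous_FTC2 _ _ (fun x => (2 + 2 * C) * G x) a b)//; last 2 first.
- have cCG x : 0 < x -> {for x, continuous (fun x => (2 + 2 * C) * G x)}.
    move=> x0; apply: differentiable_continuous; apply/derivable1_diffP.
    by have [] := dCG x x0.
  split.
  + move=> x; rewrite in_itv/= => /andP[ax _].
    by have [] := dCG x (lt_trans a0 ax).
  + by apply: cvg_at_right_filter; exact: cCG.
  + by apply: cvg_at_left_filter; apply: cCG; exact: lt_trans ab.
- move=> x; rewrite in_itv/= => /andP[ax _].
  by rewrite derive1E; have [_ ->] := dCG x (lt_trans a0 ax).
rewrite -EFinB lee_fin /G -mulrBr ler_pM2l; last by lra.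
rewrite -mulrBr mulNr -mulrN opprB -[leRHS]mulr1 ler_pM2l ?invr_gt0//.
have := x1 b; rewrite -invr_gt0.
have : (1 + a `^ p)^-1 <= 1 by rewrite invf_le1// lerDl powR_ge0.
lra.
Qed.

Lemma Gamma_EFin p : 0 < p -> (\int[leb]_x gamma_integrand p x = (Gamma p)%:E)%E.
Proof.
move=> p0; rewrite GammaE fineK// ge0_fin_numE ?gamma_integrand_lty//.
by apply: integral_ge0 => x _; exact: gamma_integrand_ge0.
Qed.

(** Keep only the part of the integral over [A, A + 1], where
    x^(p - 1) = x^p / x >= A^p / (A + 1). Choosing A freely makes Gamma grow faster than
    any geometric sequence, which is all that the convergence of the series needs. *)
Lemma Gamma_ge p A : 0 < p -> 1 <= A -> A `^ p * expR (- (A + 1)) / (A + 1) <= Gamma p.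
Proof.
move=> p0 A1; have A0 : 0 < A by lra.
rewrite -lee_fin -Gamma_EFin//.
apply: (@le_trans _ _ (\int[leb]_(x in `[A, (A + 1)%R]) gamma_integrand p x)%E); last first.
  apply: ge0_subset_integral => //; first exact: measurable_gamma_integrand.
  by move=> x _; exact: gamma_integrand_ge0.
apply: (@le_trans _ _ (\int[leb]_(x in `[A, (A + 1)%R]) (A `^ p * expR (- (A + 1)) / (A + 1))%:E)%E).
  rewrite integral_cst//= lebesgue_measure_itv/= lte_fin ltrDl ltr01 -EFinD.
  by rewrite (_ : A + 1 - A = 1) ?mule1//; lra.
apply: ge0_le_integral => //.
- by move=> x _; rewrite lee_fin divr_ge0 ?mulr_ge0 ?powR_ge0 ?expR_ge0//; lra.
- by apply: measurable_funTS; exact: measurable_gamma_integrand.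
move=> x /=; rewrite in_itv/= => /andP[Ax xA].
have x0 : 0 < x by lra.
rewrite lee_fin /pk x0 mulrAC ler_pM ?expR_ge0//.
- by rewrite divr_ge0 ?powR_ge0//; lra.
- rewrite powRB; last by rewrite (gt_eqF x0) implybT.
  rewrite powRr1 ?(ltW x0)// ler_pM ?powR_ge0 ?invr_ge0//; first by lra.
    by rewrite ge0_ler_powR ?nnegrE// ltW.
  by rewrite lef_pV2 ?posrE//; lra.
- by rewrite ler_expR; lra.
Qed.

Lemma Gamma_gt0 p : 0 < p -> 0 < Gamma p.
Proof.
move=> p0; apply: lt_le_trans (Gamma_ge p0 (lexx 1)).
by rewrite divr_gt0 ?mulr_gt0 ?expR_gt0 ?powR_gt0.
Qed.

Lemma Gamma1 : Gamma 1 = 1 :> R.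
Proof.
apply/EFin_inj; rewrite -Gamma_EFin//.
rewrite integral_halfline; last by move=> x x0; rewrite pk_le0// mul0r.
transitivity (\int[leb]_(x in `[0%R, +oo[) (expR (- x))%:E)%E.
  rewrite -integral_itv_obnd_cbnd; last first.
    apply: measurable_funTS; apply/measurable_EFinP.
    by apply: (measurableT_comp (f := expR)).
  apply: eq_integral => x; rewrite inE/= in_itv/= andbT => x0.
  by rewrite /pk x0 subrr powRr0 mul1r.
have dF x : is_derive x 1 (fun x : R => - expR (- x)) (expR (- x)).
  apply: is_derive_eq.
  by rewrite /GRing.scale/= mulrN1 opprK.
rewrite (@ge0_continuous_FTC2y _ _ (fun x => - expR (- x)) _ 0)//.
- by rewrite oppr0 expR0 EFinN oppeK add0e.
- apply: continuous_subspaceT => x; apply: continuous_comp; first exact: opp_continuous.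
  exact: continuous_expR.
- by rewrite -oppr0; apply: cvgN; exact: cvgr_expR.
- apply: cvg_at_right_filter.
  have /derivable1_diffP/differentiable_continuous : derivable (fun x : R => - expR (- x)) 0 1 by have [] := dF 0.
  exact.
- by move=> x _; rewrite derive1E; have [_ ->] := dF x.
Qed.

Let B p q t := (\int[leb]_x (pk p (t - x) * pk q x)%:E)%E.

Lemma measurable_pkpk p q t : measurable_fun setT (fun x : R => pk p (t - x) * pk q x).
Proof. by apply: measurable_conv_integrand; exact: measurable_pk. Qed.

(** Substitute x = t y. *)
Lemma beta_homogeneous p q t : B p q t = ((pk (p + q) t)%:E * B p q 1)%E.
Proof.
have [t0|t0] := leP t 0.
  rewrite pk_le0// mul0e /B integral0_eq// => x _.
  have [x0|x0] := leP x 0; first by rewrite (pk_le0 q)// mulr0.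
  by rewrite pk_le0 ?mul0r//; lra.
have := ge0_integral_scale t0 (f := fun x => (pk p (t - x) * pk q x)%:E).
rewrite -/(B p q t) => H.
have -> : (B p q t = t%:E * (t^-1%:E * B p q t))%E.
  by rewrite muleA -EFinM mulfV ?mul1e// gt_eqF.
rewrite -H; [|by apply/measurable_EFinP; exact: measurable_pkpk|
             by move=> x; rewrite lee_fin mulr_ge0 ?pk_ge0].
under eq_integral.
  move=> x _; rewrite -[X in X - _]mulr1 -mulrBr !pk_scale//.
  rewrite (_ : _ * _ = (t `^ (p - 1) * t `^ (q - 1)) * (pk p (1 - x) * pk q x)); last by ring.
  rewrite EFinM; over.
rewrite ge0_integralZl_EFin//=; [|
  by move=> x _; rewrite lee_fin mulr_ge0 ?pk_ge0|
  by apply/measurable_EFinP; exact: measurable_pkpk|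
  by rewrite mulr_ge0 ?powR_ge0].
rewrite muleA -EFinM; congr ((_%:E) * _)%E.
rewrite /pk t0 -powRD; last by rewrite (gt_eqF t0) implybT.
rewrite -{1}[t]powRr1 ?ltW// -powRD; last by rewrite (gt_eqF t0) implybT.
by congr (_ `^ _); lra.
Qed.

(** Euler's identity Gamma(p) Gamma(q) = Gamma(p + q) B(p, q): integrate
    e^(-x) (x - y)_+^(p - 1) y_+^(q - 1) over the plane in the two orders. *)
Lemma Gamma_mul_EFin p q : 0 < p -> 0 < q ->
  ((Gamma p * Gamma q)%:E = (Gamma (p + q))%:E * B p q 1)%E.
Proof.
move=> p0 q0; pose h (z : R * R) := ((expR (- z.1))%:E * (pk p (z.1 - z.2) * pk q z.2)%:E)%E.
have h0 z : (0 <= h z)%E.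
  by rewrite mule_ge0// lee_fin ?expR_ge0// mulr_ge0 ?pk_ge0.
have mh : measurable_fun setT h.
  apply: emeasurable_funM; apply/measurable_EFinP.
    by apply: (measurableT_comp (f := expR)) => //; apply: measurableT_comp.
  by apply: measurable_conv_kernel; exact: measurable_pk.
have B1 : (0 <= B p q 1)%E.
  by apply: integral_ge0 => x _; rewrite lee_fin mulr_ge0 ?pk_ge0.
have := @fubini_tonelli _ _ _ _ R leb leb h mh h0.
have -> : (\int[leb]_x \int[leb]_y h (x, y) = (Gamma (p + q))%:E * B p q 1)%E.
  rewrite -Gamma_EFin ?addr_gt0// -ge0_integralZr//; last 2 first.
  - exact: measurable_gamma_integrand.
  - by move=> x _; exact: gamma_integrand_ge0.
  apply: eq_integral => x _.
  rewrite /h/= ge0_integralZl_EFin; first last.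
  - exact: expR_ge0.
  - by apply/measurable_EFinP; exact: measurable_pkpk.
  - by move=> y _; rewrite lee_fin mulr_ge0 ?pk_ge0.
  - exact: measurableT.
  by rewrite /= -/(B p q x) beta_homogeneous muleA -EFinM mulrC.
move=> ->; rewrite EFinM -(Gamma_EFin q0) -ge0_integralZl//; last 3 first.
- exact: measurable_gamma_integrand.
- by move=> x _; exact: gamma_integrand_ge0.
- by rewrite lee_fin ltW// Gamma_gt0.
apply: eq_integral => y _; rewrite /h/=.
rewrite -(Gamma_EFin p0) muleC -ge0_integralZl//; last 3 first.
- exact: measurable_gamma_integrand.
- by move=> x _; exact: gamma_integrand_ge0.
- exact: gamma_integrand_ge0.
rewrite -(integral_translate (f := fun x => (gamma_integrand q y * gamma_integrand p x)%E) y); last first.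
  apply: emeasurable_funM => //; exact: measurable_gamma_integrand.
apply: eq_integral => x _; rewrite /gamma_integrand -!EFinM; congr EFin.
rewrite (_ : - x = - y - (x - y)) ?expRD; last by lra.
ring.
Qed.

(** The kernel of the Riemann-Liouville integral of order p. *)
Definition gk p t : R := pk p t / Gamma p.

Lemma gkE p t : gk p t = pk p t / Gamma p.
Proof. by []. Qed.

Lemma integral_pk_conv p q t : 0 < p -> 0 < q ->
  (\int[leb]_x (pk p (t - x) * pk q x)%:E =
   (Gamma p * Gamma q / Gamma (p + q) * pk (p + q) t)%:E)%E.
Proof.
move=> p0 q0; rewrite -/(B p q t) beta_homogeneous.
have g0 := Gamma_gt0 (addr_gt0 p0 q0).
have -> : B p q 1 = (Gamma p * Gamma q / Gamma (p + q))%:E.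
  rewrite mulrC EFinM Gamma_mul_EFin// muleA -EFinM mulVf ?mul1e//.
  by rewrite gt_eqF.
by rewrite -EFinM mulrC.
Qed.

Lemma integrable_pk_conv p q t : 0 < p -> 0 < q ->
  leb.-integrable setT (EFin \o (fun x => pk p (t - x) * pk q x)).
Proof.
move=> p0 q0; apply/integrableP; split.
  by apply/measurable_EFinP; exact: measurable_pkpk.
under eq_integral do rewrite /= ger0_norm ?mulr_ge0 ?pk_ge0//.
by rewrite integral_pk_conv// ltry.
Qed.

Lemma measurable_gk p : measurable_fun setT (gk p).
Proof. by apply: measurable_funM => //; exact: measurable_pk. Qed.

Lemma gk_ge0 p t : 0 < p -> 0 <= gk p t.
Proof. by move=> p0; rewrite divr_ge0 ?pk_ge0// ltW// Gamma_gt0. Qed.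

Lemma gk_gt0 p t : 0 < p -> 0 < t -> 0 < gk p t.
Proof. by move=> p0 t0; rewrite divr_gt0 ?pk_gt0// Gamma_gt0. Qed.

Lemma gk_le0 p t : t <= 0 -> gk p t = 0.
Proof. by move=> t0; rewrite /gk pk_le0// mul0r. Qed.

Lemma gk1 t : 0 < t -> gk 1 t = 1.
Proof. by move=> t0; rewrite /gk /pk t0 subrr powRr0 Gamma1 divr1. Qed.

Lemma gk_homo p s t : 1 <= p -> s <= t -> gk p s <= gk p t.
Proof.
move=> p1 st; have p0 : 0 < p by rewrite (lt_le_trans ltr01).
have [s0|s0] := leP s 0; first by rewrite (gk_le0 p s0) gk_ge0.
rewrite /gk ler_wpM2r//; first by rewrite invr_ge0 (ltW (Gamma_gt0 p0)).
by rewrite /pk s0 (lt_le_trans s0 st) ge0_ler_powR ?nnegrE ?subr_ge0 ?(ltW s0)// (le_trans (ltW s0)).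
Qed.

(** The semigroup law of fractional integration is Euler's Beta integral. *)
Lemma conv_gk p q : 0 < p -> 0 < q -> conv (gk p) (gk q) = gk (p + q).
Proof.
move=> p0 q0; apply/funext => t; rewrite /conv /gk.
under eq_Rintegral do rewrite mulrACA -invfM.
rewrite RintegralZr//; last exact: integrable_pk_conv.
rewrite /Rintegral integral_pk_conv//=.
have := gt_eqF (Gamma_gt0 (addr_gt0 p0 q0)).
have := gt_eqF (Gamma_gt0 p0); have := gt_eqF (Gamma_gt0 q0).
move: (Gamma p) (Gamma q) (Gamma (p + q)) (pk (p + q) t) => a b c e b0 a0 c0.
by field; rewrite a0 b0 c0.
Qed.

End gamma.

(** * Locally singular functions *)

Lemma integrable_norm_le d (T : measurableType d) (R : realType)
    (mu : {measure set T -> \bar R}) (D : set T) (f g : T -> R) :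
  measurable D -> measurable_fun D f ->
  (forall x, D x -> `|f x| <= g x) ->
  mu.-integrable D (EFin \o g) -> mu.-integrable D (EFin \o f).
Proof.
move=> mD mf fg ig; apply: (le_integrable mD _ _ ig).
  exact/measurable_EFinP.
by move=> x Dx; rewrite lee_fin (le_trans (fg x Dx))// ler_norm.
Qed.

Section lsing.
Context {R : realType}.
Local Notation leb := (@lebesgue_measure R).
Implicit Types (p q r t x X : R) (a b c : R -> R).

(** Functions supported in the positive half-line which are locally O(t^(p - 1)). For p > 0
    convolution adds the exponents, so that all kernels, sources and solutions below live in
    one of these classes and every convolution of them converges absolutely. *)
Definition lsing p a : Prop := measurable_fun setT a /\
  forall X, exists2 C : R, 0 <= C & forall x, x <= X -> `|a x| <= C * pk p x.

Lemma lsing_le0 p a x : lsing p a -> x <= 0 -> a x = 0.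
Proof.
move=> [_ /(_ 0)[C C0 aC]] x0; apply/eqP; rewrite -normr_le0.
by rewrite (le_trans (aC _ x0))// pk_le0// mulr0.
Qed.

Lemma lsing_gk p : 0 < p -> lsing p (gk p).
Proof.
move=> p0; split; first exact: measurable_gk.
move=> X; exists (Gamma p)^-1; first by rewrite invr_ge0 ltW// Gamma_gt0.
by move=> x _; rewrite ger0_norm ?gk_ge0// mulrC.
Qed.

Lemma lsingZ p k a : lsing p a -> lsing p (fun x => k * a x).
Proof.
move=> [ma Ha]; split; first exact: measurable_funM.
move=> X; have [C C0 aC] := Ha X; exists (`|k| * C); first by rewrite mulr_ge0.
by move=> x xX; rewrite normrM -mulrA ler_wpM2l// aC.
Qed.

Lemma lsingD p a b : lsing p a -> lsing p b -> lsing p (fun x => a x + b x).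
Proof.
move=> [ma Ha] [mb Hb]; split; first exact: measurable_funD.
move=> X; have [C C0 aC] := Ha X; have [D D0 bD] := Hb X.
exists (C + D); first by rewrite addr_ge0.
by move=> x xX; rewrite mulrDl (le_trans (ler_normD _ _))// lerD ?aC ?bD.
Qed.

(** On ]0, X] the quotient t^(q - p) of the two powers is bounded. *)
Lemma lsing_wk p q a : p <= q -> lsing q a -> lsing p a.
Proof.
move=> pq [ma Ha]; split => // X; have [C C0 aC] := Ha X.
exists (C * (Num.max 1 X) `^ (q - p)); first by rewrite mulr_ge0 ?powR_ge0.
move=> x xX; apply: (le_trans (aC _ xX)); rewrite -mulrA ler_wpM2l//.
have [x0|x0] := leP x 0; first by rewrite !pk_le0// mulr0.
rewrite /pk x0 (_ : q - 1 = (q - p) + (p - 1)); last by ring.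
rewrite powRD; last by rewrite (gt_eqF x0) implybT.
rewrite ler_wpM2r ?powR_ge0// ge0_ler_powR ?nnegrE ?subr_ge0 ?(ltW x0)//.
  by rewrite le_max ler01.
by rewrite le_max xX orbT.
Qed.

(** Where the integrand does not vanish, both arguments lie in ]0, X[. *)
Lemma lsing_conv_bound p q a b X : lsing p a -> lsing q b ->
  exists2 C : R, 0 <= C & forall t x, t <= X ->
    `|a (t - x) * b x| <= C * (pk p (t - x) * pk q x).
Proof.
move=> la lb; have [_ /(_ X)[C C0 aC]] := la; have [_ /(_ X)[D D0 bD]] := lb.
exists (C * D); first by rewrite mulr_ge0.
move=> t x tX; rewrite mulrACA normrM.
have [x0|x0] := leP x 0.
  by rewrite (lsing_le0 lb x0) normr0 (pk_le0 _ x0) !mulr0.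
have [xt|xt] := leP t x.
  by rewrite (lsing_le0 la) ?subr_le0// normr0 pk_le0 ?subr_le0// !(mulr0, mul0r).
by rewrite ler_pM// ?aC ?bD//; lra.
Qed.

Lemma lsing_integrable p q a b t : 0 < p -> 0 < q -> lsing p a -> lsing q b ->
  leb.-integrable setT (EFin \o (fun x => a (t - x) * b x)).
Proof.
move=> p0 q0 la lb; have [C C0 H] := lsing_conv_bound t la lb.
apply: (@integrable_norm_le _ _ R leb setT _ (fun x => C * (pk p (t - x) * pk q x))) => //.
- by apply: measurable_conv_integrand; [case: la|case: lb].
- by move=> x _; rewrite (le_trans (H t x (lexx _)))// ler_norm.
- have := integrableZl measurableT C (integrable_pk_conv t p0 q0).
  by apply: eq_integrable => // x _ /=; rewrite EFinM.
Qed.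

Lemma lsing_conv_norm p q a b X : 0 < p -> 0 < q -> lsing p a -> lsing q b ->
  exists2 C : R, 0 <= C & forall t, t <= X ->
  \int[leb]_x `|a (t - x) * b x| <= C * pk (p + q) t.
Proof.
move=> p0 q0 la lb; have [C C0 H] := lsing_conv_bound X la lb.
exists (C * (Gamma p * Gamma q / Gamma (p + q))).
  by rewrite mulr_ge0// divr_ge0 ?mulr_ge0 ?ltW ?Gamma_gt0// addr_gt0.
move=> t tX.
apply: (@le_trans _ _ (\int[leb]_x (C * (pk p (t - x) * pk q x)))).
  apply: le_Rintegral => //.
  - exact: (integrable_norm (lsing_integrable t p0 q0 la lb)).
  - have := integrableZl measurableT C (integrable_pk_conv t p0 q0).
    by apply: eq_integrable => // x _ /=; rewrite EFinM.
  - by move=> x _; exact: H.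
rewrite RintegralZl//; last exact: integrable_pk_conv.
by rewrite /Rintegral integral_pk_conv//= mulrA.
Qed.

Lemma lsing_conv p q a b : 0 < p -> 0 < q -> lsing p a -> lsing q b ->
  lsing (p + q) (conv a b).
Proof.
move=> p0 q0 la lb; split; first by apply: measurable_conv; [case: la|case: lb].
move=> X; have [C C0 H] := lsing_conv_norm X p0 q0 la lb.
exists C => // t tX; apply: le_trans (H t tX).
by apply: le_normr_Rintegral => //; exact: lsing_integrable p0 q0 la lb.
Qed.

(** The product of the three powers is an integrable majorant: its iterated integral is a
    product of two Beta integrals. *)
Lemma lsing_convA p q r a b c : 0 < p -> 0 < q -> 0 < r ->
  lsing p a -> lsing q b -> lsing r c ->
  conv a (conv b c) = conv (conv a b) c.
Proof.
move=> p0 q0 r0 la lb lc; apply/funext => t.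
have [[ma _] [mb _] [mc _]] := And3 la lb lc.
have [D D0 HD] := (lsing_conv_bound t lb lc).
have [_ /(_ t)[C C0 aC]] := la.
have mk (f g h : R -> R) : measurable_fun setT f -> measurable_fun setT g -> measurable_fun setT h ->
  measurable_fun setT (EFin \o (fun z : R * R => f (t - z.1) * (g (z.1 - z.2) * h z.2))).
  move=> mf mg mh; apply/measurable_EFinP; apply: measurable_funM.
    by apply: measurableT_comp => //; apply: measurable_funB.
  exact: measurable_conv_kernel.
have mpk := mk _ _ _ (@measurable_pk _ p) (@measurable_pk _ q) (@measurable_pk _ r).
apply: conv_assoc => //.
apply: (@integrable_norm_le _ _ R (leb \x leb)%E setT _ (fun z => (C * D) *
  (pk p (t - z.1) * (pk q (z.1 - z.2) * pk r z.2)))) => //.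
- by have /measurable_EFinP := mk _ _ _ ma mb mc.
- move=> [s x] _ /=.
  rewrite mulrACA normrM.
  have [s0|s0] := leP s 0.
    suff -> : b (s - x) * c x = 0.
      by rewrite normr0 mulr0 !mulr_ge0 ?pk_ge0.
    have [x0|x0] := leP x 0; first by rewrite (lsing_le0 lc x0) mulr0.
    by rewrite (lsing_le0 lb) ?mul0r//; lra.
  have [st|st] := leP t s.
    by rewrite (lsing_le0 la) ?subr_le0// normr0 mul0r !mulr_ge0 ?pk_ge0.
  rewrite ler_pM// ?aC ?HD//; lra.
- have Z (h : R * R -> R) : (leb \x leb)%E.-integrable setT (EFin \o h) ->
    (leb \x leb)%E.-integrable setT (EFin \o (fun z => C * D * h z)).
    move=> ih; have := integrableZl measurableT (C * D) ih.
    by apply: eq_integrable => // z _ /=; rewrite EFinM.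
  apply: Z; apply/integrable12ltyP => //=.
  apply: (@le_lt_trans _ _ (\int[leb]_x ((Gamma q * Gamma r / Gamma (q + r))%:E *
     (pk p (t - x) * pk (q + r) x)%:E))%E).
    apply: ge0_le_integral => //.
    + by move=> x _; exact: integral_ge0.
    + apply: (@measurable_fun_fubini_tonelli_F _ _ _ _ _ leb (abse \o (EFin \o (fun z : R * R => pk p (t - z.1) * (pk q (z.1 - z.2) * pk r z.2))))) => //=.
      by apply: measurableT_comp.
    + apply: emeasurable_funM => //; apply/measurable_EFinP; exact: measurable_pkpk.
    move=> s _.
    under eq_integral do rewrite ger0_norm ?mulr_ge0 ?pk_ge0// EFinM.
    rewrite ge0_integralZl_EFin ?pk_ge0//; last 2 first.
    + by move=> y _; rewrite lee_fin mulr_ge0 ?pk_ge0.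
    + by apply/measurable_EFinP; exact: measurable_pkpk.
    by rewrite integral_pk_conv// -!EFinM lee_fin mulrCA.
  rewrite ge0_integralZl_EFin//; last 3 first.
  + by move=> y _; rewrite lee_fin mulr_ge0 ?pk_ge0.
  + by apply/measurable_EFinP; exact: measurable_pkpk.
  + by rewrite divr_ge0 ?mulr_ge0 ?ltW ?Gamma_gt0// addr_gt0.
  by rewrite integral_pk_conv ?addr_gt0// -EFinM ltry.
Qed.

Lemma lsing_convC p q a b : lsing p a -> lsing q b -> conv a b = conv b a.
Proof. by move=> [ma _] [mb _]; apply/funext => t; exact: convC. Qed.

Lemma convDr a b c t :
  leb.-integrable setT (EFin \o (fun x => a (t - x) * b x)) ->
  leb.-integrable setT (EFin \o (fun x => a (t - x) * c x)) ->
  conv a (fun x => b x + c x) t = conv a b t + conv a c t.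
Proof.
move=> ib ic; rewrite /conv -RintegralD//.
by apply: eq_Rintegral => x _; rewrite mulrDr.
Qed.

Lemma convZr k a b t :
  leb.-integrable setT (EFin \o (fun x => a (t - x) * b x)) ->
  conv a (fun x => k * b x) t = k * conv a b t.
Proof.
move=> ib; rewrite /conv -RintegralZl//.
by apply: eq_Rintegral => x _; rewrite mulrCA.
Qed.

Lemma lsing_convDr p q a b c : 0 < p -> 0 < q -> lsing p a -> lsing q b -> lsing q c ->
  conv a (fun x => b x + c x) = (fun t => conv a b t + conv a c t).
Proof.
move=> p0 q0 la lb lc; apply/funext => t.
by apply: convDr; [exact: lsing_integrable p0 q0 la lb|exact: lsing_integrable p0 q0 la lc].
Qed.

Lemma lsing_convZr p q k a b : 0 < p -> 0 < q -> lsing p a -> lsing q b ->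
  conv a (fun x => k * b x) = (fun t => k * conv a b t).
Proof.
move=> p0 q0 la lb; apply/funext => t.
by apply: convZr; exact: lsing_integrable p0 q0 la lb.
Qed.

Lemma eq_conv_lt a b b' t : (forall x, x <= 0 -> a x = 0) ->
  (forall x, x <= 0 -> b x = 0) -> (forall x, x <= 0 -> b' x = 0) ->
  (forall x, 0 < x < t -> b x = b' x) -> conv a b t = conv a b' t.
Proof.
move=> a0 b0 b'0 bb; apply: eq_Rintegral => x _.
have [x0|x0] := leP x 0; first by rewrite b0// b'0.
have [xt|xt] := leP t x; first by rewrite a0 ?mul0r//; lra.
by rewrite bb// x0.
Qed.

Lemma conv_le0 a b t : (forall x, x <= 0 -> a x = 0) ->
  (forall x, x <= 0 -> b x = 0) -> t <= 0 -> conv a b t = 0.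
Proof.
move=> a0 b0 t0; rewrite /conv /Rintegral integral0_eq// => x _.
have [x0|x0] := leP x 0; first by rewrite b0// mulr0.
by rewrite a0 ?mul0r//; lra.
Qed.

End lsing.

(** * Fractional power series *)

Section mlseries.
Context {R : realType}.
Local Notation leb := (@lebesgue_measure R).
Variable al : R.
Hypothesis al0 : 0 < al.
Implicit Types (b r t x X z : R) (c : nat -> R).

(** Gamma p >= c A^p for every A >= 1; take A with A^al = 2 r + 1. *)
Lemma Gamma_growth r b : 0 <= r -> 0 < b -> exists2 D : R, 0 <= D &
  forall k : nat, r ^+ k / Gamma (al * k%:R + b) <= D * 2^-1 ^+ k.
Proof.
move=> r0 b0; pose A := (2 * r + 1) `^ al^-1.
have A1 : 1 <= A.
  rewrite -(powRr0 (2 * r + 1)) ler_powR//; first by lra.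
  by rewrite invr_ge0 ltW.
have A0 : 0 < A by exact: lt_le_trans A1.
have AE : A `^ al = 2 * r + 1.
  by rewrite -powRrM mulVf ?gt_eqF// powRr1//; lra.
pose kap := expR (- (A + 1)) / (A + 1).
have kap0 : 0 < kap by rewrite divr_gt0 ?expR_gt0//; lra.
exists (A `^ b * kap)^-1; first by rewrite invr_ge0 mulr_ge0 ?powR_ge0 ?ltW.
move=> k.
have p0 : 0 < al * k%:R + b by rewrite ltr_wpDl// mulr_ge0// ltW.
have := Gamma_ge p0 A1; rewrite -mulrA -/kap.
rewrite powRD; last by rewrite (gt_eqF A0) implybT.
rewrite powRrM AE powR_mulrn; last by lra.
move=> Gge; have r1 : 0 < 2 * r + 1 by lra.
have d0 : 0 < (2 * r + 1) ^+ k * A `^ b * kap.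
  by rewrite mulr_gt0// mulr_gt0 ?exprn_gt0 ?powR_gt0.
apply: (@le_trans _ _ (r ^+ k / ((2 * r + 1) ^+ k * A `^ b * kap))).
  by rewrite ler_wpM2l ?exprn_ge0// lef_pV2 ?posrE// Gamma_gt0.
rewrite -mulrA invfM mulrA mulrC ler_wpM2l//.
  by rewrite invr_ge0 mulr_ge0 ?powR_ge0// ltW.
rewrite -expr_div_n lerXn2r ?nnegrE ?invr_ge0//.
  by rewrite divr_ge0// ltW.
by rewrite ler_pdivrMr//; lra.
Qed.

(** These are the coefficients of the power series with a positive radius of convergence; dividing
    them by Gamma (al k + b) makes the radius infinite. *)
Definition geom_bounded c := exists C r, [/\ 0 <= C, 0 <= r & forall k, `|c k| <= C * r ^+ k].

Lemma geom_bounded_expr r : geom_bounded (fun k => r ^+ k).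
Proof.
exists 1, `|r|; split => // k; by rewrite mul1r normrX.
Qed.

Lemma geom_bounded_diffs c : geom_bounded c -> geom_bounded (fun k => k.+1%:R * c k.+1).
Proof.
move=> [C [r [C0 r0 cC]]]; exists (C * r), (2 * r); split.
- exact: mulr_ge0.
- by rewrite mulr_ge0.
move=> k; rewrite normrM normr_nat.
apply: (@le_trans _ _ (2 ^+ k * (C * r ^+ k.+1))).
  rewrite ler_pM// -natrX ler_nat.
  exact: ltn_expl.
rewrite exprMn exprS le_eqVlt; apply/orP; left; apply/eqP; ring.
Qed.

Lemma geom_bounded_shift c : geom_bounded c -> geom_bounded (fun k => if k is j.+1 then c j else 0).
Proof.
move=> [C [r [C0 r0 cC]]]; exists C, (r + 1); split => //; first by rewrite addr_ge0.
move=> [|k]; first by rewrite normr0 mulr_ge0// exprn_ge0// addr_ge0.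
apply: (le_trans (cC k)); rewrite ler_wpM2l//.
apply: (@le_trans _ _ ((r + 1) ^+ k)).
  by rewrite lerXn2r ?nnegrE//; lra.
by rewrite exprSr ler_peMr ?exprn_ge0//; lra.
Qed.

Lemma geom_boundedZ l c : geom_bounded c -> geom_bounded (fun k => l * c k).
Proof.
move=> [C [r [C0 r0 cC]]]; exists (`|l| * C), r; split => //; first exact: mulr_ge0.
by move=> k; rewrite normrM -mulrA ler_wpM2l.
Qed.

(** With c_k = (- l)^k this is t^(b - 1) E_(al, b)(- l t^al). Writing it as a series of
    fractional integration kernels, rather than as a power series, makes it easy to convolve. *)
Definition frac_series c b t : R :=
  limn (series (fun k : nat => c k * gk (al * k%:R + b) t)).

Lemma idx_gt0 b (k : nat) : 0 < b -> 0 < al * k%:R + b.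
Proof. by move=> b0; rewrite ltr_wpDl// mulr_ge0// ltW. Qed.

(** Factoring out the singularity t^(b - 1) leaves a power series in t^al. *)
Lemma gk_idx b (k : nat) t : gk (al * k%:R + b) t =
  pk b t * ((t `^ al) ^+ k / Gamma (al * k%:R + b)).
Proof.
rewrite /gk /pk; case: ifPn => t0; last by rewrite !mul0r.
rewrite -addrA [in LHS]powRD; last by rewrite (gt_eqF t0) implybT.
by rewrite powRrM powR_mulrn ?powR_ge0// [in RHS]mulrA [in RHS](mulrC (t `^ (b - 1))).
Qed.

Lemma frac_term_bound c b X : geom_bounded c -> 0 < b -> exists2 D : R, 0 <= D &
  forall (k : nat) x, x <= X ->
    `|c k * gk (al * k%:R + b) x| <= D * 2^-1 ^+ k * pk b x.
Proof.
move=> [C [r [C0 r0 cC]]] b0.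
have [|D D0 HD] := @Gamma_growth (r * (Num.max 0 X) `^ al) b _ b0.
  by rewrite mulr_ge0 ?powR_ge0.
exists (C * D) => [|k x xX]; first by rewrite mulr_ge0.
have [x0|x0] := leP x 0; first by rewrite gk_le0// mulr0 normr0 pk_le0// mulr0.
rewrite gk_idx normrM normrM (ger0_norm (pk_ge0 b x)) mulrCA mulrC ler_wpM2r ?pk_ge0//.
rewrite [X in _ * X]ger0_norm; last first.
  by rewrite divr_ge0 ?exprn_ge0 ?powR_ge0// ltW// Gamma_gt0// idx_gt0.
apply: (@le_trans _ _ (C * r ^+ k * ((Num.max 0 X `^ al) ^+ k / Gamma (al * k%:R + b)))).
  rewrite ler_pM//.
    by rewrite divr_ge0 ?exprn_ge0 ?powR_ge0// ltW// Gamma_gt0// idx_gt0.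
  rewrite ler_wpM2r//; first by rewrite invr_ge0 ltW// Gamma_gt0// idx_gt0.
  rewrite lerXn2r ?nnegrE ?powR_ge0// ge0_ler_powR ?nnegrE ?(ltW al0) ?(ltW x0)//.
    by rewrite le_max lexx.
  by rewrite le_max xX orbT.
have := HD k; rewrite exprMn -!mulrA => /(ler_wpM2l C0).
by rewrite !mulrA.
Qed.

Lemma half_series_le n : series (fun k : nat => 2^-1 ^+ k : R) n <= 2.
Proof.
suff -> : series (fun k : nat => 2^-1 ^+ k : R) n = 2 - 2 * 2^-1 ^+ n.
  by rewrite gerBl mulr_ge0// exprn_ge0// invr_ge0.
elim: n => [|n IH]; first by rewrite /series/= big_geq// expr0; lra.
by rewrite seriesSr IH exprS; lra.
Qed.

Lemma half_series_cvg : cvgn (series (fun k : nat => 2^-1 ^+ k : R)).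
Proof.
apply: nondecreasing_is_cvgn.
  by apply: nondecreasing_series => k _ _; rewrite exprn_ge0// invr_ge0.
by exists 2 => _ [n _ <-]; exact: half_series_le.
Qed.

Lemma cvg_half_bound (u : nat -> R) D :
  (forall k, `|u k| <= D * 2^-1 ^+ k) -> cvgn (series u).
Proof.
move=> uD; have D0 : 0 <= D by rewrite -[D]mulr1 -(expr0 2^-1) (le_trans _ (uD 0%N)).
apply: normed_cvg; apply: (@series_le_cvg _ _ (fun k => D * 2^-1 ^+ k)) => //.
- by move=> n /=.
- by move=> n; rewrite /= mulr_ge0// exprn_ge0// invr_ge0.
- rewrite (_ : series _ = (fun n => D * series (fun k : nat => 2^-1 ^+ k) n)).
    by apply: is_cvgMr; exact: half_series_cvg.
  by apply/funext => n; rewrite /series/= mulr_sumr.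
Qed.

Lemma frac_series_cvg c b t : geom_bounded c -> 0 < b ->
  series (fun k : nat => c k * gk (al * k%:R + b) t) n @[n --> \oo]
    --> frac_series c b t.
Proof.
move=> ec b0; have [D D0 HD] := frac_term_bound t ec b0.
apply: (@cvg_half_bound _ (D * pk b t)) => k.
by rewrite mulrAC HD.
Qed.

Lemma frac_partial_bound c b X : geom_bounded c -> 0 < b -> exists2 D : R, 0 <= D &
  forall n x, x <= X ->
  `|series (fun k : nat => c k * gk (al * k%:R + b) x) n| <= D * pk b x.
Proof.
move=> ec b0; have [D D0 HD] := frac_term_bound X ec b0.
exists (D * 2); first by rewrite mulr_ge0.
move=> n x xX; rewrite /series/= (le_trans (ler_norm_sum _ _ _))//.
apply: (@le_trans _ _ (\sum_(0 <= k < n) D * 2^-1 ^+ k * pk b x)).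
  by apply: ler_sum => k _; exact: HD.
rewrite -mulr_suml ler_wpM2r ?pk_ge0// -mulr_sumr ler_wpM2l//.
exact: half_series_le.
Qed.

Lemma measurable_frac_partial c b n :
  measurable_fun setT (fun x => series (fun k : nat => c k * gk (al * k%:R + b) x) n).
Proof.
apply: measurable_sum => k; apply: measurable_funM => //.
exact: measurable_gk.
Qed.

Lemma lsing_frac_series c b : geom_bounded c -> 0 < b -> lsing b (frac_series c b).
Proof.
move=> ec b0; split.
  apply: (@measurable_fun_cvg _ _ _ _ (fun n x => series (fun k : nat => c k * gk (al * k%:R + b) x) n)).
    by move=> n; exact: measurable_frac_partial.
  by move=> x _; exact: frac_series_cvg.
move=> X; have [D D0 HD] := frac_partial_bound X ec b0.
exists D => // x xX.
have H : `|series (fun k : nat => c k * gk (al * k%:R + b) x) n| @[n --> \oo]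
    --> `|frac_series c b x| by apply: cvg_norm; exact: frac_series_cvg.
rewrite -(cvg_lim _ H)//; apply: limr_le.
  by apply: is_cvg_norm; apply: cvgP; exact: frac_series_cvg.
by apply: nearW => n; exact: HD.
Qed.

(** Termwise by the semigroup law; the partial sums have a common integrable majorant, so
    that the limit passes under the integral. *)
Lemma conv_gk_frac_series a c b : 0 < a -> 0 < b -> geom_bounded c ->
  conv (gk a) (frac_series c b) = frac_series c (a + b).
Proof.
move=> a0 b0 ec; apply/funext => t.
have [D D0 HD] := frac_partial_bound t ec b0.
pose s n x := series (fun k : nat => c k * gk (al * k%:R + b) x) n.
have ls n : lsing b (s n).
  split; first exact: measurable_frac_partial.
  move=> X; have [D' D'0 HD'] := frac_partial_bound X ec b0.
  by exists D' => // x; exact: HD'.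
have H1 : conv (gk a) (s n) t @[n --> \oo] --> conv (gk a) (frac_series c b) t.
  apply: fine_cvg; rewrite fineK; last first.
    apply: integrable_fin_num => //.
    exact: (lsing_integrable t a0 b0 (lsing_gk a0) (lsing_frac_series ec b0)).
  apply: (@dominated_cvg _ _ _ leb setT measurableT _ _
    (EFin \o (fun x => D * (gk a (t - x) * pk b x)))) => //.
  - move=> n; apply/measurable_EFinP; apply: measurable_conv_integrand.
      exact: measurable_gk.
    exact: measurable_frac_partial.
  - move=> x _; apply: cvg_EFin; first exact: nearW.
    by apply: cvgM; [exact: cvg_cst|exact: frac_series_cvg].
  - have lp : lsing b (pk b).
      split; first exact: measurable_pk.
      by move=> X; exists 1 => // x _; rewrite mul1r ger0_norm ?pk_ge0.
    have := integrableZl measurableT D (lsing_integrable t a0 b0 (lsing_gk a0) lp).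
    by apply: eq_integrable => // x _ /=; rewrite EFinM.
  - move=> n x _; rewrite lee_fin normrM mulrCA ger0_norm ?gk_ge0//.
    have [xt|xt] := leP x t; first by rewrite ler_wpM2l ?gk_ge0// HD.
    by rewrite gk_le0 ?mul0r//; lra.
have H2 n : conv (gk a) (s n) t =
    series (fun k : nat => c k * gk (al * k%:R + (a + b)) t) n.
  elim: n => [|n IH].
    rewrite /series/= big_geq// /conv /Rintegral integral0_eq// => x _.
    by rewrite /s /series/= big_geq// mulr0.
  rewrite seriesSr -IH.
  have l1 : lsing b (fun x => c n * gk (al * n%:R + b) x).
    apply: lsingZ; apply: (lsing_wk _ (lsing_gk _)); last exact: idx_gt0.
    by rewrite lerDr mulr_ge0// ltW.
  have -> : s n.+1 = fun x => s n x + c n * gk (al * n%:R + b) x.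
    by apply/funext => x; rewrite /s seriesSr.
  rewrite (lsing_convDr a0 b0 (lsing_gk a0) (ls n) l1); congr (_ + _).
  rewrite (@lsing_convZr _ a (al * n%:R + b)) ?idx_gt0//; last 2 first.
  - exact: lsing_gk.
  - by apply: lsing_gk; exact: idx_gt0.
  rewrite conv_gk//; last exact: idx_gt0.
  by congr (_ * gk _ _); ring.
apply: (cvg_unique _ H1) => //=.
rewrite (_ : (fun n => _) = series (fun k : nat => c k * gk (al * k%:R + (a + b)) t)).
  by apply: frac_series_cvg => //; rewrite addr_gt0.
by apply/funext.
Qed.

Lemma frac_seriesD c c' b t : geom_bounded c -> geom_bounded c' -> 0 < b ->
  frac_series c b t + frac_series c' b t = frac_series (fun k => c k + c' k) b t.
Proof.
move=> ec ec' b0; apply/esym/cvg_lim => //.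
rewrite (_ : series _ = fun n => series (fun k : nat => c k * gk (al * k%:R + b) t) n +
  series (fun k : nat => c' k * gk (al * k%:R + b) t) n).
  by apply: cvgD; exact: frac_series_cvg.
apply/funext => n.
by rewrite /series/= -big_split; apply: eq_bigr => k _; rewrite mulrDl.
Qed.

Lemma frac_seriesZ l c b t : geom_bounded c -> 0 < b ->
  l * frac_series c b t = frac_series (fun k => l * c k) b t.
Proof.
move=> ec b0; apply/esym/cvg_lim => //.
rewrite (_ : series _ = fun n => l * series (fun k : nat => c k * gk (al * k%:R + b) t) n).
  by apply: cvgM; [exact: cvg_cst|exact: frac_series_cvg].
apply/funext => n.
by rewrite /series/= mulr_sumr; apply: eq_bigr => k _; rewrite mulrA.
Qed.

Lemma frac_series_shift c b t : geom_bounded c -> 0 < b ->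
  frac_series c (al + b) t =
  frac_series (fun k => if k is j.+1 then c j else 0) b t.
Proof.
move=> ec b0; apply/esym/cvg_lim => //.
rewrite -cvg_shiftS /=.
rewrite (_ : (fun n => _) = series (fun k : nat => c k * gk (al * k%:R + (al + b)) t)).
  by apply: frac_series_cvg => //; rewrite addr_gt0.
apply/funext => n.
rewrite /series/= big_nat_recl//= mul0r add0r.
by apply: eq_bigr => k _; rewrite -natr1 mulrDr mulr1 addrA.
Qed.

Lemma frac_series_delta0 b t : 0 < b ->
  frac_series (fun k => (k == 0%N)%:R) b t = gk b t.
Proof.
move=> b0; apply/cvg_lim => //; rewrite -cvg_shiftS /=.
rewrite (_ : (fun n => _) = cst (gk b t)); first exact: cvg_cst.
apply/funext => n; rewrite /series/= big_nat_recl//= mulr0 add0r mul1r.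
by rewrite big1 ?addr0// => k _; rewrite mul0r.
Qed.

End mlseries.

(** * Mittag-Leffler functions *)

Section mittag_leffler.
Context {R : realType}.
Local Notation leb := (@lebesgue_measure R).
Variable al : R.
Hypothesis al0 : 0 < al.
Implicit Types (b l r t x X z : R) (c : nat -> R).

Lemma pseries_Gamma_cvg c b z : geom_bounded c -> 0 < b ->
  cvgn (pseries (fun k => c k / Gamma (al * k%:R + b)) z).
Proof.
move=> [C [r [C0 r0 cC]]] b0.
have [|D D0 HD] := @Gamma_growth R al al0 (r * `|z|) b _ b0; first exact: mulr_ge0.
apply: (@cvg_half_bound _ _ (C * D)) => k.
have g0 := Gamma_gt0 (idx_gt0 al0 k b0).
rewrite normrM normrM normrX (ger0_norm (x := _^-1)); last by rewrite invr_ge0 ltW.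
apply: (@le_trans _ _ (C * r ^+ k * (Gamma (al * k%:R + b))^-1 * `|z| ^+ k)).
  by rewrite ler_wpM2r ?exprn_ge0// ler_wpM2r// invr_ge0 ltW.
have := ler_wpM2l C0 (HD k); rewrite exprMn => h.
rewrite (_ : _ * _ = C * (r ^+ k * `|z| ^+ k / Gamma (al * k%:R + b))); last by ring.
by rewrite -[leRHS]mulrA.
Qed.

Lemma pseries_diffs_div c b :
  pseries_diffs (fun k => c k / Gamma (al * k%:R + b)) =
  (fun k : nat => (k.+1%:R * c k.+1) / Gamma (al * k%:R + (al + b))).
Proof.
apply/funext => k; rewrite /pseries_diffs -mulrA; congr (_ * (_ / Gamma _)).
by rewrite -natr1; ring.
Qed.

Lemma is_derive_pseries_Gamma c b z : geom_bounded c -> 0 < b ->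
  is_derive z 1 (fun z => limn (pseries (fun k => c k / Gamma (al * k%:R + b)) z))
   (limn (pseries (fun k => (k.+1%:R * c k.+1) / Gamma (al * k%:R + (al + b))) z)).
Proof.
move=> ec b0; rewrite -[X in is_derive _ _ _ (limn (pseries X _))]pseries_diffs_div.
apply: (@pseries_snd_diffs _ _ (`|z| + 1)).
- exact: pseries_Gamma_cvg.
- rewrite pseries_diffs_div; apply: pseries_Gamma_cvg; last exact: addr_gt0.
  exact: geom_bounded_diffs.
- rewrite pseries_diffs_div pseries_diffs_div; apply: pseries_Gamma_cvg.
    exact: (geom_bounded_diffs (geom_bounded_diffs ec)).
  by rewrite !addr_gt0.
- by rewrite (@ger0_norm _ (_ + 1)) ?addr_ge0// ltrDl.
Qed.

Lemma mittag_leffler_pseries b z :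
  mittag_leffler al b z = limn (pseries (fun k => 1 ^+ k / Gamma (al * k%:R + b)) z).
Proof.
rewrite /mittag_leffler; congr (limn (series _)); apply/funext => k.
by rewrite /= expr1n mul1r mulrC.
Qed.

(** The derivative of E_(al, b). *)
Definition ml_deriv b z : R :=
  limn (pseries (fun k => (k.+1%:R * 1 ^+ k.+1) / Gamma (al * k%:R + (al + b))) z).

Lemma is_derive_mittag_leffler b z : 0 < b ->
  is_derive z 1 (mittag_leffler al b) (ml_deriv b z).
Proof.
move=> b0.
rewrite (_ : mittag_leffler al b = fun z => limn (pseries (fun k => 1 ^+ k / Gamma (al * k%:R + b)) z)).
  by apply: is_derive_pseries_Gamma => //; exact: geom_bounded_expr.
by apply/funext => y; exact: mittag_leffler_pseries.
Qed.

Lemma continuous_mittag_leffler b : 0 < b -> continuous (mittag_leffler al b).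
Proof.
move=> b0 z; apply: differentiable_continuous; apply/derivable1_diffP.
by have [] := is_derive_mittag_leffler z b0.
Qed.

Lemma continuous_ml_deriv b : 0 < b -> continuous (ml_deriv b).
Proof.
move=> b0 z; apply: differentiable_continuous; apply/derivable1_diffP.
have [] := @is_derive_pseries_Gamma (fun k => k.+1%:R * 1 ^+ k.+1) (al + b) z _ _ => //.
  by apply: geom_bounded_diffs; exact: geom_bounded_expr.
exact: addr_gt0.
Qed.

Lemma mittag_leffler0 b : 0 < b -> mittag_leffler al b 0 = (Gamma b)^-1.
Proof.
move=> b0; apply/cvg_lim => //; rewrite -cvg_shiftS /=.
rewrite (_ : (fun n => _) = cst (Gamma b)^-1); first exact: cvg_cst.
apply/funext => n; rewrite /series/= big_nat_recl//= expr0 mul1r mulr0 add0r.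
by rewrite big1 ?addr0// => k _; rewrite exprS !mul0r.
Qed.

(** The series in the kernels gk and the power series defining the Mittag-Leffler function are the
    same function of t. *)
Lemma frac_series_pseries c b t l : geom_bounded c -> 0 < b ->
  frac_series al (fun k => c k * l ^+ k) b t =
  pk b t * limn (pseries (fun k => c k / Gamma (al * k%:R + b)) (l * t `^ al)).
Proof.
move=> ec b0; apply/cvg_lim => //.
rewrite (_ : series _ = fun n => pk b t *
   pseries (fun k => c k / Gamma (al * k%:R + b)) (l * t `^ al) n).
  by apply: cvgM; [exact: cvg_cst|exact: pseries_Gamma_cvg].
apply/funext => n; rewrite /pseries /series/= mulr_sumr.
by apply: eq_bigr => k _; rewrite gk_idx exprMn; ring.
Qed.

(** The function t^(b - 1) E_(al, b)(- l t^al), extended by 0 to the negative half-line. *)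
Definition mlk l b t : R := frac_series al (fun k => (- l) ^+ k) b t.

Lemma mlkE l b t : 0 < b ->
  mlk l b t = pk b t * mittag_leffler al b (- l * t `^ al).
Proof.
move=> b0; rewrite mittag_leffler_pseries -frac_series_pseries//; last exact: geom_bounded_expr.
by congr (frac_series _ _ _ _); apply/funext => k; rewrite expr1n mul1r.
Qed.

Lemma lsing_mlk l b : 0 < b -> lsing b (mlk l b).
Proof. by move=> b0; apply: lsing_frac_series => //; exact: geom_bounded_expr. Qed.

Lemma conv_gk_mlk a l b : 0 < a -> 0 < b -> conv (gk a) (mlk l b) = mlk l (a + b).
Proof. by move=> a0 b0; apply: conv_gk_frac_series => //; exact: geom_bounded_expr. Qed.

(** The first term of the series is split off. Together with conv_gk_mlk this is the resolvent
    equation mlk l b + l gk al * mlk l b = gk b. *)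
Lemma mlk_rec l b t : 0 < b -> mlk l b t + l * mlk l (al + b) t = gk b t.
Proof.
move=> b0; rewrite /mlk (frac_seriesZ al0)//; [|exact: geom_bounded_expr|exact: addr_gt0].
rewrite (frac_series_shift al0)//; last by apply: geom_boundedZ; exact: geom_bounded_expr.
rewrite (frac_seriesD al0)//; last 2 first.
- exact: geom_bounded_expr.
- by apply: geom_bounded_shift; apply: geom_boundedZ; exact: geom_bounded_expr.
rewrite -(@frac_series_delta0 _ al)//; congr (frac_series _ _ _ _).
apply/funext => -[|k]; first by rewrite expr0 addr0.
by rewrite exprS mulNr addNr.
Qed.

(** Minus the derivative of mlk l al with respect to l at l = 1; it carries the sign of the
    derivative of E_(al, al). *)
Definition mlm t : R := frac_series al (fun k => k.+1%:R * (- 1) ^+ k) (al + al) t.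

Let geom_bounded_m : geom_bounded (fun k => k.+1%:R * (- 1 : R) ^+ k).
Proof.
have := geom_boundedZ (-1) (geom_bounded_diffs (geom_bounded_expr (-1 : R))).
by congr geom_bounded; apply/funext => k; rewrite exprS; lra.
Qed.

Lemma mlmE t : mlm t = pk (al + al) t * ml_deriv al (- t `^ al).
Proof.
rewrite /ml_deriv -[- _]mulN1r -frac_series_pseries//; last 2 first.
- by apply: geom_bounded_diffs; exact: geom_bounded_expr.
- exact: addr_gt0.
by congr (frac_series _ _ _ _); apply/funext => k; rewrite expr1n mulr1.
Qed.

Lemma lsing_mlm : lsing (al + al) mlm.
Proof. by apply: lsing_frac_series => //; exact: addr_gt0. Qed.

(** The derivative in l, at l = 1, of the resolvent equation of mlk l al. *)
Lemma mlm_rec t : mlm t + conv (gk al) mlm t = conv (gk al) (mlk 1 al) t.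
Proof.
have aa0 : 0 < al + al by exact: addr_gt0.
rewrite [in RHS](conv_gk_mlk 1 al0 al0) /mlk /mlm.
rewrite (conv_gk_frac_series al0 al0 aa0 geom_bounded_m).
rewrite (frac_series_shift al0 t geom_bounded_m aa0).
rewrite (frac_seriesD al0 t geom_bounded_m (geom_bounded_shift geom_bounded_m) aa0).
congr (frac_series _ _ _ _); apply/funext => -[|k].
  by rewrite !expr0 mulr1 addr0.
rewrite -[k.+2%:R]natr1 exprS; ring.
Qed.

End mittag_leffler.

(** * Positivity of the Mittag-Leffler functions on the negative half-line *)

Local Opaque Gamma powR expR mittag_leffler ml_deriv mlk mlm frac_series.

Section positivity.
Context {R : realType}.
Local Notation leb := (@lebesgue_measure R).
Variable al : R.
Hypotheses (al0 : 0 < al) (al1 : al <= 1).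
Implicit Types (p r s t x z : R).

Lemma powR_anti e x y : e <= 0 -> 0 < x -> x <= y -> y `^ e <= x `^ e :> R.
Proof.
move=> e0 x0 xy; rewrite -[e]opprK ![_ `^ (- - e)]powRN.
have y0 : 0 < y by exact: lt_le_trans xy.
rewrite lef_pV2 ?posrE ?powR_gt0// ge0_ler_powR ?nnegrE ?oppr_ge0// ltW//.
Qed.

Lemma gk_anti x y : 0 < x -> x <= y -> gk al y <= gk al x.
Proof.
move=> x0 xy; rewrite /gk /pk x0 (lt_le_trans x0 xy) ler_wpM2r//.
  by rewrite invr_ge0 ltW// Gamma_gt0.
by apply: powR_anti => //; rewrite subr_le0.
Qed.

(** Log-convexity of t^(al - 1) for al <= 1. *)
Lemma gk_logconvex x s t : 0 < x -> x < s -> s <= t ->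
  gk al (t - x) * gk al s <= gk al t * gk al (s - x).
Proof.
move=> x0 xs st; rewrite /gk mulrACA [leRHS]mulrACA ler_wpM2r//.
  by rewrite -invfM invr_ge0 mulr_ge0 ?ltW ?Gamma_gt0.
have t0 : 0 < t by lra.
have [tx0 s0 sx0] : [/\ 0 < t - x, 0 < s & 0 < s - x] by split; lra.
rewrite /pk t0 tx0 s0 sx0 -!powRM ?(ltW t0) ?(ltW tx0) ?(ltW s0) ?(ltW sx0)//.
by apply: powR_anti; [rewrite subr_le0|rewrite mulr_gt0|nra].
Qed.

(** Let t0 be a first zero of w and tm a maximum point of w on a short interval [t0 - dl, t0].
    By log-convexity gk al (t0 - x) <= rho gk al (tm - x) for x < tm, where
    rho = gk al t0 / gk al tm, while rho h(tm) <= h(t0) by assumption. Subtracting rho times the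
    equation at tm from the equation at t0 gives rho w(tm) <= w(tm) g, where g is the integral of
    gk al over an interval of length 2 dl. For small dl this is impossible, as rho is bounded
    below. *)
Lemma volterra_positivity (w h : R -> R) p eta : 0 < p -> lsing p w ->
  (forall t, 0 < t -> {for t, continuous w}) ->
  0 < eta -> (forall t, 0 < t < eta -> 0 < w t) ->
  (forall t, 0 < t -> w t + conv (gk al) w t = h t) ->
  (forall t0, 0 < t0 -> (forall s, 0 < s < t0 -> 0 < w s) ->
     forall t, 0 < t < t0 -> h t * gk al t0 <= h t0 * gk al t) ->
  forall t, 0 < t -> 0 < w t.
Proof.
move=> p0 lw cw eta0 weta eqw mono t1 t10; rewrite ltNge; apply/negP => wt1.
pose Z : set R := [set t | 0 < t /\ w t <= 0].
have Zlb : lbound Z eta.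
  move=> z [z0 wz]; rewrite leNgt; apply/negP => ze.
  by have := weta z; rewrite z0 ze => /(_ isT); rewrite ltNge wz.
have hZ : has_inf Z by split; [exists t1|exists eta].
pose t0 := inf Z.
have et0 : eta <= t0 by apply: lb_le_inf => //; exists t1.
have t00 : 0 < t0 by exact: lt_le_trans et0.
have wpos s : 0 < s < t0 -> 0 < w s.
  move=> /andP[s0 st0]; rewrite ltNge; apply/negP => ws.
  have : t0 <= s by apply: ge_inf; [exists eta|].
  by rewrite leNgt st0.
have wt0 : w t0 <= 0.
  rewrite leNgt; apply/negP => wt0.
  have : \forall x \near t0, 0 < w x by apply: (cvgr_gt _ (cw t0 t00)).
  move=> /nbhs_ballP[e /= e0 be].
  have [z [z0 wz] zt] := inf_adherent e0 hZ.
  have t0z : t0 <= z by apply: ge_inf; [exists eta|].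
  have : 0 < w z.
    by apply: be; rewrite /ball/= ler0_norm ?subr_le0// opprB ltrBlDl.
  by rewrite ltNge wz.
pose rho0 := gk al t0 / gk al (t0 / 2).
have rho00 : 0 < rho0 by rewrite divr_gt0 ?gk_gt0//; lra.
have rho_le x : t0 / 2 <= x -> rho0 <= gk al t0 / gk al x.
  move=> tx; have x0 : 0 < x by apply: lt_le_trans tx; rewrite divr_gt0.
  rewrite ler_wpM2l ?gk_ge0// lef_pV2 ?posrE ?gk_gt0 ?divr_gt0//.
  by apply: gk_anti => //; rewrite divr_gt0.
clearbody rho0.
(* dl is small enough for the integral of gk al over ]0, 2 dl[ to be at most rho0 / 2. *)
pose e := rho0 * Gamma (1 + al) / 2.
have g0 : 0 < Gamma (1 + al) by rewrite Gamma_gt0// addr_gt0.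
have e0 : 0 < e by rewrite mulr_gt0// mulr_gt0.
pose dl := Num.min (t0 / 4) (e `^ al^-1 / 2).
have dl0 : 0 < dl by rewrite lt_min !divr_gt0 ?powR_gt0.
have dl1 : 2 * dl <= t0 / 2 by have : dl <= t0 / 4 by [rewrite ge_min lexx]; lra.
have dl2 : 2 * dl <= e `^ al^-1.
  by have : dl <= e `^ al^-1 / 2 by [rewrite ge_min lexx orbT]; lra.
have gdl : gk (1 + al) (2 * dl) <= rho0 / 2.
  have d20 : 0 < 2 * dl by lra.
  rewrite /gk /pk d20 ler_pdivrMr// (_ : 1 + al - 1 = al); last by ring.
  rewrite (_ : rho0 / 2 * _ = e); last by rewrite /e; ring.
  have -> : e = (e `^ al^-1) `^ al by rewrite -powRrM mulVf ?gt_eqF// powRr1// ltW.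
  by rewrite ge0_ler_powR ?nnegrE ?powR_ge0 ?(ltW al0) ?(ltW d20).
clearbody dl e t0; clear Z Zlb hZ et0 weta.
have [||tm] := @EVT_max _ w (t0 - dl) t0.
- by rewrite gerBl ltW.
- apply: continuous_in_subspaceT => x; rewrite inE/= in_itv/= => /andP[x1 x2].
  by apply: cw; lra.
rewrite in_itv/= => /andP[tm1 tm2] wmax.
have wtm : 0 < w tm.
  apply: (@lt_le_trans _ _ (w (t0 - dl))); first by apply: wpos; lra.
  by apply: wmax; rewrite in_itv/=; lra.
have tmt0 : tm < t0.
  rewrite lt_neqAle tm2 andbT; apply/eqP => tE.
  by move: wtm; rewrite tE ltNge wt0.
have tm0 : 0 < tm by lra.
(* The indicator function of a half-line which contains tm. *)
pose b x := gk 1 (x - (t0 - 2 * dl)).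
have lb : lsing 1 b.
  split.
    apply: measurableT_comp; first exact: measurable_gk.
    exact: measurable_funB.
  move=> X; exists 1 => // x _; rewrite ger0_norm ?gk_ge0// mul1r.
  have [x0|x0] := leP x (t0 - 2 * dl).
    by rewrite /b gk_le0 ?pk_ge0// subr_le0.
  by rewrite /b gk1 ?subr_gt0// /pk subrr powRr0 ifT//; lra.
have b_ge0 x : 0 <= b x by exact: gk_ge0.
have b1 x : tm <= x -> b x = 1.
  by move=> tx; rewrite /b gk1//; lra.
have cb : conv (gk al) b t0 = gk (1 + al) (2 * dl).
  transitivity (conv (gk 1) (gk al) (2 * dl)); last by rewrite conv_gk.
  rewrite (convC t0 (@measurable_gk R al) lb.1).
  apply: eq_Rintegral => x _; rewrite /b; congr (gk 1 _ * _); ring.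
clearbody b.
have [rho [rho_ge rho_conv Mo]] : exists rho, [/\ rho0 <= rho,
    forall x, 0 < x < tm -> gk al (t0 - x) <= rho * gk al (tm - x) &
    rho * h tm <= h t0].
  have gtm : 0 < gk al tm by exact: gk_gt0.
  exists (gk al t0 / gk al tm); split.
  - apply: rho_le; clear - tm1 dl1 dl0; lra.
  - move=> x /andP[x0 xtm]; rewrite mulrAC ler_pdivlMr//.
    by apply: gk_logconvex => //; exact: ltW.
  - by rewrite mulrAC ler_pdivrMr// mulrC; apply: mono => //; rewrite tm0 tmt0.
have rho_gt0 : 0 < rho by exact: lt_le_trans rho_ge.
have ib := lsing_integrable t0 al0 ltr01 (lsing_gk al0) lb.
have iw t := lsing_integrable t al0 p0 (lsing_gk al0) lw.
(* Before tm use log-convexity, after tm bound w by its maximum. *)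
have Iw : conv (gk al) w t0 <= rho * conv (gk al) w tm + w tm * conv (gk al) b t0.
  rewrite /conv -(@RintegralZl _ _ _ leb setT _ rho measurableT (iw tm)).
  rewrite -(@RintegralZl _ _ _ leb setT _ (w tm) measurableT ib) -RintegralD//; last 2 first.
  - have := integrableZl measurableT rho (iw tm).
    by apply: eq_integrable => // x _ /=; rewrite EFinM.
  - have := integrableZl measurableT (w tm) ib.
    by apply: eq_integrable => // x _ /=; rewrite EFinM.
  apply: le_Rintegral => //.
    have i1 := integrableZl measurableT rho (iw tm).
    have i2 := integrableZl measurableT (w tm) ib.
    by apply: eq_integrable (integrableD measurableT i1 i2) => // x _.
  move=> x _.
  have [x0|x0] := leP x 0.
    by rewrite (lsing_le0 lw x0) (lsing_le0 lb x0) !mulr0 addr0.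
  have [xt0|xt0] := leP t0 x.
    rewrite (gk_le0 _ (t := t0 - x)) ?subr_le0//.
    rewrite (gk_le0 _ (t := tm - x)) ?subr_le0; last exact: le_trans xt0.
    by rewrite !(mul0r, mulr0) addr0.
  have [xtm|xtm] := ltP x tm.
    apply: (@le_trans _ _ (rho * (gk al (tm - x) * w x))).
      rewrite mulrA ler_wpM2r//; first by rewrite ltW// wpos// x0.
      by apply: rho_conv; rewrite x0.
    by rewrite lerDl mulr_ge0 ?(ltW wtm)// mulr_ge0 ?gk_ge0.
  rewrite (gk_le0 _ (t := tm - x)) ?subr_le0// mul0r mulr0 add0r mulrCA b1// mulr1.
  rewrite ler_wpM2l ?gk_ge0//.
  by apply: wmax; rewrite in_itv/= (ltW xt0) andbT (le_trans tm1).
have E0 := eqw t0 t00; have Em := eqw tm tm0.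
move: Iw E0 Em gdl; rewrite cb.
move: (conv _ _ t0) (conv _ _ tm) (gk (1 + al) _) => c0 cm g Iw E0 Em gdl.
clear - rho00 wt0 wtm rho_ge Mo Iw E0 Em gdl.
have c0E : c0 = h t0 - w t0 by rewrite -E0 addrC addKr.
have cmE : cm = h tm - w tm by rewrite -Em addrC addKr.
have R2 : rho * w tm <= g * w tm.
  by move: Iw; rewrite c0E cmE mulrBr (mulrC _ g); lra.
have : rho <= g by rewrite -(ler_pM2r wtm).
lra.
Qed.

Lemma gt0_near0 (phi : R -> R) : continuous phi -> 0 < phi 0 ->
  exists2 eta : R, 0 < eta & forall t, 0 < t < eta -> 0 < phi (- t `^ al).
Proof.
move=> cphi phi0.
have : \forall x \near (0 : R), 0 < phi x by apply: (cvgr_gt _ (cphi 0)).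
move=> /nbhs_ballP[e /= e0 be]; exists (e `^ al^-1); first exact: powR_gt0.
move=> t /andP[t0 te]; apply: be.
rewrite /ball/= sub0r opprK ger0_norm ?powR_ge0//.
have -> : e = (e `^ al^-1) `^ al by rewrite -powRrM mulVf ?gt_eqF// powRr1// ltW.
by rewrite gt0_ltr_powR ?nnegrE ?powR_ge0// ltW.
Qed.

Lemma continuous_pk p t : 0 < t -> {for t, continuous (pk p)}.
Proof.
move=> t0; have c : {for t, continuous (fun x => x `^ (p - 1))}.
  apply: differentiable_continuous; apply/derivable1_diffP.
  by apply: derivable_powR; rewrite in_itv/= t0.
suff H : pk p x @[x --> t] --> pk p t by exact: H.
rewrite (_ : pk p t = t `^ (p - 1)); last by rewrite /pk t0.
apply: cvg_trans c; apply: near_eq_cvg; near=> x.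
by rewrite /pk ifT//; near: x; exact: lt_nbhsr.
Unshelve. all: by end_near.
Qed.

Lemma continuous_powRN p t : 0 < t -> {for t, continuous (fun t => - t `^ p)}.
Proof.
move=> t0; have c : {for t, continuous (fun x => x `^ p)}.
  apply: differentiable_continuous; apply/derivable1_diffP.
  by apply: derivable_powR; rewrite in_itv/= t0.
exact: cvgN c.
Qed.

Lemma continuous_pk_comp (phi : R -> R) p t : continuous phi -> 0 < t ->
  {for t, continuous (fun t => pk p t * phi (- t `^ al))}.
Proof.
move=> cphi t0; apply: cvgM; first exact: continuous_pk.
by apply: (@continuous_comp _ _ _ (fun t : R => - t `^ al) phi); [exact: continuous_powRN|exact: cphi].
Qed.

Lemma mlkE1 b t : 0 < b -> mlk al 1 b t = pk b t * mittag_leffler al b (- t `^ al).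
Proof. by move=> b0; rewrite mlkE// mulN1r. Qed.

Lemma powR_invK x : 0 < x -> (x `^ al^-1) `^ al = x.
Proof. by move=> x0; rewrite -powRrM mulVf ?gt_eqF// powRr1// ltW. Qed.

Lemma continuous_mlk1 b t : 0 < b -> 0 < t -> {for t, continuous (mlk al 1 b)}.
Proof.
move=> b0 t0; rewrite (_ : mlk al 1 b = fun t => pk b t * mittag_leffler al b (- t `^ al)).
  by apply: continuous_pk_comp => //; exact: continuous_mittag_leffler.
by apply/funext => x; rewrite mlkE1.
Qed.

Lemma mlk1_near0 b : 0 < b -> exists2 eta : R, 0 < eta & forall t, 0 < t < eta -> 0 < mlk al 1 b t.
Proof.
move=> b0; have [||eta eta0 H] := @gt0_near0 (mittag_leffler al b).
- exact: continuous_mittag_leffler.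
- by rewrite mittag_leffler0// invr_gt0 Gamma_gt0.
exists eta => // t t0e; rewrite mlkE1// mulr_gt0 ?H// pk_gt0//.
by case/andP: t0e.
Qed.

(** For h = gk al the monotonicity condition of the positivity principle is an equality. *)
Lemma mlk_al_gt0 t : 0 < t -> 0 < mlk al 1 al t.
Proof.
have [eta eta0 He] := mlk1_near0 al0.
apply: (@volterra_positivity _ (gk al) al eta) => //.
- exact: lsing_mlk.
- by move=> x x0; exact: continuous_mlk1.
- move=> x x0; rewrite conv_gk_mlk//.
  by have := @mlk_rec _ al al0 1 al x al0; rewrite mul1r.
- by move=> x x0 _ y _; rewrite mulrC.
Qed.

(** For h = gk 1 the monotonicity condition says that gk al decreases. *)
Lemma mlk_1_gt0 t : 0 < t -> 0 < mlk al 1 1 t.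
Proof.
have [eta eta0 He] := mlk1_near0 (ltr01 : 0 < 1 :> R).
apply: (@volterra_positivity _ (gk 1) 1 eta) => //.
- exact: lsing_mlk.
- by move=> x x0; exact: continuous_mlk1.
- move=> x x0; rewrite conv_gk_mlk//.
  by have := @mlk_rec _ al al0 1 1 x ltr01; rewrite mul1r.
- move=> x x0 _ y /andP[y0 yx]; rewrite !gk1// !mul1r.
  by apply: gk_anti => //; exact: ltW.
Qed.

Lemma mlk_al_le t : mlk al 1 al t <= gk al t.
Proof.
have := @mlk_rec _ al al0 1 al t al0; rewrite mul1r => <-.
rewrite lerDl -conv_gk_mlk//; apply: Rintegral_ge0 => x _.
rewrite mulr_ge0 ?gk_ge0//.
have [x0|x0] := leP x 0; first by rewrite (lsing_le0 (lsing_mlk al0 1 al0)).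
by rewrite ltW// mlk_al_gt0.
Qed.

(** Every x > 0 is of the form t^al, so that it suffices to know the sign of
    t^(al - 1) E_(al, al)(- t^al); the upper bound follows from the resolvent equation. *)
Lemma mittag_leffler_al_bounds x : 0 < x ->
  0 < mittag_leffler al al (- x) <= (Gamma al)^-1.
Proof.
move=> x0; pose t := x `^ al^-1.
have t0 : 0 < t by exact: powR_gt0.
have := mlk_al_gt0 t0; have := mlk_al_le t.
rewrite mlkE1// (powR_invK x0) ler_pM2l ?pk_gt0// pmulr_rgt0 ?pk_gt0//.
by move=> -> ->.
Qed.

Lemma mittag_leffler_1_bounds x : 0 < x -> 0 < mittag_leffler al 1 (- x) <= 1.
Proof.
move=> x0; pose t := x `^ al^-1.
have t0 : 0 < t by exact: powR_gt0.
have : mlk al 1 1 t <= gk 1 t.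
  have := @mlk_rec _ al al0 1 1 t ltr01; rewrite mul1r => <-.
  rewrite lerDl -conv_gk_mlk//; apply: Rintegral_ge0 => y _.
  rewrite mulr_ge0 ?gk_ge0//.
  have [y0|y0] := leP y 0; first by rewrite (lsing_le0 (lsing_mlk al0 1 ltr01)).
  by rewrite ltW// mlk_1_gt0.
have := mlk_1_gt0 t0.
rewrite mlkE1// (powR_invK x0) gk1// pmulr_rgt0 ?pk_gt0// => ->.
by rewrite /pk t0 subrr powRr0 mul1r.
Qed.

Lemma ml_deriv0_gt0 : 0 < ml_deriv al al 0.
Proof.
suff -> : ml_deriv al al 0 = (Gamma (al + al))^-1.
  by rewrite invr_gt0 Gamma_gt0// addr_gt0.
apply/cvg_lim => //; rewrite -cvg_shiftS /=.
rewrite (_ : (fun n => _) = cst (Gamma (al + al))^-1); first exact: cvg_cst.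
apply/funext => n; rewrite /pseries /series/= big_nat_recl; last by [].
rewrite /= expr0 expr1 !mulr1 mulr0 add0r mul1r.
by rewrite big1 ?addr0// => k _; rewrite [0 ^+ _]exprS mul0r mulr0.
Qed.

(** Here h = gk al - mlk 1 al, and h / gk al = 1 - Gamma(al) E_(al, al)(- t^al) increases as long
    as the derivative of E_(al, al) is positive at - s^al for s < t, that is, as long as mlm is
    positive: the positivity principle closes the loop. *)
Lemma mlm_gt0 t : 0 < t -> 0 < mlm al t.
Proof.
have [||eta eta0 H] := @gt0_near0 (ml_deriv al al).
- exact: continuous_ml_deriv.
- exact: ml_deriv0_gt0.
have aa0 : 0 < al + al by exact: addr_gt0.
apply: (@volterra_positivity _ (conv (gk al) (mlk al 1 al)) (al + al) eta) => //.
- exact: lsing_mlm.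
- move=> x x0; rewrite (_ : mlm al = fun t => pk (al + al) t * ml_deriv al al (- t `^ al)).
    by apply: continuous_pk_comp => //; exact: continuous_ml_deriv.
  by apply/funext => y; rewrite mlmE.
- move=> x xe; rewrite mlmE// mulr_gt0 ?H// pk_gt0//; by case/andP: xe.
- by move=> x x0; exact: mlm_rec.
move=> t0 t00 pos s /andP[s0 st0].
have hE x : conv (gk al) (mlk al 1 al) x = gk al x - mlk al 1 al x.
  rewrite conv_gk_mlk//; have := @mlk_rec _ al al0 1 al x al0; rewrite mul1r => <-.
  by rewrite addrAC subrr add0r.
rewrite !hE !mlkE1//.
suff H1 : mittag_leffler al al (- t0 `^ al) <= mittag_leffler al al (- s `^ al).
  have ps := pk_gt0 al s0; have pt := pk_gt0 al t00.
  have := ler_wpM2l (ltW (mulr_gt0 ps pt)) H1.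
  rewrite /gk; set u := pk al s; set v := pk al t0; set a := mittag_leffler _ _ _.
  set b := mittag_leffler _ _ _; set g := Gamma al => H2.
  have g0 : 0 <= g^-1 by rewrite invr_ge0 ltW// Gamma_gt0.
  have := ler_wpM2l g0 H2; lra.
have sal : s `^ al < t0 `^ al by rewrite gt0_ltr_powR ?nnegrE// ltW.
have [|||c] := @MVT _ (mittag_leffler al al) (ml_deriv al al) (- t0 `^ al) (- s `^ al).
- by rewrite ltrN2.
- by move=> x _; exact: is_derive_mittag_leffler.
- by apply: continuous_subspaceT; exact: continuous_mittag_leffler.
rewrite in_itv/= => /andP[c1 c2] E.
rewrite -subr_ge0 E mulr_ge0//; last by rewrite opprK addrC subr_ge0 ltW.
have c0 : 0 < - c by have := powR_gt0 al s0; lra.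
pose y := (- c) `^ al^-1.
have y0 : 0 < y by exact: powR_gt0.
have yE : - y `^ al = c by rewrite (powR_invK c0) opprK.
have yt : 0 < y < t0.
  rewrite y0 ltNge; apply/negP => ty.
  have : t0 `^ al <= y `^ al by rewrite ge0_ler_powR ?nnegrE// ltW.
  lra.
have := pos _ yt; rewrite mlmE// yE pmulr_rgt0 ?pk_gt0//.
exact: ltW.
Qed.

(** mlm <= gk al * mlk 1 al <= gk al * gk al = gk (al + al). *)
Lemma ml_deriv_bounds x : 0 < x ->
  0 < ml_deriv al al (- x) <= (Gamma (al + al))^-1.
Proof.
move=> x0; pose t := x `^ al^-1.
have t0 : 0 < t by exact: powR_gt0.
have aa0 : 0 < al + al by exact: addr_gt0.
have : mlm al t <= gk (al + al) t.
  rewrite -conv_gk//.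
  apply: (@le_trans _ _ (conv (gk al) (mlk al 1 al) t)).
    rewrite -mlm_rec// lerDl; apply: Rintegral_ge0 => y _.
    rewrite mulr_ge0 ?gk_ge0//.
    have [y0|y0] := leP y 0; first by rewrite (lsing_le0 (lsing_mlm al0)).
    by rewrite ltW// mlm_gt0.
  apply: le_Rintegral => //.
  - exact: lsing_integrable al0 al0 (lsing_gk al0) (lsing_mlk al0 1 al0).
  - exact: lsing_integrable al0 al0 (lsing_gk al0) (lsing_gk al0).
  - by move=> y _; rewrite ler_wpM2l ?gk_ge0// mlk_al_le.
have := mlm_gt0 t0.
rewrite mlmE// (powR_invK x0) pmulr_rgt0 ?pk_gt0// => ->.
by rewrite ler_pM2l// pk_gt0.
Qed.

End positivity.

Local Transparent Gamma powR expR mittag_leffler ml_deriv mlk mlm frac_series.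

(** * Differentiating convolutions *)

Section scalar_calculus.
Context {R : realType}.
Local Notation leb := (@lebesgue_measure R).
Implicit Types (p q t x : R) (a b f g : R -> R).

Lemma derivable1_cont (f : R -> R) t : derivable f t 1 -> {for t, continuous f}.
Proof. by move=> /derivable1_diffP/differentiable_continuous. Qed.

Lemma conv_gk1E a t : (forall x, x <= 0 -> a x = 0) ->
  conv (gk 1) a t = \int[leb]_(x in `]0, t[%classic) a x.
Proof.
move=> a0; rewrite Rintegral_mkcond; apply: eq_Rintegral => x _.
rewrite patchE; case: ifPn => [/set_mem|/negP]; rewrite ?inE/= in_itv/=.
  by move=> /andP[x0 xt]; rewrite gk1 ?subr_gt0// mul1r.
move=> /negP; rewrite negb_and -!leNgt => /orP[x0|xt]; first by rewrite a0 ?mulr0.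
by rewrite gk_le0 ?mul0r// subr_le0.
Qed.

Lemma lsing_integrable_itv p a t : 0 < p -> lsing p a ->
  leb.-integrable `[0, t]%classic (EFin \o a).
Proof.
move=> p0 la.
have H := lsing_integrable (t + 1) (ltr01 : 0 < 1 :> R) p0 (lsing_gk ltr01) la.
have : leb.-integrable `[0, t]%classic (EFin \o (fun x => gk 1 (t + 1 - x) * a x)).
  by apply: (integrableS measurableT) H.
apply: eq_integrable => // x; rewrite inE/= in_itv/= => /andP[x0 xt].
by rewrite gk1 ?mul1r//; lra.
Qed.

Lemma conv_gk1_closed p a t : 0 < p -> lsing p a -> 
  conv (gk 1) a t = \int[leb]_(x in `[0, t]%classic) a x.
Proof.
move=> p0 la; rewrite conv_gk1E; last by move=> x; exact: (lsing_le0 la).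
have ii := lsing_integrable_itv t p0 la.
rewrite Rintegral_itv_obnd_cbnd.
  rewrite Rintegral_itv_bndo_bndc//.
  apply: (integrableS _ _ _ ii) => //.
  by move=> x /=; rewrite !in_itv/= => /andP[-> /ltW ->].
apply: (integrableS _ _ _ ii) => //.
by move=> x /=; rewrite !in_itv/= => /andP[/ltW -> /ltW ->].
Qed.

(** The fundamental theorem of calculus for integrands which may be singular at 0. *)
Lemma is_derive_conv_gk1 p a t : 0 < p -> lsing p a -> 0 < t ->
  {for t, continuous a} -> is_derive t 1 (conv (gk 1) a) (a t).
Proof.
move=> p0 la t0 ca.
have t1 : t < t + 1 by rewrite ltrDl.
have [dF F'] := continuous_FTC1_closed t1 (lsing_integrable_itv (t + 1) p0 la) t0 ca.
have E : conv (gk 1) a = fun x => \int[leb]_(x in `[0, x]%classic) a x.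
  by apply/funext => x; exact: conv_gk1_closed p0 la.
rewrite E; apply: DeriveDef; first exact: dF.
by rewrite -derive1E F'.
Qed.

Definition pos f t : R := if 0 < t then f t else 0.

Lemma posE f t : 0 < t -> pos f t = f t.
Proof. by rewrite /pos => ->. Qed.

Lemma pos_le0 f t : t <= 0 -> pos f t = 0.
Proof. by rewrite /pos leNgt; case: ifP. Qed.

Lemma cont_bounded_itv f X : continuous f ->
  exists2 M : R, 0 <= M & forall x, 0 <= x <= X -> `|f x| <= M.
Proof.
move=> cf; have [X0|X0] := leP 0 X; last first.
  by exists 0 => // x /andP[x0 xX]; lra.
have cn : {within `[0, X], continuous (fun x => `|f x|)}.
  by apply: continuous_subspaceT => x; apply: cvg_norm; exact: cf.
have [c _ Hc] := EVT_max X0 cn.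
exists `|f c| => // x xX; by apply: Hc; rewrite in_itv/=.
Qed.

Lemma lsing_pos f : continuous f -> lsing 1 (pos f).
Proof.
move=> cf; split.
  apply: measurable_fun_ifT => //; first exact: measurable_fun_ltr.
  exact: continuous_measurable_fun.
move=> X; have [M M0 HM] := cont_bounded_itv X cf.
exists M => // x xX; rewrite /pos /pk subrr; case: ifPn => x0; last by rewrite normr0 mulr0.
by rewrite powRr0 mulr1 HM// (ltW x0).
Qed.

Lemma continuous_pos f t : {for t, continuous f} -> 0 < t -> {for t, continuous (pos f)}.
Proof.
move=> cf t0; suff H : pos f x @[x --> t] --> pos f t by exact: H.
rewrite posE//; apply: cvg_trans cf; apply: near_eq_cvg; near=> x.
by rewrite posE//; near: x; exact: lt_nbhsr.
Unshelve. all: by end_near.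
Qed.

(** A factor continuous across 0 absorbs the singularity of the other one. *)
Lemma continuous_conv_vanishing p a g : 0 < p -> lsing p a -> continuous g ->
  (forall x, x <= 0 -> g x = 0) -> continuous (conv a g).
Proof.
move=> p0 la cg g0 t.
have mg : measurable_fun setT g by exact: continuous_measurable_fun.
have ma : measurable_fun setT a by case: la.
have lg : lsing 1 g.
  rewrite (_ : g = pos g); first exact: lsing_pos.
  by apply/funext => x; rewrite /pos; case: ltP => // /g0.
have -> : conv a g = fun t => \int[leb]_y (g (t - y) * a y).
  by apply/funext => s; exact: convC.
have [M M0 HM] := cont_bounded_itv (t + 1) cg.
have H := @continuity_under_integral R _ _ leb (fun t y => g (t - y) * a y) setT
  measurableT (t - 1) (t + 1) _ _ (fun y => M * `|gk 1 (t + 1 - y) * a y|) _ _.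
apply: (H _ _ _ _ t); last by rewrite inE/= in_itv/=; lra.
- by move=> x _; exact: lsing_integrable ltr01 p0 lg la.
- apply: aeW => y _ x _; apply: cvgM; last exact: cvg_cst.
  apply: (@continuous_comp _ _ _ (fun x : R => x - y) g); last exact: cg.
  by apply: cvgB; [exact: cvg_id|exact: cvg_cst].
- have i := integrable_norm (lsing_integrable (t + 1) ltr01 p0 (lsing_gk ltr01) la).
  have := integrableZl measurableT M i.
  by apply: eq_integrable => // x _ /=; rewrite EFinM.
move=> x; rewrite /= in_itv/= => /andP[x1 x2]; apply: aeW => y _.
have [y0|y0] := leP y 0; first by rewrite (lsing_le0 la y0) mulr0 normr0 mulr_ge0.
have [yx|yx] := leP x y.
  by rewrite g0 ?subr_le0// mul0r normr0 mulr_ge0.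
rewrite normrM gk1 ?mul1r; last by lra.
by rewrite ler_wpM2r// HM//; lra.
Qed.

(** pos f jumps at 0. Splitting off f 0 * gk 1 leaves a continuous function, and the
    convolution of the jump is a primitive. *)
Lemma continuous_conv_pos p a f t : 0 < p -> lsing p a -> continuous f ->
  (forall x, 0 < x -> {for x, continuous a}) -> 0 < t ->
  {for t, continuous (conv a (pos f))}.
Proof.
move=> p0 la cf ca t0.
pose g x := f (Num.max x 0) - f 0.
have cg : continuous g.
  move=> x; apply: cvgB; last exact: cvg_cst.
  apply: (@continuous_comp _ _ _ (fun x : R => Num.max x 0) f); last exact: cf.
  by apply: continuous_max; [exact: cvg_id|exact: cvg_cst].
have g0 x : x <= 0 -> g x = 0 by move=> x0; rewrite /g max_r// subrr.
have lg : lsing 1 g.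
  rewrite (_ : g = pos g); first exact: lsing_pos.
  by apply/funext => x; rewrite /pos; case: ltP => // /g0.
have E : pos f = fun x => f 0 * gk 1 x + g x.
  apply/funext => x; have [x0|x0] := leP x 0.
    by rewrite pos_le0// gk_le0// g0// mulr0 addr0.
  by rewrite posE// gk1// mulr1 /g max_l ?(ltW x0)// addrC subrK.
have -> : conv a (pos f) = fun x => f 0 * conv (gk 1) a x + conv a g x.
  rewrite E (lsing_convDr p0 ltr01 la (lsingZ _ (lsing_gk ltr01)) lg).
  by rewrite (lsing_convZr _ p0 ltr01 la (lsing_gk ltr01)) (lsing_convC la (lsing_gk ltr01)).
have cc := continuous_conv_vanishing p0 la cg g0 (x := t).
apply: cvgD cc; apply: cvgM; first exact: cvg_cst.
apply: derivable1_cont.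
by have [] := is_derive_conv_gk1 p0 la t0 (ca t t0).
Qed.

End scalar_calculus.

(** * The fractional equation of a single mode *)

Local Opaque conv gk.

Section scalar_equation.
Context {R : realType}.
Local Notation leb := (@lebesgue_measure R).
(* K and e stand for t^(al - 1) E_(al, al)(- lam t^al) and E_(al, 1)(- lam t^al); only their
   relations through convolution with the fractional kernels matter. *)
Variables (al lam : R) (K e : R -> R).
Hypotheses (al0 : 0 < al) (al1 : al < 1).
Hypothesis lK : lsing al K.
Hypothesis cK : forall t, 0 < t -> {for t, continuous K}.
Hypothesis KE : conv (gk (1 - al)) K = e.
Hypothesis eK : forall t, e t = gk 1 t - lam * conv (gk 1) K t.
Hypothesis KK : forall t, K t = gk al t - lam * conv (gk al) K t.
Hypothesis e0 : e t @[t --> 0^'+] --> (1 : R).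
Variables (u0 c0 : R) (g : R -> R).
Hypothesis cg : continuous g.

Let o1 : 0 < 1 :> R := ltr01.
Let al1' : 0 < 1 - al. Proof. by rewrite subr_gt0. Qed.
Let l1 : lsing 1 (gk 1 : R -> R) := lsing_gk o1.
Let lpg : lsing 1 (pos g) := lsing_pos cg.

Lemma lsing_e : lsing 1 e.
Proof.
rewrite -KE; have := lsing_conv al1' al0 (lsing_gk al1') lK.
by rewrite subrK.
Qed.

Lemma conv_gk1_e a p : 0 < p -> lsing p a ->
  conv e a = fun t => conv (gk 1) a t - lam * conv (gk 1) (conv K a) t.
Proof.
move=> p0 la; have lKa := lsing_conv al0 p0 lK la.
have lgK := lsing_conv o1 al0 l1 lK.
have oal : 0 < 1 + al by exact: addr_gt0.
have E : e = fun t => gk 1 t + (- lam) * conv (gk 1) K t.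
  by apply/funext => t; rewrite eK mulNr.
have le2 : lsing 1 (fun t => - lam * conv (gk 1) K t).
  by apply: lsingZ; apply: (lsing_wk _ lgK); rewrite lerDl ltW.
rewrite (lsing_convC lsing_e la) {1}E (lsing_convDr p0 o1 la l1 le2).
apply/funext => t.
rewrite (lsing_convZr (- lam) p0 oal la lgK) (lsing_convC la l1).
by rewrite (lsing_convC la lgK) -(lsing_convA o1 al0 p0 l1 lK la) mulNr.
Qed.

(** The primitive of g with value c0 at 0, as a convolution: this is the form in which the source
    enters. *)
Definition primitive t := c0 * gk 1 t + conv (gk 1) (pos g) t.
Let F := primitive.

Let lF2 : lsing 1 (conv (gk 1) (pos g)).
Proof. by apply: (lsing_wk _ (lsing_conv o1 o1 l1 lpg)); rewrite lerDl. Qed.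

Lemma lsing_primitive : lsing 1 F.
Proof. by apply: lsingD => //; apply: lsingZ. Qed.
Let lF := lsing_primitive.

Lemma continuous_gk1 t : 0 < t -> {for t, continuous (gk 1 : R -> R)}.
Proof.
move=> t0; rewrite (_ : gk 1 = pos (cst 1)).
  by apply: continuous_pos => //; exact: cvg_cst.
by apply/funext => x; rewrite /pos; case: ltP => x0; [rewrite gk1|rewrite gk_le0].
Qed.

Lemma continuous_primitive t : 0 < t -> {for t, continuous F}.
Proof.
move=> t0; have c1 := continuous_gk1 t0.
have [d2 _] := is_derive_conv_gk1 o1 lpg t0 (continuous_pos (cg (x := t)) t0).
have c2 := derivable1_cont d2.
apply: (cvgD _ c2); apply: (cvgM _ c1); exact: cvg_cst.
Qed.

(* The Duhamel term and the part of its derivative which comes from g. *)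
Let D := conv K F.
Let N := conv K (pos g).

(** Moving the integration in F onto K displays the Duhamel term as a primitive. *)
Lemma duhamelE t : D t = c0 * conv (gk 1) K t + conv (gk 1) N t.
Proof.
rewrite /D (lsing_convDr al0 o1 lK (lsingZ c0 l1) lF2).
rewrite (lsing_convZr c0 al0 o1 lK l1) (lsing_convC lK l1); congr (_ + _).
rewrite (lsing_convA al0 o1 o1 lK l1 lpg) (lsing_convC lK l1).
by rewrite -(lsing_convA o1 al0 o1 l1 lK lpg).
Qed.

Lemma lsing_duhamel : lsing (al + 1) D.
Proof. exact: lsing_conv. Qed.

Lemma lsing_dduhamel : lsing (al + 1) N.
Proof. exact: lsing_conv. Qed.

Lemma continuous_dduhamel t : 0 < t -> {for t, continuous N}.
Proof. exact: (continuous_conv_pos al0 lK cg cK). Qed.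

Lemma is_derive_duhamel (t : R) : 0 < t -> is_derive t 1 D (c0 * K t + N t).
Proof.
move=> t0; have alo : 0 < al + 1 by exact: addr_gt0.
have d1 := is_derive_conv_gk1 al0 lK t0 (cK t0).
have d2 := is_derive_conv_gk1 alo lsing_dduhamel t0 (continuous_dduhamel t0).
rewrite (_ : D = fun t => c0 * conv (gk 1) K t + conv (gk 1) N t); last first.
  by apply/funext => x; exact: duhamelE.
exact: (is_deriveD (is_deriveZ c0 d1) d2).
Qed.

(** The gain of one power of lam, at the price of one derivative of the source: on the right all
    kernels are bounded uniformly in lam. *)
Lemma lam_duhamel t : lam * D t = F t - c0 * e t - conv e (pos g) t.
Proof.
rewrite (conv_gk1_e o1 lpg) eK duhamelE /F /primitive -/N.
move: (conv _ K t) (conv _ N t) (conv _ (pos g) t) (gk 1 t) => a b c d; ring.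
Qed.

Lemma is_derive_e (t : R) : 0 < t -> is_derive t 1 e (- lam * K t).
Proof.
move=> t0; rewrite (_ : e = pos (fun t => 1 - lam * conv (gk 1) K t)); last first.
  apply/funext => x; rewrite /pos; case: ltP => x0; last first.
    by rewrite (lsing_le0 lsing_e).
  by rewrite eK gk1.
have d1 := is_derive_conv_gk1 al0 lK t0 (cK t0).
have d2 := is_deriveD (is_derive_cst (1 : R) t (1 : R)) (is_deriveZ (- lam) d1).
apply: (@near_eq_is_derive _ _ _ (cst 1 + (- lam) \*: conv (gk 1) K)).
- near=> x; rewrite posE//; last by near: x; exact: lt_nbhsr.
  by rewrite -mulNr.
- by move: d2; rewrite add0r.
Unshelve. all: by end_near.
Qed.

(** The derivative of u0 e + D. *)
Definition caputo_rate t := (c0 - lam * u0) * K t + N t.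

Lemma lsing_caputo_rate : lsing al caputo_rate.
Proof.
apply: lsingD; first exact: lsingZ.
by apply: (lsing_wk _ lsing_dduhamel); rewrite lerDl.
Qed.

Lemma is_derive_caputo (t : R) : 0 < t ->
  is_derive t 1 (fun t => u0 * e t + D t) (caputo_rate t).
Proof.
move=> t0; have := is_deriveD (is_deriveZ u0 (is_derive_e t0)) (is_derive_duhamel t0).
congr (is_derive _ _ _ _); rewrite /caputo_rate /GRing.scale/=.
move: (K t) (N t) => a b; ring.
Qed.

(** Fractional integration of order 1 - al turns K into e, and lam D is given by lam_duhamel. *)
Lemma caputo_equation t :
  conv (gk (1 - al)) caputo_rate t = F t - lam * (u0 * e t + D t).
Proof.
have lN : lsing al N by apply: (lsing_wk _ lsing_dduhamel); rewrite lerDl.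
have lg := lsing_gk al1'.
rewrite (lsing_convDr al1' al0 lg (lsingZ _ lK) lN).
rewrite (lsing_convZr _ al1' al0 lg lK) KE.
rewrite (lsing_convA al1' al0 o1 lg lK lpg) KE mulrDr lam_duhamel.
by move: (F t) (e t) (conv _ _ t) => a b c; ring.
Qed.

Lemma RL_integral_solution t :
  conv (gk (1 - al)) (fun t => u0 * K t + D t) t = u0 * e t + conv e F t.
Proof.
have lD : lsing al D by apply: (lsing_wk _ lsing_duhamel); rewrite lerDl.
have lg := lsing_gk al1'.
rewrite (lsing_convDr al1' al0 lg (lsingZ _ lK) lD).
rewrite (lsing_convZr _ al1' al0 lg lK) KE.
by rewrite (lsing_convA al1' al0 o1 lg lK lF) KE.
Qed.

(** By RL_integral_solution and the equation of e, the fractional integral of the solution is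
    u0 e plus the primitive of F - lam D. *)
Lemma is_derive_RL (t : R) : 0 < t ->
  is_derive t 1 (conv (gk (1 - al)) (fun t => u0 * K t + D t))
    (F t - lam * (u0 * K t + D t)).
Proof.
move=> t0; have alo : 0 < al + 1 by exact: addr_gt0.
have -> : conv (gk (1 - al)) (fun t => u0 * K t + D t) =
    fun t => u0 * e t + (conv (gk 1) F t + (- lam) * conv (gk 1) D t).
  apply/funext => x; rewrite RL_integral_solution (conv_gk1_e o1 lF) mulNr.
  by [].
have cD : {for t, continuous D}.
  by apply: derivable1_cont; have [] := is_derive_duhamel t0.
have d1 := is_derive_conv_gk1 o1 lF t0 (continuous_primitive t0).
have d2 := is_derive_conv_gk1 alo lsing_duhamel t0 cD.
have := is_deriveD (is_deriveZ u0 (is_derive_e t0)) (is_deriveD d1 (is_deriveZ (- lam) d2)).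
congr (is_derive _ _ _ _); rewrite /GRing.scale/=.
move: (K t) (F t) (D t) => a b c; ring.
Qed.

Lemma lsing_cvg0 p a : 1 < p -> lsing p a -> a t @[t --> 0^'+] --> (0 : R).
Proof.
move=> p1 [_ /(_ 1)[C C0 HC]].
have p0 : 0 < p - 1 by rewrite subr_gt0.
have H : C * t `^ (p - 1) @[t --> 0^'+] --> (0 : R).
  by rewrite -[X in _ --> X](mulr0 C); apply: cvgM; [exact: cvg_cst|exact: powR_cvg0].
apply: norm_cvg0; apply: (squeeze_cvgr _ (cvg_cst 0) H).
near=> t; rewrite normr_ge0/=.
have t0 : 0 < t by near: t; exact: nbhs_right_gt.
have := HC t; rewrite /pk t0; apply.
by near: t; apply: nbhs_right_le.
Unshelve. all: by end_near.
Qed.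

(** The fractional integral of the solution is u0 e plus a term of order t. *)
Lemma RL_initial :
  conv (gk (1 - al)) (fun t => u0 * K t + D t) t @[t --> 0^'+] --> u0.
Proof.
rewrite (_ : conv _ _ = fun t => u0 * e t + conv e F t); last first.
  by apply/funext => t; exact: RL_integral_solution.
rewrite -[X in _ --> X]addr0; apply: cvgD.
  by rewrite -[X in _ --> X]mulr1; apply: cvgM; [exact: cvg_cst|exact: e0].
have := lsing_conv o1 o1 lsing_e lF; apply: lsing_cvg0.
by rewrite ltrDl.
Qed.

(** Convolve the equation with the resolvent kernel K: the resolvent equation of K then gives
    gk al * W = 0, hence W = 0. *)
Lemma volterra_unique p W T : 0 < p -> lsing p W ->
  (forall t, 0 < t < T -> W t = - lam * conv (gk al) W t) ->
  forall t, 0 < t < T -> W t = 0.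
Proof.
move=> p0 lW HW t tT.
have la := lsing_gk al0.
have lgW := lsing_conv al0 p0 la lW.
have alp : 0 < al + p by exact: addr_gt0.
have E1 : conv K W t = conv K (fun s => - lam * conv (gk al) W s) t.
  apply: eq_conv_lt.
  - by move=> x; exact: (lsing_le0 lK).
  - by move=> x; exact: (lsing_le0 lW).
  - by move=> x; exact: (lsing_le0 (lsingZ (- lam) lgW)).
  - move=> x /andP[x0 xt]; apply: HW; rewrite x0 (lt_trans xt)//.
    by case/andP: tT.
have lgK := lsing_conv al0 al0 la lK.
have E2 : conv K W t = conv (gk al) W t - lam * conv (conv (gk al) K) W t.
  have E : K = fun t => gk al t + (- lam) * conv (gk al) K t.
    by apply/funext => x; rewrite {1}KK mulNr.
  have aa : 0 < al + al by exact: addr_gt0.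
  have lgK' : lsing al (fun t => - lam * conv (gk al) K t).
    by apply: lsingZ; apply: (lsing_wk _ lgK); rewrite lerDl ltW.
  rewrite (lsing_convC lK lW) {1}E (lsing_convDr p0 al0 lW la lgK').
  rewrite (lsing_convZr (- lam) p0 aa lW lgK) (lsing_convC lW la).
  by rewrite (lsing_convC lW lgK) mulNr.
have E3 : conv K (conv (gk al) W) t = conv (conv (gk al) K) W t.
  by rewrite (lsing_convA al0 al0 p0 lK la lW) (lsing_convC lK la).
rewrite (HW t tT).
move: E1; rewrite (lsing_convZr (- lam) al0 alp lK lgW) E2 E3 mulNr.
move=> /eqP; rewrite -subr_eq0 opprK subrK => /eqP ->.
by rewrite mulr0.
Qed.

End scalar_equation.

(** * Fractional derivatives as convolutions, and uniqueness for a single mode *)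

Local Transparent conv gk.
Local Opaque Gamma powR expR.

Section frac_deriv.
Context {R : realType}.
Local Notation leb := (@lebesgue_measure R).
Variable (al : R).
Hypotheses (al0 : 0 < al) (al1 : al < 1).
Implicit Types (w a : R -> R) (t l T : R).

Let al1' : 0 < 1 - al. Proof. by rewrite subr_gt0. Qed.
Let G0 : 0 < Gamma (1 - al). Proof. exact: Gamma_gt0. Qed.

(** The kernel of the fractional derivatives of order al is that of the fractional integral of
    order 1 - al. *)
Lemma gk_compl x : 0 < x -> gk (1 - al) x = (Gamma (1 - al))^-1 * (x `^ al)^-1.
Proof.
move=> x0; rewrite /gk /pk x0 (_ : 1 - al - 1 = - al); last by ring.
by rewrite powRN mulrC.
Qed.

Lemma frac_kernel_patch w a t : (forall x, x <= 0 -> a x = 0) ->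
  (forall x, 0 < x < t -> w x = a x) ->
  (fun x => gk (1 - al) (t - x) * a x) =
  (fun x => (Gamma (1 - al))^-1 * ((fun x => w x / (t - x) `^ al) \_ `]0, t[%classic) x).
Proof.
move=> a0 wa; apply/funext => x; rewrite patchE; case: ifPn => [/set_mem|/negP].
  rewrite /= in_itv/= => /andP[x0 xt].
  by rewrite gk_compl ?subr_gt0// wa ?x0// -mulrA (mulrC (a x)).
rewrite inE/= in_itv/= => /negP; rewrite negb_and -!leNgt mulr0 => /orP[x0|xt].
  by rewrite a0 ?mulr0.
by rewrite gk_le0 ?mul0r// subr_le0.
Qed.

Lemma integrable_frac_kernel w a t : (forall x, x <= 0 -> a x = 0) ->
  (forall x, 0 < x < t -> w x = a x) ->
  leb.-integrable setT (EFin \o (fun x => gk (1 - al) (t - x) * a x)) <->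
  leb.-integrable `]0, t[%classic (EFin \o (fun x => w x / (t - x) `^ al)).
Proof.
move=> a0 wa; rewrite (frac_kernel_patch a0 wa).
have E : (EFin \o (fun x => w x / (t - x) `^ al)) \_ `]0, t[%classic =
   EFin \o ((fun x => w x / (t - x) `^ al) \_ `]0, t[%classic).
  by rewrite restrict_EFin.
split => H.
  apply/integrable_mkcond => //; rewrite E.
  have := integrableZl measurableT (Gamma (1 - al)) H.
  by apply: eq_integrable => // x _ /=; rewrite -EFinM mulVKf// gt_eqF.
have /integrable_mkcond : leb.-integrable `]0, t[%classic (EFin \o (fun x => w x / (t - x) `^ al)) by exact: H.
rewrite E => /(_ (measurable_itv _)) H'.
have := integrableZl measurableT (Gamma (1 - al))^-1 H'.
by apply: eq_integrable => // x _ /=; rewrite EFinM.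
Qed.

Lemma conv_frac_kernel w a t : (forall x, x <= 0 -> a x = 0) ->
  (forall x, 0 < x < t -> w x = a x) ->
  leb.-integrable setT (EFin \o (fun x => gk (1 - al) (t - x) * a x)) ->
  conv (gk (1 - al)) a t = (Gamma (1 - al))^-1 *
    \int[leb]_(x in `]0, t[%classic) (w x / (t - x) `^ al).
Proof.
move=> a0 wa H; rewrite /conv (frac_kernel_patch a0 wa).
rewrite [in RHS]Rintegral_mkcond RintegralZl//.
move: H; rewrite (frac_kernel_patch a0 wa) => H.
have := integrableZl measurableT (Gamma (1 - al)) H.
by apply: eq_integrable => // x _ /=; rewrite -EFinM mulVKf// gt_eqF.
Qed.

(** Local singularity of the derivative already makes the defining integral converge. *)
Lemma caputo_deriv_intro w a t : lsing al a ->
  (forall x, 0 < x < t -> is_derive x 1 w (a x)) ->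
  caputo_deriv al w t (conv (gk (1 - al)) a t).
Proof.
move=> la dw.
have a0 x : x <= 0 -> a x = 0 by exact: (lsing_le0 la).
have E x : 0 < x < t -> derive1 w x = a x.
  by move=> xt; rewrite derive1E; have [_ ->] := dw x xt.
have H := lsing_integrable t al1' al0 (lsing_gk al1') la.
split.
- by move=> x xt; have [] := dw x xt.
- exact: (integrable_frac_kernel a0 E).1 H.
- exact: conv_frac_kernel.
Qed.

Lemma RL_integralE w a t : lsing al a -> (forall x, 0 < x < t -> w x = a x) ->
  RL_integral al w t = conv (gk (1 - al)) a t.
Proof.
move=> la wa; apply/esym; apply: conv_frac_kernel => //.
  by move=> x; exact: (lsing_le0 la).
exact: lsing_integrable al1' al0 (lsing_gk al1') la.
Qed.

Lemma RL_deriv_intro w a t T l : lsing al a -> 0 < t < T ->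
  (forall x, 0 < x < T -> w x = a x) ->
  is_derive t 1 (conv (gk (1 - al)) a) l -> RL_deriv al w t l.
Proof.
move=> la /andP[t0 tT] wa dl.
have a0 x : x <= 0 -> a x = 0 by exact: (lsing_le0 la).
have wa' r : r < T -> forall x, 0 < x < r -> w x = a x.
  by move=> rT x /andP[x0 xr]; apply: wa; rewrite x0 (lt_trans xr).
split.
  near=> r; apply/(integrable_frac_kernel a0 (wa' r _)).
    by near: r; exact: lt_nbhsl.
  exact: lsing_integrable al1' al0 (lsing_gk al1') la.
apply: near_eq_is_derive dl => //.
near=> r; apply/esym; apply: RL_integralE => //; apply: wa'.
by near: r; exact: lt_nbhsl.
Unshelve. all: by end_near.
Qed.

(** Composing with clamp T extends a function from [0, T] to the line and keeps it continuous. *)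
Definition clamp T x : R := Num.max 0 (Num.min x T).

Lemma clampE T x : 0 <= x <= T -> clamp T x = x.
Proof. by move=> /andP[x0 xT]; rewrite /clamp min_l// max_r. Qed.

Lemma clamp_itv T x : 0 < T -> 0 <= clamp T x <= T.
Proof.
move=> T0; rewrite /clamp le_max lexx/= ge_max (ltW T0)/=.
by rewrite ge_min lexx orbT.
Qed.

Lemma continuous_clamp T : continuous (clamp T).
Proof.
move=> x; apply: (@continuous_max _ _ (cst 0) (fun x => Num.min x T)).
  exact: cvg_cst.
by apply: (@continuous_min _ _ id (cst T)); [exact: cvg_id|exact: cvg_cst].
Qed.

Lemma continuous_comp_clamp T (f : R -> R) : 0 < T ->
  (forall t, 0 <= t <= T -> f r @[r --> within `[0, T]%classic (nbhs t)] --> f t) ->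
  continuous (f \o clamp T).
Proof.
move=> T0 cf x; have cT := clamp_itv x T0.
apply: (cvg_comp (clamp T) f _ (cf _ cT)) => A /=.
rewrite /nbhs/= /within/= => HA.
have H := @continuous_clamp T x [set y | y \in `[0, T] -> A y] HA.
have {}H : \forall y \near x, clamp T y \in `[0, T] -> A (clamp T y) by exact: H.
suff : \forall y \near x, A (clamp T y) by exact.
apply: filterS H => y H1; apply: H1.
by rewrite in_itv/= clamp_itv.
Qed.

Lemma integral_conv_EFin a b t :
  leb.-integrable setT (EFin \o (fun x => a (t - x) * b x)) ->
  (\int[leb]_x (a (t - x) * b x)%:E = (conv a b t)%:E)%E.
Proof. by move=> iab; rewrite /conv fineK// integrable_fin_num. Qed.

Local Opaque conv gk pk.

Section uniqueness.
Variables (lam : R) (K : R -> R).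
Hypothesis lK : lsing al K.
Hypothesis KK : forall t, K t = gk al t - lam * conv (gk al) K t.

(** Fractional integration of order al inverts the one of order 1 - al up to a full
    integration. For a merely integrable a, Fubini's theorem applies because
    gk al * gk (1 - al) = gk 1 is bounded. *)
Lemma gk_inverse t a : measurable_fun setT a -> (forall x, x <= 0 -> a x = 0) ->
  leb.-integrable setT (EFin \o a) ->
  conv (gk al) (conv (gk (1 - al)) a) t = conv (gk 1) a t.
Proof.
move=> ma a0 ia.
have E : conv (gk al) (gk (1 - al)) = gk 1.
  by rewrite (conv_gk al0 al1') (_ : al + (1 - al) = 1)// addrC subrK.
have I s : (\int[leb]_x (gk al (s - x) * gk (1 - al) x)%:E = (gk 1 s)%:E)%E.
  rewrite -E -integral_conv_EFin//.
  exact: lsing_integrable al0 al1' (lsing_gk al0) (lsing_gk al1').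
have mg := @measurable_gk R al; have mg' := @measurable_gk R (1 - al).
rewrite (conv_assoc mg mg' ma); first by rewrite E.
have mF : measurable_fun setT
   (fun z : R * R => gk al (t - z.1) * (gk (1 - al) (z.1 - z.2) * a z.2)).
  have mt1 : measurable_fun setT (fun z : R * R => t - z.1) by exact: measurable_funB.
  exact: (measurable_funM (measurableT_comp mg mt1) (measurable_conv_kernel mg' ma)).
apply/integrable21ltyP; first by apply/measurable_EFinP; exact: mF.
apply: (@le_lt_trans _ _ (\int[leb]_y `|(a y)%:E|)%E); last by case/integrableP: ia.
apply: ge0_le_integral => //.
- by move=> y _; exact: integral_ge0.
- apply: (@measurable_fun_fubini_tonelli_G _ _ _ _ _ leb (abse \o (EFin \o (fun z : R * R => gk al (t - z.1) * (gk (1 - al) (z.1 - z.2) * a z.2))))) => //=.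
  by apply: measurableT_comp => //; apply/measurable_EFinP; exact: mF.
- by apply: measurableT_comp => //; exact/measurable_EFinP.
move=> y _ /=.
have -> : (\int[leb]_x `|gk al (t - x) * (gk (1 - al) (x - y) * a y)|%:E =
   `|a y|%:E * \int[leb]_x (gk al (t - y - (x - y)) * gk (1 - al) (x - y))%:E)%E.
  rewrite -ge0_integralZl_EFin//; last 2 first.
  - by move=> x _; rewrite lee_fin mulr_ge0 ?gk_ge0.
  - have mty : measurable_fun setT (fun x : R => x - y) by exact: measurable_funB.
    apply/measurable_EFinP.
    exact: (measurableT_comp (measurable_conv_integrand (t - y) mg mg') mty).
  apply: eq_integral => x _; rewrite -EFinM; congr EFin.
  rewrite (_ : t - y - (x - y) = t - x); last by ring.
  rewrite mulrA normrM mulrC; congr (_ * _).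
  by rewrite ger0_norm// mulr_ge0 ?gk_ge0.
rewrite (integral_translate (f := fun x => (gk al (t - y - x) * gk (1 - al) x)%:E)); last first.
  by apply/measurable_EFinP; exact: measurable_conv_integrand.
rewrite I -EFinM lee_fin ler_piMr//.
by have [h|h] := leP (t - y) 0; [rewrite gk_le0|rewrite gk1].
Qed.

(** The derivative may be unbounded near 0: integrate over [x, t] and let x tend to 0. *)
Lemma FTC_improper0 (w dw : R -> R) t : 0 < t ->
  (forall x, 0 < x <= t -> {for x, continuous dw}) ->
  (forall x, 0 < x <= t -> is_derive x 1 w (dw x)) ->
  w x @[x --> 0^'+] --> (0 : R) ->
  leb.-integrable `[0, t]%classic (EFin \o dw) ->
  \int[leb]_(x in `[0, t]%classic) dw x = w t.
Proof.
move=> t0 cdw ddw w0 idw.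
have H1 : \int[leb]_(y in `[0, x]%classic) dw y @[x --> 0^'+] --> (0 : R).
  by apply: cvg_at_right_filter; exact: (parameterized_integral_cvg_left t0).
have H2 : w t - w x + \int[leb]_(y in `[0, x]%classic) dw y @[x --> 0^'+] --> w t.
  rewrite -[X in _ --> X]addr0 -[X in _ --> X + _]subr0; apply: cvgD => //.
  by apply: cvgB => //; exact: cvg_cst.
apply: (cvg_unique _ _ H2) => //.
apply: cvg_near_cst; near=> x.
have x0 : 0 < x by near: x; exact: nbhs_right_gt.
have xt : x < t by near: x; exact: nbhs_right_lt.
have cw y : 0 < y <= t -> {for y, continuous w}.
  by move=> yt; apply: derivable1_cont; have [] := ddw y yt.
have -> : w t - w x = \int[leb]_(y in `[x, t]%classic) dw y.
  rewrite /Rintegral (@continuous_FTC2 _ _ w x t)//.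
  - apply: continuous_in_subspaceT => y; rewrite inE/= in_itv/= => /andP[xy yt].
    by apply: cdw; rewrite (lt_le_trans x0).
  - split.
    + move=> y; rewrite in_itv/= => /andP[xy yt].
      by have [] := ddw y; rewrite ?(lt_trans x0)// ltW.
    + by apply: cvg_at_right_filter; apply: cw; rewrite x0 ltW.
    + by apply: cvg_at_left_filter; apply: cw; rewrite t0 lexx.
  - move=> y; rewrite in_itv/= => /andP[xy yt].
    have ylt : 0 < y <= t by rewrite (lt_trans x0 xy) ltW.
    by rewrite derive1E; have [_ ->] := ddw y ylt.
have ixt : leb.-integrable `]x, t]%classic (EFin \o dw).
  apply: (integrableS _ _ _ idw) => //.
  by move=> y /=; rewrite !in_itv/= => /andP[xy ->]; rewrite andbT ltW// (lt_trans x0).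
rewrite -Rintegral_itv_obnd_cbnd//.
rewrite -(@Rintegral_itvB _ _ (BLeft 0) (BRight t) x)//; last 2 first.
  by rewrite bnd_simp ltW.
  by rewrite bnd_simp ltW.
by rewrite subrK.
Unshelve. all: by end_near.
Qed.

(** w = gk al * (gk (1 - al) * dw) = - lam gk al * w, a homogeneous Volterra equation. To make
    sense of the convolutions, dw is restricted to an interval ]0, t'[ on which it is
    integrable. *)
Lemma caputo_unique w dw T : 0 < T ->
  (forall t, 0 <= t <= T -> w r @[r --> within `[0, T]%classic (nbhs t)] --> w t) ->
  w 0 = 0 ->
  (forall t, 0 < t < T -> {for t, continuous dw}) ->
  (forall t, 0 < t < T -> is_derive t 1 w (dw t)) ->
  (forall t, 0 < t < T -> leb.-integrable `]0, t[%classic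
     (EFin \o (fun x => dw x / (t - x) `^ al))) ->
  (forall t, 0 < t < T -> (Gamma (1 - al))^-1 *
     \int[leb]_(x in `]0, t[%classic) (dw x / (t - x) `^ al) = - lam * w t) ->
  forall t, 0 < t < T -> w t = 0.
Proof.
move=> T0 cw w0 cdw ddw idw eqw.
have cW := continuous_comp_clamp T0 cw.
pose W := pos (w \o clamp T).
have lW : lsing 1 W by exact: lsing_pos.
have WE x : 0 < x <= T -> W x = w x.
  by move=> /andP[x0 xT]; rewrite /W posE//= clampE// xT ltW.
have w0r : w x @[x --> 0^'+] --> (0 : R).
  have : (w \o clamp T) x @[x --> 0^'+] --> (0 : R).
    rewrite -[X in _ --> X](_ : (w \o clamp T) 0 = 0); last first.
      by rewrite /= clampE ?lexx ?(ltW T0).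
    by apply: cvg_at_right_filter; exact: cW.
  apply: cvg_trans; apply: near_eq_cvg; near=> x.
  rewrite /= clampE//; apply/andP; split; first by apply: ltW; near: x; exact: nbhs_right_gt.
  by near: x; exact: nbhs_right_le.
suff H t : 0 < t < T -> W t = 0.
  by move=> t /andP[t0 tT]; rewrite -WE ?t0 ?ltW//; apply: H; rewrite t0.
apply: (volterra_unique al0 lK KK ltr01 lW) => {}t /andP[t0 tT].
pose t' := (t + T) / 2.
have [tt' t'T] : t < t' /\ t' < T by rewrite /t'; split; lra.
have t'0 : 0 < t' by exact: lt_trans tt'.
clearbody t'.
have inT x : 0 < x < t' -> 0 < x < T.
  by move=> /andP[-> /= xt]; exact: lt_trans t'T.
pose a : R -> R := dw \_ `]0, t'[%classic.
have mdw : measurable_fun `]0, t'[%classic dw.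
  apply: open_continuous_measurable_fun => //.
  move=> x; rewrite inE/= in_itv/= => /andP[x0 xt].
  by apply: cdw; apply: inT; rewrite x0.
(* Integrability against (t' - x)^(- al), which is bounded below, implies integrability. *)
have idw' : leb.-integrable `]0, t'[%classic (EFin \o dw).
  apply: (@integrable_norm_le _ _ R leb _ dw (fun x => t' `^ al * `|dw x / (t' - x) `^ al|)) => //.
    move=> x /=; rewrite in_itv/= => /andP[x0 xt].
    have tx : 0 < t' - x by rewrite subr_gt0.
    rewrite normrM (ger0_norm (x := _^-1)) ?invr_ge0 ?powR_ge0// mulrCA.
    rewrite ler_peMr// ler_pdivlMr ?powR_gt0// mul1r.
    by rewrite ge0_ler_powR ?nnegrE ?(ltW al0) ?(ltW tx) ?(ltW t'0)// gerBl ltW.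
  have i1 := idw t'; rewrite t'0 t'T in i1.
  have := fun mi => integrableZl mi (t' `^ al) (integrable_norm (i1 isT)).
  move=> /(_ (measurable_itv _)).
  by apply: eq_integrable => // x _ /=; rewrite EFinM.
have ia : leb.-integrable setT (EFin \o a).
  have /integrable_mkcond : leb.-integrable `]0, t'[%classic (EFin \o dw) by [].
  by rewrite restrict_EFin; apply.
have ma : measurable_fun setT a by apply/measurable_EFinP; case/integrableP: ia.
have a0 x : x <= 0 -> a x = 0.
  move=> x0; rewrite /a patchE ifF//; apply/negbTE/negP.
  by rewrite inE/= in_itv/= => /andP[]; rewrite ltNge x0.
have aE x : 0 < x < t' -> dw x = a x.
  by move=> xt; rewrite /a patchE ifT// inE/= in_itv.
have I1 s : 0 < s < t -> conv (gk (1 - al)) a s = - lam * W s.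
  move=> /andP[s0 st]; have sT : 0 < s < T by rewrite s0 (lt_trans st).
  have aE' x : 0 < x < s -> dw x = a x.
    by move=> /andP[x0 xs]; apply: aE; rewrite x0 (lt_trans xs)// (lt_trans st).
  rewrite (conv_frac_kernel a0 aE'); last exact/(integrable_frac_kernel a0 aE')/idw.
  by rewrite eqw// WE// s0 ltW//; case/andP: sT.
have E1 : conv (gk al) (conv (gk (1 - al)) a) t = - lam * conv (gk al) W t.
  transitivity (conv (gk al) (fun s => - lam * W s) t).
    apply: eq_conv_lt => //.
    - by move=> x; exact: gk_le0.
    - by move=> x; apply: conv_le0 => // y; exact: gk_le0.
    - by move=> x x0; rewrite (lsing_le0 lW)// mulr0.
  by rewrite (lsing_convZr (- lam) al0 ltr01 (lsing_gk al0) lW).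
rewrite -E1 gk_inverse// conv_gk1E// WE ?t0 ?ltW//.
have ia' (D : set R) : measurable D -> leb.-integrable D (EFin \o a).
  by move=> mD; apply: (integrableS _ _ _ ia).
rewrite Rintegral_itv_bndo_bndc; last exact: ia'.
rewrite Rintegral_itv_obnd_cbnd; last exact: ia'.
apply/esym/FTC_improper0 => //; last exact: ia'.
- move=> x /andP[x0 xt]; have xt' : x < t' by exact: le_lt_trans tt'.
  have cx : {for x, continuous dw} by apply: cdw; rewrite x0 (lt_trans xt').
  suff : a y @[y --> x] --> a x by exact.
  rewrite -aE ?x0//; apply: cvg_trans cx; apply: near_eq_cvg; near=> y.
  by rewrite -aE//; apply/andP; split; near: y; [exact: lt_nbhsr|exact: lt_nbhsl].
- move=> x /andP[x0 xt]; have xt' : x < t' by exact: le_lt_trans tt'.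
  by rewrite -aE ?x0//; apply: ddw; rewrite x0 (lt_trans xt').
Unshelve. all: by end_near.
Qed.

Lemma derive0_cvg0 (J : R -> R) T : (forall t, 0 < t < T -> is_derive t 1 J 0) ->
  J t @[t --> 0^'+] --> (0 : R) -> forall t, 0 < t < T -> J t = 0.
Proof.
move=> dJ J0 t /andP[t0 tT].
apply: (cvg_unique _ _ J0) => //; apply: cvg_near_cst; near=> s.
have s0 : 0 < s by near: s; exact: nbhs_right_gt.
have st : s < t by near: s; exact: nbhs_right_lt.
have [||c _] := @MVT _ J (cst 0) s t st.
- by move=> x; rewrite in_itv/= => /andP[sx xt]; apply: dJ; rewrite (lt_trans s0)// (lt_trans xt).
- apply: continuous_in_subspaceT => x; rewrite inE/= in_itv/= => /andP[sx xt].
  apply: derivable1_cont.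
  by have [] := dJ x; rewrite ?(lt_le_trans s0)// (le_lt_trans xt).
by rewrite mul0r => /eqP; rewrite subr_eq0 => /eqP.
Unshelve. all: by end_near.
Qed.

(** Let W be the primitive of w. The fractional integral of w plus lam W has derivative 0 and limit
    0 at 0, hence it vanishes; fractional integration of order al turns this into
    W = - lam gk al * W. *)
Lemma RL_unique (w y : R -> R) T : 0 < T -> continuous y ->
  (forall t, 0 < t < T -> w t = pk al t * y t) ->
  (forall t, 0 < t < T -> is_derive t 1 (RL_integral al w) (- lam * w t)) ->
  RL_integral al w t @[t --> 0^'+] --> (0 : R) ->
  forall t, 0 < t < T -> w t = 0.
Proof.
move=> T0 cy wE dI I0.
pose a t := pk al t * y t.
have la : lsing al a.
  split; first by apply: measurable_funM; [exact: measurable_pk|exact: continuous_measurable_fun].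
  move=> X; have [M M0 HM] := cont_bounded_itv X cy.
  exists M => // x xX; rewrite normrM (ger0_norm (pk_ge0 _ _)) mulrC.
  have [x0|x0] := leP x 0; first by rewrite pk_le0// !mulr0.
  by rewrite ler_wpM2r ?pk_ge0// HM// xX ltW.
have ca t : 0 < t -> {for t, continuous a}.
  by move=> t0; apply: cvgM; [exact: continuous_pk|exact: cy].
have IE t : 0 < t < T -> RL_integral al w t = conv (gk (1 - al)) a t.
  move=> /andP[t0 tT]; apply: RL_integralE => // x /andP[x0 xt].
  by apply: wE; rewrite x0 (lt_trans xt).
have l1 : lsing 1 (gk 1 : R -> R) by exact: lsing_gk.
pose W := conv (gk 1) a.
have oal : 0 < 1 + al by exact: addr_gt0.
have lW : lsing (1 + al) W by exact: lsing_conv.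
have dW t : 0 < t -> is_derive t 1 W (a t).
  by move=> t0; apply: (is_derive_conv_gk1 al0 la t0); exact: ca.
have J0 : forall t, 0 < t < T -> RL_integral al w t + lam * W t = 0.
  apply: (@derive0_cvg0 (fun t => RL_integral al w t + lam * W t)).
    move=> t tT; case/andP: (tT) => t0 _.
    have := is_deriveD (dI t tT) (is_deriveZ lam (dW t t0)).
    by rewrite wE// /GRing.scale/= mulNr addNr.
  rewrite -[X in _ --> X]addr0; apply: cvgD I0 _.
  rewrite -[X in _ --> X](mulr0 lam); apply: cvgM; first exact: cvg_cst.
  by apply: lsing_cvg0 lW; rewrite ltrDl.
have HW t : 0 < t < T -> W t = - lam * conv (gk al) W t.
  move=> /andP[t0 tT].
  have <- : conv (gk al) (conv (gk (1 - al)) a) t = W t.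
    rewrite (lsing_convA al0 al1' al0 (lsing_gk al0) (lsing_gk al1') la).
    rewrite (conv_gk al0 al1') (_ : al + (1 - al) = 1)//.
    by rewrite addrC subrK.
  transitivity (conv (gk al) (fun s => - lam * W s) t); last first.
    by rewrite (lsing_convZr (- lam) al0 oal (lsing_gk al0) lW).
  apply: eq_conv_lt.
  - by move=> x; exact: gk_le0.
  - move=> x; apply: conv_le0 => z; first exact: gk_le0.
    exact: (lsing_le0 la).
  - by move=> x x0; rewrite (lsing_le0 lW)// mulr0.
  - move=> x /andP[x0 xt].
    have xT : 0 < x < T by rewrite x0 (lt_trans xt).
    rewrite -IE// mulNr; apply/eqP; rewrite -subr_eq0 opprK; apply/eqP.
    exact: J0.
have W0 := volterra_unique al0 lK KK oal lW HW.
move=> t tT; case/andP: (tT) => t0 t1; rewrite wE//.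
have d0 : is_derive t 1 W 0.
  apply: (@near_eq_is_derive _ _ _ (cst 0)) => //.
  near=> x; rewrite W0//; apply/andP; split; near: x; [exact: lt_nbhsr|exact: lt_nbhsl].
by have [_ E1] := dW t t0; have [_ E2] := d0; rewrite -[LHS]/(a t) -E1 E2.
Unshelve. all: by end_near.
Qed.

End uniqueness.
End frac_deriv.

Local Transparent Gamma powR expR.

(** * Families of square-summable sequences *)

Section l2families.
Context {R : realType}.
Local Notation leb := (@lebesgue_measure R).
Implicit Types (c d : R -> nat -> R) (a b : nat -> R) (I : set R).

Definition square_summable a : Prop :=
  exists B : R, forall M, \sum_(0 <= j < M) a j ^+ 2 <= B.

(** A bound on the squared norm, stated on partial sums so that no limit is involved. *)
Definition l2_le a (eps : R) : Prop := forall M, \sum_(0 <= j < M) a j ^+ 2 <= eps.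

(** Uniformly small tails upgrade pointwise convergence to convergence in l^2, and they are stable
    under the operations from which the solutions are built. *)
Definition equi_tails I c : Prop := forall eps : R, 0 < eps ->
  exists N, forall t, I t -> forall M, \sum_(N <= j < M) c t j ^+ 2 <= eps.

Lemma sum_sqr_ge0 a n m : 0 <= \sum_(n <= j < m) a j ^+ 2.
Proof. by apply: sumr_ge0 => j _; exact: sqr_ge0. Qed.

Lemma sum_sqr_le a N n m : (N <= n)%N -> \sum_(n <= j < m) a j ^+ 2 <= \sum_(N <= j < m) a j ^+ 2.
Proof.
move=> Nn; have [nm|mn] := leqP n m.
  by rewrite (@big_cat_nat _ _ _ n N m)//= lerDr sum_sqr_ge0.
by rewrite big_geq ?sum_sqr_ge0// ltnW.
Qed.

Lemma sum_sqrD_le a b n m : \sum_(n <= j < m) (a j + b j) ^+ 2 <=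
  2 * \sum_(n <= j < m) a j ^+ 2 + 2 * \sum_(n <= j < m) b j ^+ 2.
Proof.
rewrite !mulr_sumr -big_split/=; apply: ler_sum => j _.
by have := sqr_ge0 (a j - b j); nra.
Qed.

Lemma sum_sqrB_le a b n m : \sum_(n <= j < m) (a j - b j) ^+ 2 <=
  2 * \sum_(n <= j < m) a j ^+ 2 + 2 * \sum_(n <= j < m) b j ^+ 2.
Proof.
have := sum_sqrD_le a (fun j => - b j) n m.
by under [X in _ + _ * X]eq_bigr do rewrite sqrrN.
Qed.

(** Take N such that the N-th partial sum is close to the supremum. *)
Lemma square_summable_tail a : square_summable a -> forall eps : R, 0 < eps ->
  exists N, forall M, \sum_(N <= j < M) a j ^+ 2 <= eps.
Proof.
move=> [B HB] eps e0.
pose S := [set s | exists M, s = \sum_(0 <= j < M) a j ^+ 2].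
have hS : has_sup S.
  by split; [exists (\sum_(0 <= j < 0) a j ^+ 2), 0%N|exists B => _ [M ->]].
have [_ [N ->] HN] := sup_adherent e0 hS.
exists N => M; have [NM|MN] := leqP N M; last by rewrite big_geq ?ltW// ltnW.
have : \sum_(0 <= j < M) a j ^+ 2 <= sup S by apply: ub_le_sup; [case: hS|exists M].
rewrite (@big_cat_nat _ _ _ N 0 M)//=; lra.
Qed.

Lemma equi_tails_cst I a : square_summable a -> equi_tails I (fun=> a).
Proof. by move=> /square_summable_tail Ha eps /Ha[N HN]; exists N. Qed.

Lemma equi_tailsD I c d : equi_tails I c -> equi_tails I d ->
  equi_tails I (fun t j => c t j + d t j).
Proof.
move=> Hc Hd eps e0.
have e4 : 0 < eps / 4 by rewrite divr_gt0.
have [N HN] := Hc _ e4; have [P HP] := Hd _ e4.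
exists (maxn N P) => t It M; apply: (le_trans (sum_sqrD_le _ _ _ _)).
have := le_trans (sum_sqr_le (c t) M (leq_maxl N P)) (HN t It M).
have := le_trans (sum_sqr_le (d t) M (leq_maxr N P)) (HP t It M).
lra.
Qed.

Lemma equi_tailsM I c (m : R -> nat -> R) (C : R) : 0 <= C ->
  (forall t j, I t -> `|m t j| <= C) -> equi_tails I c ->
  equi_tails I (fun t j => m t j * c t j).
Proof.
move=> C0 mC Hc eps e0.
have e1 : 0 < eps / (C ^+ 2 + 1) by rewrite divr_gt0// ltr_wpDl// sqr_ge0.
have [N HN] := Hc _ e1; exists N => t It M.
apply: (@le_trans _ _ (C ^+ 2 * \sum_(N <= j < M) c t j ^+ 2)).
  rewrite mulr_sumr; apply: ler_sum => j _; rewrite exprMn ler_wpM2r ?sqr_ge0//.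
  by rewrite -real_normK ?num_real// lerXn2r ?nnegrE// mC.
apply: (@le_trans _ _ (C ^+ 2 * (eps / (C ^+ 2 + 1)))).
  by rewrite ler_wpM2l ?sqr_ge0// HN.
have C2 : 0 < C ^+ 2 + 1 by rewrite ltr_wpDl// sqr_ge0.
rewrite mulrCA ler_piMr ?(ltW e0)// ler_pdivrMr//; lra.
Qed.

Lemma equi_tailsS I J c : J `<=` I -> equi_tails I c -> equi_tails J c.
Proof. by move=> JI Hc eps /Hc[N HN]; exists N => t /JI; exact: HN. Qed.

Lemma eq_equi_tails I c d : (forall t j, I t -> c t j = d t j) ->
  equi_tails I c -> equi_tails I d.
Proof.
move=> cd Hc eps /Hc[N HN]; exists N => t It M.
by under eq_bigr do rewrite -cd//; exact: HN.
Qed.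

Lemma equi_tails_summable I c t : equi_tails I c -> I t -> square_summable (c t).
Proof.
move=> /(_ 1 ltr01)[N HN] It; exists (\sum_(0 <= j < N) c t j ^+ 2 + 1) => M.
have [NM|MN] := leqP N M.
  by rewrite (@big_cat_nat _ _ _ N 0 M)//= lerD2l HN.
rewrite (@big_cat_nat _ _ _ M 0 N) ?(ltnW MN)//= -addrA lerDl addr_ge0//.
exact: sum_sqr_ge0.
Qed.

(** Beyond some index everything is small uniformly; before it there are finitely many terms. *)
Lemma equi_tails_cvg (F : set_system R) {FF : Filter F} I c t :
  equi_tails I c -> I t -> (\forall r \near F, I r) ->
  (forall j, c r j @[r --> F] --> c t j) ->
  forall eps : R, 0 < eps -> \forall r \near F, l2_le (fun j => c r j - c t j) eps.
Proof.
move=> Hc It FI cc eps e0.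
have e8 : 0 < eps / 8 by rewrite divr_gt0.
have [N HN] := Hc _ e8.
have S0 : \sum_(0 <= j < N) (c r j - c t j) ^+ 2 @[r --> F] --> (0 : R).
  rewrite -[X in _ --> X](_ : \sum_(0 <= j < N) (0 : R) = 0); last by rewrite big1.
  elim: N {HN} => [|N IH].
    by rewrite big_geq//; under eq_fun do rewrite big_geq//; exact: cvg_cst.
  rewrite big_nat_recr//=; under eq_fun do rewrite big_nat_recr//=.
  apply: cvgD; first exact: IH.
  rewrite -[X in _ --> X](_ : (c t N - c t N) ^+ 2 = 0); last by rewrite subrr expr0n.
  by rewrite expr2; under eq_fun do rewrite expr2; apply: cvgM; apply: cvgB => //; exact: cvg_cst.
have S1 : \forall r \near F, \sum_(0 <= j < N) (c r j - c t j) ^+ 2 <= eps / 2.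
  by have := cvgr_le _ S0 (eps / 2); apply; rewrite divr_gt0.
near=> r => M.
have Ir : I r by near: r.
have s1 : \sum_(0 <= j < N) (c r j - c t j) ^+ 2 <= eps / 2 by near: r.
have [NM|MN] := leqP N M.
  rewrite (@big_cat_nat _ _ _ N 0 M)//=.
  have := sum_sqrB_le (c r) (c t) N M.
  have := HN r Ir M; have := HN t It M; lra.
apply: (@le_trans _ _ (\sum_(0 <= j < N) (c r j - c t j) ^+ 2)); last lra.
by rewrite (@big_cat_nat _ _ _ M 0 N) ?(ltnW MN)//= lerDl sum_sqr_ge0.
Unshelve. all: by end_near.
Qed.

(** Dini's argument: an index which works at t works near t, and [0, T] is compact. *)
Lemma l2_continuous_equi_tails (T : R) c :
  (forall t, 0 <= t <= T -> square_summable (c t)) ->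
  (forall t, 0 <= t <= T -> forall eps : R, 0 < eps ->
     \forall r \near within `[0, T]%classic (nbhs t), l2_le (fun j => c r j - c t j) eps) ->
  equi_tails `[0, T]%classic c.
Proof.
move=> sc cc eps e0.
have e4 : 0 < eps / 4 by rewrite divr_gt0.
have := @segment_compact R 0 T => /compact_near_coveringP.
move=> /(_ nat \oo (fun N t => `[0, T]%classic t -> forall M, \sum_(N <= j < M) c t j ^+ 2 <= eps) _).
case.
  move=> t /=; rewrite in_itv/= => tT.
  have [N HN] := square_summable_tail (sc t tT) e4.
  have := cc t tT _ e4; rewrite /within/= => H.
  exists ([set r | `[0, T]%classic r -> l2_le (fun j => c r j - c t j) (eps / 4)], [set n | (N <= n)%N]).
    by split; [exact: H|exists N].
  move=> [r n] [/= Hr Nn] Ir M.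
  rewrite (_ : \sum_(n <= j < M) _ = \sum_(n <= j < M) (c r j - c t j + c t j) ^+ 2).
    apply: (le_trans (sum_sqrD_le (fun j => c r j - c t j) (c t) n M)).
    have := le_trans (sum_sqr_le (c t) M Nn) (HN M).
    have := le_trans (sum_sqr_le (fun j => c r j - c t j) M (leq0n n)) (Hr Ir M).
    lra.
  by apply: eq_bigr => j _; rewrite subrK.
move=> N _ HN; exists N => t It; apply: (HN N) => //=.
Qed.

(** Minkowski's integral inequality, by duality: the sum S of the squares of the convolutions is
    the integral of their pairing with the sequence itself. Young's inequality with the weight
    G, a bound for the mass of gk al, then gives S <= S / 2 + eps / 2. *)
Lemma equi_tails_conv al (T : R) (K F : nat -> R -> R) : 0 < al -> 0 < T ->
  (forall j, measurable_fun setT (K j)) ->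
  (forall j x, 0 <= K j x <= gk al x) ->
  (forall j, continuous (F j)) ->
  equi_tails `[0, T]%classic (fun t j => F j t) ->
  equi_tails `[0, T]%classic (fun t j => conv (K j) (pos (F j)) t).
Proof.
move=> al0 T0 mK KB cF HF eps e0.
have [G G0 cG] : exists2 G : R, 0 < G &
    forall t, t <= T -> conv (gk al) (gk 1) t <= G.
  exists (gk (al + 1) T) => [|t tT]; first by rewrite gk_gt0// addr_gt0.
  by rewrite conv_gk// gk_homo// lerDr ltW.
have G1 : G != 0 by rewrite gt_eqF.
have iG0 : 0 <= (2 * G)^-1 by rewrite invr_ge0 mulr_ge0// ltW.
have e1 : 0 < eps / G ^+ 2 by rewrite divr_gt0// exprn_gt0.
have [N HN] := HF _ e1; exists N => t; rewrite /= in_itv/= => /andP[t0 tT] M.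
set h := fun j => conv (K j) (pos (F j)) t.
set S := \sum_(N <= j < M) h j ^+ 2.
have lK j : lsing al (K j).
  split => // X; have [_ /(_ X)[C C0 HC]] := lsing_gk al0; exists C => // x xX.
  have /andP[K0 Kg] := KB j x.
  by rewrite (ger0_norm K0) (le_trans Kg)// (le_trans (ler_norm _))// HC.
have lF j : lsing 1 (pos (F j)) by exact: lsing_pos.
have l1 : lsing 1 (gk 1 : R -> R) by exact: lsing_gk.
have iKF j := lsing_integrable t al0 ltr01 (lK j) (lF j).
have ig := lsing_integrable t al0 ltr01 (lsing_gk al0) l1.
(* B * gk al bounds the paired integrand. *)
pose B := (2 * G)^-1 * S + G / 2 * (eps / G ^+ 2).
have SB : S <= B * conv (gk al) (gk 1) t.
  have iT j : leb.-integrable setT (EFin \o (fun x => h j * (K j (t - x) * pos (F j) x))).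
    have := integrableZl measurableT (h j) (iKF j).
    by apply: eq_integrable => // x _ /=; rewrite EFinM.
  have iS m : leb.-integrable setT
      (EFin \o (fun x => \sum_(N <= j < m) h j * (K j (t - x) * pos (F j) x))).
    elim: m => [|m IH].
      by apply: eq_integrable (integrable0 _ _) => // x _; rewrite /= big_geq.
    have [mN|Nm] := ltnP m N.
      by apply: eq_integrable (integrable0 _ _) => // x _; rewrite /= big_geq.
    apply: eq_integrable (integrableD measurableT IH (iT m)) => // x _.
    by rewrite /= big_nat_recr.
  have SE m : \sum_(N <= j < m) h j ^+ 2 =
      \int[leb]_x (\sum_(N <= j < m) h j * (K j (t - x) * pos (F j) x)).
    elim: m => [|m IH].
      rewrite big_geq// /Rintegral integral0_eq// => x _.
      by rewrite big_geq.
    have [mN|Nm] := ltnP m N.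
      rewrite big_geq// /Rintegral integral0_eq// => x _.
      by rewrite big_geq.
    under eq_Rintegral do rewrite big_nat_recr//=.
    rewrite big_nat_recr//= RintegralD//.
    rewrite IH; congr (_ + _).
    by rewrite RintegralZl//.
  rewrite /S SE -(@convZr _ B (gk al) (gk 1) t ig) convE.
  apply: le_Rintegral => //.
    have := integrableZl measurableT B ig.
    by apply: eq_integrable => // x _ /=; rewrite -EFinM; congr EFin; ring.
  move=> x _.
  have [x0|x0] := leP x 0.
    rewrite (gk_le0 1 x0) !mulr0 big1// => j _; by rewrite pos_le0// !mulr0.
  have [xt|xt] := leP t x.
    rewrite (gk_le0 al) ?subr_le0// mul0r big1// => j _.
    by rewrite (lsing_le0 (lK j)) ?subr_le0// mul0r mulr0.
  rewrite gk1// mulr1 mulrC.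
  have gx := gk_ge0 (t - x) al0.
  apply: (@le_trans _ _ (\sum_(N <= j < M) (((2 * G)^-1 * h j ^+ 2 + G / 2 * F j x ^+ 2) * gk al (t - x)))).
    apply: ler_sum => j _; rewrite posE//.
    have /andP[K0 Kg] := KB j (t - x).
    apply: (@le_trans _ _ (`|h j * F j x| * K j (t - x))).
      by rewrite mulrCA mulrC ler_wpM2r// ler_norm.
    apply: ler_pM => //; rewrite normrM.
    have := sqr_ge0 (`|h j| - G * `|F j x|).
    rewrite -(real_normK (num_real (h j))) -(real_normK (num_real (F j x))).
    move: `|h j| `|F j x| => u v H.
    rewrite -subr_ge0 (_ : _ - _ = (2 * G)^-1 * (u - G * v) ^+ 2).
      by rewrite mulr_ge0 ?sqr_ge0.
    by field; exact: G1.
  rewrite -mulr_suml ler_wpM2r//.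
  rewrite big_split/= -!mulr_sumr lerD2l ler_wpM2l//; first by rewrite divr_ge0// ltW.
  by apply: HN; rewrite /= in_itv/= (ltW x0) (le_trans (ltW xt)).
have S0 : 0 <= S by exact: sum_sqr_ge0.
have B0 : 0 <= B.
  by rewrite addr_ge0// mulr_ge0// ?invr_ge0 ?divr_ge0 ?mulr_ge0// ?exprn_ge0// ltW.
have SB2 : S <= B * G.
  by apply: (le_trans SB); apply: ler_wpM2l => //; exact: cG.
have BG : B * G = S / 2 + eps / 2 by rewrite /B; field; exact: G1.
rewrite -/S; move: SB2; rewrite BG; lra.
Qed.

(** The mean value inequality in l^2: apply the scalar mean value theorem to the pairing with the
    error q of the difference quotient itself, truncated to finitely many terms. *)
Lemma l2_derive (T t : R) (c dc : R -> nat -> R) : 0 < t ->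
  (forall j (s : R), 0 < s -> is_derive s 1 (c^~ j) (dc s j)) ->
  (forall eps : R, 0 < eps ->
     \forall r \near within `]0, T]%classic (nbhs t), l2_le (fun j => dc r j - dc t j) eps) ->
  `]0, T]%classic t ->
  forall eps : R, 0 < eps -> \forall r \near within `]0, T]%classic (dnbhs t),
    l2_le (fun j => (c r j - c t j) / (r - t) - dc t j) eps.
Proof.
move=> t0 dcE dcc It eps e0.
have := dcc _ e0; rewrite /within/= => /nbhs_ballP[dl /= dl0 Hdl].
apply/nbhs_ballP; exists dl => //= r; rewrite /ball/= => tr rt Ir M.
have bI s : `|t - s| < dl -> `]0, T]%classic s -> l2_le (fun j => dc s j - dc t j) eps.
  by move=> ts Is; apply: Hdl.
pose q j := (c r j - c t j) / (r - t) - dc t j.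
pose phi s := \sum_(0 <= j < M) q j * (c s j - s * dc t j).
pose dphi s := \sum_(0 <= j < M) q j * (dc s j - dc t j).
have dphiE (s : R) : 0 < s -> is_derive s 1 phi (dphi s).
  move=> s0; rewrite /phi /dphi.
  elim: M {phi dphi} => [|M IH].
    rewrite big_geq//; under eq_fun do rewrite big_geq//.
    exact: is_derive_cst.
  rewrite big_nat_recr//=; under eq_fun do rewrite big_nat_recr//=.
  apply: (is_deriveD IH).
  have d1 := dcE M s s0.
  have d2 : is_derive s 1 (fun s => s * dc t M) (dc t M).
    apply: is_derive_eq; rewrite /GRing.scale/=; ring.
  exact: (is_deriveZ (q M) (is_deriveB d1 d2)).
have r0 : 0 < r by move: Ir; rewrite /= in_itv/= => /andP[].
have tT : t <= T by move: It; rewrite /= in_itv/= => /andP[].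
have rT : r <= T by move: Ir; rewrite /= in_itv/= => /andP[].
have qE j : q j = ((c r j - r * dc t j) - (c t j - t * dc t j)) / (r - t).
  by rewrite /q; field; rewrite subr_eq0.
have main (a b : R) : 0 < a -> a < b -> b <= T -> `|t - a| < dl -> `|t - b| < dl ->
    phi b - phi a = (\sum_(0 <= j < M) q j ^+ 2) * (b - a) ->
    \sum_(0 <= j < M) q j ^+ 2 <= eps.
  move=> a0 ab bT ta tb E.
  have [||xi] := @MVT _ phi dphi a b ab.
  - by move=> x; rewrite in_itv/= => /andP[ax _]; apply: dphiE; exact: lt_trans ax.
  - apply: continuous_in_subspaceT => x; rewrite inE/= in_itv/= => /andP[ax _].
    by apply: derivable1_cont; have [] := dphiE x (lt_le_trans a0 ax).
  rewrite in_itv/= => /andP[ax xb]; rewrite E => /mulIf; rewrite subr_eq0 gt_eqF// => /(_ isT) E1.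
  have Hx : l2_le (fun j => dc xi j - dc t j) eps.
    apply: bI; last by rewrite /= in_itv/= (lt_trans a0 ax)/= (le_trans (ltW xb)).
    have := ltr_normlP _ _ ta; have := ltr_normlP _ _ tb.
    by move=> [? ?] [? ?]; apply/ltr_normlP; split; lra.
  have := Hx M; have : \sum_(0 <= j < M) q j ^+ 2 <= 
     2^-1 * \sum_(0 <= j < M) q j ^+ 2 + 2^-1 * \sum_(0 <= j < M) (dc xi j - dc t j) ^+ 2.
    rewrite {1}E1 /dphi !mulr_sumr -big_split/=; apply: ler_sum => j _.
    by have := sqr_ge0 (q j - (dc xi j - dc t j)); nra.
  lra.
have phiE : phi r - phi t = (\sum_(0 <= j < M) q j ^+ 2) * (r - t).
  rewrite /phi -sumrB mulr_suml; apply: eq_bigr => j _.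
  rewrite -mulrBr expr2 -mulrA; congr (_ * _).
  by rewrite qE divfK// subr_eq0.
have [tr'|rt'|E] := ltgtP t r.
- by apply: (main t r) => //; rewrite subrr normr0.
- apply: (main r t) => //; first by rewrite subrr normr0.
  by rewrite -opprB phiE -mulrN opprB.
- by rewrite E eqxx in rt.
Qed.

End l2families.

(** * The space of square-integrable functions and the Riesz-Fischer theorem *)

Section Lfun2.
Context {d : measure_display} {T : measurableType d} {R : realType}.
Variable mu : {measure set T -> \bar R}.
Implicit Types (v w : T -> R) (c : nat -> R).
Local Notation Lfun2 v := (v \in Lfun mu 2%:E).

Definition ip v w : R := \int[mu]_x (v x * w x).

Lemma Lfun2_measurable v : Lfun2 v -> measurable_fun setT v.
Proof. by move=> /sub_Lfun_mfun; rewrite inE. Qed.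

Lemma Lfun2_ip v w : Lfun2 v -> Lfun2 w ->
  mu.-integrable setT (EFin \o (fun x => v x * w x)).
Proof. by move=> Lv Lw; apply/Lfun1_integrable; exact: Lfun2_mul_Lfun1. Qed.

Lemma Lnorm2E v : 'N[mu]_2%:E[EFin \o v]%E =
  ((\int[mu]_x (v x ^+ 2)%:E) `^ 2^-1)%E.
Proof.
rewrite unlock; congr (_ `^ _)%E; apply: eq_integral => x _ /=.
by rewrite powR_mulrn// real_normK ?num_real.
Qed.

Lemma integral_sqr v : Lfun2 v -> (\int[mu]_x (v x ^+ 2)%:E = (ip v v)%:E)%E.
Proof.
move=> Lv; rewrite /ip /Rintegral fineK; last first.
  by apply: integrable_fin_num => //; exact: Lfun2_ip.
by apply: eq_integral.
Qed.

Lemma Lfun2I v : measurable_fun setT v ->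
  (\int[mu]_x (v x ^+ 2)%:E < +oo)%E -> Lfun2 v.
Proof.
move=> mv iv; rewrite inE/=; apply/andP; split; rewrite inE//=.
by rewrite /finite_norm Lnorm2E; exact: poweR_lty.
Qed.

Lemma ip_ge0 v : 0 <= ip v v.
Proof. by apply: Rintegral_ge0 => x _; rewrite -expr2 sqr_ge0. Qed.

Lemma Lnorm2_ip v : Lfun2 v ->
  'N[mu]_2%:E[EFin \o v]%E = (Num.sqrt (ip v v))%:E.
Proof. by move=> Lv; rewrite Lnorm2E integral_sqr// poweR_EFin powR12_sqrt// ip_ge0. Qed.

Lemma Lfun2D v w : Lfun2 v -> Lfun2 w -> Lfun2 (fun x => v x + w x).
Proof.
by move=> Lv Lw; apply: (Lfun_addr_closed mu _).2 => //; rewrite lee1n.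
Qed.

Lemma Lfun2Z a v : Lfun2 v -> Lfun2 (fun x => a * v x).
Proof.
move=> Lv; rewrite (_ : (fun x => _) = a \o* v).
  by apply: Lfun_scale => //; rewrite ler1n.
by apply/funext => x /=; rewrite mulrC.
Qed.

Lemma Lfun20 : Lfun2 (fun=> 0).
Proof.
apply: Lfun2I => //; rewrite integral0_eq ?ltry// => x _.
by rewrite expr0n.
Qed.

Lemma Lfun2B v w : Lfun2 v -> Lfun2 w -> Lfun2 (fun x => v x - w x).
Proof.
move=> Lv Lw; have := Lfun2D Lv (Lfun2Z (-1) Lw).
by under eq_fun do rewrite mulN1r.
Qed.

Lemma Lfun2_sum (f : nat -> T -> R) c n : (forall j, Lfun2 (f j)) ->
  Lfun2 (fun x => \sum_(0 <= j < n) c j * f j x).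
Proof.
move=> Lf; elim: n => [|n IH].
  by under eq_fun do rewrite big_geq//; exact: Lfun20.
under eq_fun do rewrite big_nat_recr//=.
by apply: Lfun2D => //; exact: Lfun2Z.
Qed.

Lemma ipC v w : ip v w = ip w v.
Proof. by apply: eq_Rintegral => x _; rewrite mulrC. Qed.

Lemma ipDl v v' w : Lfun2 v -> Lfun2 v' -> Lfun2 w ->
  ip (fun x => v x + v' x) w = ip v w + ip v' w.
Proof.
move=> Lv Lv' Lw; rewrite /ip -RintegralD//; [|exact: Lfun2_ip..].
by apply: eq_Rintegral => x _; rewrite mulrDl.
Qed.

Lemma ipZl a v w : Lfun2 v -> Lfun2 w -> ip (fun x => a * v x) w = a * ip v w.
Proof.
move=> Lv Lw; rewrite /ip -RintegralZl//; last exact: Lfun2_ip.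
by apply: eq_Rintegral => x _; rewrite mulrA.
Qed.

Lemma ipBl v v' w : Lfun2 v -> Lfun2 v' -> Lfun2 w ->
  ip (fun x => v x - v' x) w = ip v w - ip v' w.
Proof.
move=> Lv Lv' Lw; rewrite -mulN1r -(ipZl (-1) Lv' Lw) -ipDl//; last exact: Lfun2Z.
by congr ip; apply/funext => x; rewrite mulN1r.
Qed.

Lemma ip0l w : ip (fun=> 0) w = 0.
Proof. by rewrite /ip /Rintegral integral0_eq// => x _; rewrite mul0r. Qed.

Lemma ip_suml (f : nat -> T -> R) c n w : (forall j, Lfun2 (f j)) -> Lfun2 w ->
  ip (fun x => \sum_(0 <= j < n) c j * f j x) w =
  \sum_(0 <= j < n) c j * ip (f j) w.
Proof.
move=> Lf Lw; elim: n => [|n IH].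
  by under eq_fun do rewrite big_geq//; rewrite big_geq// ip0l.
under eq_fun do rewrite big_nat_recr//=.
rewrite ipDl ?ipZl ?IH ?big_nat_recr//; first exact: Lfun2_sum.
exact: Lfun2Z.
Qed.

Lemma ipBr v w w' : Lfun2 v -> Lfun2 w -> Lfun2 w' ->
  ip v (fun x => w x - w' x) = ip v w - ip v w'.
Proof. by move=> Lv Lw Lw'; rewrite ipC ipBl// !(ipC v). Qed.

(** Discriminant of a |-> |a v - w|^2; the degenerate case |v| = 0 is separate. *)
Lemma cauchy_schwarz v w : Lfun2 v -> Lfun2 w ->
  ip v w ^+ 2 <= ip v v * ip w w.
Proof.
move=> Lv Lw.
have H a : 0 <= a ^+ 2 * ip v v - 2 * a * ip v w + ip w w.
  have := ip_ge0 (fun x => a * v x - w x).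
  rewrite ipBl//; try by [exact: Lfun2Z|apply: Lfun2B => //; exact: Lfun2Z].
  rewrite ipZl//; last by apply: Lfun2B => //; exact: Lfun2Z.
  rewrite !ipBr//; try exact: Lfun2Z.
  rewrite (ipC v (fun x => _)) (ipC w (fun x => _)) !ipZl//.
  by move: (ip v v) (ip v w) (ip w w) => x y z; lra.
have := ip_ge0 v; have := ip_ge0 w; move: H.
move: (ip v v) (ip v w) (ip w w) => x y z H z0 x0.
have [x1|x1] := ltP 0 x.
  have := H (y / x); rewrite (_ : _ + z = z - y ^+ 2 / x); last by field; rewrite gt_eqF.
  by rewrite subr_ge0 ler_pdivrMr// mulrC.
have {x0}x0 : x = 0 by apply/le_anti; rewrite x0 x1.
rewrite x0 mul0r; have [->|y0] := eqVneq y 0; first by rewrite expr0n.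
have := H ((z + 1) / (2 * y)).
by rewrite x0 mulr0 add0r (_ : _ + z = -1) ?ler0N1//; field.
Qed.

Lemma ae_eq_ip0 v w : Lfun2 v -> Lfun2 w ->
  ip (fun x => v x - w x) (fun x => v x - w x) = 0 -> \forall x \ae mu, v x = w x.
Proof.
move=> Lv Lw E.
have LB := Lfun2B Lv Lw.
have := @Lnorm_eq0_eq0 _ _ _ mu (EFin \o (fun x => v x - w x)) 2%:E.
case; first by apply/measurable_EFinP; exact: Lfun2_measurable.
  by rewrite lte_fin.
  by rewrite Lnorm2_ip// E sqrtr0.
move=> A [mA A0 HA]; exists A; split => // x /= nx; apply: HA => /= H.
by apply: nx; have [/eqP] := H I; rewrite subr_eq0 => /eqP.
Qed.

Lemma ae_eq_ipl v v' w : Lfun2 v -> measurable_fun setT v' -> Lfun2 w ->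
  (\forall x \ae mu, v x = v' x) -> ip v w = ip v' w.
Proof.
move=> Lv mv' Lw vv'; rewrite /ip /Rintegral; congr fine.
apply: ae_eq_integral => //.
- by apply/measurable_EFinP/measurable_funM; exact: Lfun2_measurable.
- by apply/measurable_EFinP/measurable_funM => //; exact: Lfun2_measurable.
- by move: vv'; apply: filterS => x E _; rewrite /= E.
Qed.

Lemma ae_eq_integral_sqr v v' : measurable_fun setT v -> measurable_fun setT v' ->
  (\forall x \ae mu, v x = v' x) ->
  (\int[mu]_x (v x ^+ 2)%:E = \int[mu]_x (v' x ^+ 2)%:E)%E.
Proof.
move=> mv mv' vv'; apply: ae_eq_integral => //.
- by apply/measurable_EFinP; exact: measurable_funX.
- by apply/measurable_EFinP; exact: measurable_funX.
- by move: vv'; apply: filterS => x E _; rewrite /= E.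
Qed.

Lemma ae_eq_Lfun2 v v' : Lfun2 v -> measurable_fun setT v' ->
  (\forall x \ae mu, v x = v' x) -> Lfun2 v'.
Proof.
move=> Lv mv' vv'; apply: Lfun2I => //.
rewrite -(ae_eq_integral_sqr (Lfun2_measurable Lv) mv' vv').
by rewrite integral_sqr// ltry.
Qed.

Variable phi : nat -> T -> R.
Hypothesis Lphi : forall j, Lfun2 (phi j).
Hypothesis phiE : forall i j, ip (phi i) (phi j) = (i == j)%:R.

Definition partial c n : T -> R := fun x => \sum_(0 <= j < n) c j * phi j x.

Lemma Lfun2_partial c n : Lfun2 (partial c n).
Proof. exact: Lfun2_sum. Qed.

Lemma ip_partial c n w : Lfun2 w ->
  ip (partial c n) w = \sum_(0 <= j < n) c j * ip (phi j) w.
Proof. exact: ip_suml. Qed.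

Lemma ip_partial_phi c n i : ip (partial c n) (phi i) = if (i < n)%N then c i else 0.
Proof.
rewrite ip_partial//; under eq_bigr do rewrite phiE.
have [ni|ni] := ltnP i n.
  rewrite (bigD1_seq i) ?mem_index_iota ?iota_uniq//= eqxx mulr1 big1 ?addr0//.
  by move=> j /negbTE ->; rewrite mulr0.
rewrite big_nat_cond big1// => j /andP[/andP[_ jn] _].
by rewrite (@ltn_eqF j i) ?mulr0// (leq_trans jn ni).
Qed.

(** Expanding the square: the squared distance of w to a partial sum is the defect in Bessel's
    inequality plus the error of the coefficients. *)
Lemma ip_sub_partial c n w : Lfun2 w ->
  ip (fun x => w x - partial c n x) (fun x => w x - partial c n x) =
  ip w w - \sum_(0 <= j < n) ip w (phi j) ^+ 2 +
  \sum_(0 <= j < n) (ip w (phi j) - c j) ^+ 2.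
Proof.
move=> Lw; have Lp := Lfun2_partial c n.
rewrite ipBl// ?ipBr//; last exact: Lfun2B.
rewrite (ipC w (partial c n)) !ip_partial//.
have -> : \sum_(0 <= j < n) c j * ip (phi j) (partial c n) = \sum_(0 <= j < n) c j ^+ 2.
  rewrite big_nat_cond [RHS]big_nat_cond; apply: eq_bigr => j /andP[/andP[_ jn] _].
  by rewrite ipC ip_partial_phi jn.
rewrite -addrA -addrA; congr (_ + _); rewrite -!sumrN -!big_split/=.
rewrite -sumrN -big_split/=; apply: eq_bigr => j _.
by rewrite (ipC (phi j)); move: (ip _ _) => y; ring.
Qed.

Lemma bessel w : Lfun2 w -> forall n, \sum_(0 <= j < n) ip w (phi j) ^+ 2 <= ip w w.
Proof.
move=> Lw n; have := ip_ge0 (fun x => w x - partial (fun j => ip w (phi j)) n x).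
rewrite ip_sub_partial// [X in _ + X]big1 ?addr0 ?subr_ge0// => j _.
by rewrite subrr expr0n.
Qed.

Lemma ip_partialB c n m : (n <= m)%N ->
  ip (fun x => partial c m x - partial c n x) (fun x => partial c m x - partial c n x) =
  \sum_(n <= j < m) c j ^+ 2.
Proof.
move=> nm; rewrite ip_sub_partial ?Lfun2_partial//.
rewrite [X in _ + X]big_nat_cond [X in _ + X]big1 ?addr0; last first.
  move=> j /andP[/andP[_ jn] _].
  by rewrite ip_partial_phi (leq_trans jn nm) subrr expr0n.
rewrite ip_partial ?Lfun2_partial//.
rewrite (@big_cat_nat _ _ _ n 0 m)//= addrAC -sumrB [X in X + _]big_nat_cond.
rewrite [X in X + _]big1 ?add0r.
  rewrite big_nat_cond [RHS]big_nat_cond; apply: eq_bigr => j /andP[/andP[_ jn] _].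
  by rewrite ipC ip_partial_phi jn.
move=> j /andP[/andP[_ jn] _].
by rewrite ipC ip_partial_phi (leq_trans jn nm) expr2 subrr.
Qed.

(** A subsequence of the partial sums converges fast enough to converge almost everywhere, and
    Fatou's lemma turns the Cauchy estimate into convergence in mean. The last conclusion
    localizes the sum to the union of the supports of the phi_j. *)
Lemma riesz_fischer c : (exists B : R, forall M, \sum_(0 <= j < M) c j ^+ 2 <= B) ->
  (forall eps : R, 0 < eps -> exists N, forall M, \sum_(N <= j < M) c j ^+ 2 <= eps) ->
  exists w, [/\ Lfun2 w, forall j, ip w (phi j) = c j &
    forall x, (forall j, phi j x = 0) -> w x = 0].
Proof.
move=> [B HB] tails.
have /choice[N HN] : forall k, exists N, forall M, \sum_(N <= j < M) c j ^+ 2 <= (8^-1 : R) ^+ k.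
  by move=> k; apply: tails; rewrite exprn_gt0.
(* The tails beyond P k have squared norm at most 8^-k. *)
pose P := fix P k := if k is k'.+1 then maxn (maxn (P k') (N k)) k else N 0%N.
have NP k : (N k <= P k)%N by case: k => //= k; rewrite !leq_max leqnn orbT.
have kP k : (k <= P k)%N by case: k => //= k; rewrite leq_max leqnn orbT.
have Pm k m : (k <= m)%N -> (P k <= P m)%N.
  by move=> /subnK <-; elim: (m - k)%N => //= i IH; rewrite (leq_trans IH)// !leq_max leqnn.
have HP k M : \sum_(P k <= j < M) c j ^+ 2 <= (8^-1 : R) ^+ k.
  apply: le_trans (HN k M); have [PM|PM] := leqP (P k) M.
    rewrite (@big_cat_nat _ _ _ (P k) (N k) M)//= lerDr.
    by apply: sumr_ge0 => j _; exact: sqr_ge0.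
  by rewrite big_geq ?(ltnW PM)//; apply: sumr_ge0 => j _; exact: sqr_ge0.
pose s k := partial c (P k).
have Ls k : Lfun2 (s k) by exact: Lfun2_partial.
pose g k x := s k.+1 x - s k x.
have Lg k : Lfun2 (g k) by exact: Lfun2B.
pose h x := (\sum_(0 <= k <oo) (2 ^+ k * g k x ^+ 2)%:E)%E.
have g0 k x : (0 <= (2 ^+ k * g k x ^+ 2)%:E)%E.
  by rewrite lee_fin mulr_ge0 ?sqr_ge0// exprn_ge0.
have mg k : measurable_fun setT (fun x => (2 ^+ k * g k x ^+ 2)%:E).
  apply/measurable_EFinP; apply: measurable_funM => //.
  by apply: measurable_funX; exact: Lfun2_measurable.
have h0 x : (0 <= h x)%E by exact: nneseries_ge0.
have mh : measurable_fun setT h.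
  apply: (@ge0_emeasurable_sum _ _ _ setT _ xpredT) => [k x _ _|k _]; [exact: g0|exact: mg].
have ih : (\int[mu]_x h x <= 2%:E)%E.
  rewrite integral_nneseries//.
  apply: le_trans (@epsilon_trick0 R 2 xpredT _); last by [].
  apply: lee_nneseries => [k _ _|k _]; first by apply: integral_ge0 => x _; exact: g0.
  under eq_integral do rewrite EFinM.
  rewrite ge0_integralZl//=.
  - rewrite integral_sqr// ip_partialB ?Pm//.
    have k0 : 0 < 2 ^+ k :> R by rewrite exprn_gt0.
    rewrite -EFinM lee_fin; apply: (le_trans (ler_wpM2l (ltW k0) (HP k _))).
    rewrite natrX exprS invfM mulrA divff// mul1r -exprMn.
    by rewrite (_ : 2 * 8^-1 = 4^-1 :> R) ?exprVn ?lef_pV2 ?posrE ?exprn_gt0// ?lerXn2r ?nnegrE ?ler_nat//; field.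
  - by apply/measurable_EFinP/measurable_funX; exact: Lfun2_measurable.
  - by move=> x _; rewrite lee_fin sqr_ge0.
(* Since |g_k| <= 2^k g_k^2 + 2^-k, the subsequence converges wherever h is finite. *)
pose A := [set x | (h x < +oo)%E].
have mA : measurable A.
  by rewrite -[A]setTI; exact: (emeasurable_fun_infty_o measurableT mh).
have aeA : \forall x \ae mu, A x.
  have : mu.-integrable setT h.
    apply/integrableP; split => //.
    under eq_integral do rewrite gee0_abs//.
    by rewrite (le_lt_trans ih)// ltry.
  move=> /(integrable_ae measurableT)[Z [mZ Z0 HZ]]; exists Z; split => // x /= nA.
  apply: HZ => /= /(_ I); rewrite ge0_fin_numE// => H; exact: nA.
pose sA k := (s k) \_ A.
have msA k : measurable_fun setT (sA k).
  apply/(measurable_restrictT (s k)) => //.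
  by apply: measurable_funTS; exact: Lfun2_measurable.
have csA x : cvgn (fun k => sA k x).
  have [hx|nhx] := pselect (A x); last first.
    rewrite (_ : (fun k => sA k x) = fun=> 0); first exact: is_cvg_cst.
    by apply/funext => k; rewrite /sA patchC// inE.
  rewrite (_ : (fun k => sA k x) = fun k => s k x); last first.
    by apply/funext => k; rewrite /sA patchT// inE.
  have hf : h x \is a fin_num by rewrite ge0_fin_numE.
  have bnd K : \sum_(0 <= k < K) 2 ^+ k * g k x ^+ 2 <= fine (h x).
    rewrite -lee_fin fineK// -sumEFin; exact: nneseries_lim_ge.
  have : cvgn (series (fun k => g k x)).
    apply: normed_cvg; apply: nondecreasing_is_cvgn.
      by apply: nondecreasing_series => k _ _; exact: normr_ge0.
    exists (fine (h x) + 1 * (1 - 2^-1)^-1) => _ [K _ <-].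
    rewrite /series/=.
    apply: (@le_trans _ _ (\sum_(0 <= k < K) (2 ^+ k * g k x ^+ 2 + 2^-1 ^+ k))).
      apply: ler_sum => k _.
      have k0 : 0 < 2 ^+ k :> R by rewrite exprn_gt0.
      have k1 : 2 ^+ k * 2^-1 ^+ k = 1 :> R by rewrite -exprMn divff// expr1n.
      have q0 : 0 <= 2^-1 ^+ k :> R by rewrite exprn_ge0// invr_ge0.
      rewrite -(real_normK (num_real (g k x))).
      move: (2 ^+ k) (2^-1 ^+ k) k0 k1 q0 `|g k x| (normr_ge0 (g k x)) => a b a0 ab b0 y y0.
      have : 0 <= b * (a * y - 1) ^+ 2 by rewrite mulr_ge0// sqr_ge0.
      rewrite (_ : b * (a * y - 1) ^+ 2 = (a * b) * a * y ^+ 2 - 2 * (a * b) * y + b); last by ring.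
      rewrite ab; nra.
    rewrite big_split/= lerD//.
    have := @geometric_le_lim R K 1 2^-1 ler01 _ _.
    rewrite /series/= /geometric/=; under eq_bigr do rewrite mul1r.
    by apply; rewrite ?normr_id ?invr_gt0// gtr0_norm ?invr_gt0// invf_lt1// ltr1n.
  rewrite (_ : series _ = (fun k => s k x - s 0%N x)).
    move=> /cvg_ex[l cl]; apply/cvg_ex; exists (l + s 0%N x).
    rewrite (_ : (fun k => s k x) = (fun k => s k x - s 0%N x + s 0%N x)).
      by apply: cvgD => //; exact: cvg_cst.
    by apply/funext => k; rewrite subrK.
  by apply/funext => k; rewrite /series/= telescope_sumr.
pose w x := limn (fun k => sA k x).
have mw : measurable_fun setT w.
  apply: (@measurable_fun_cvg _ _ _ setT sA w); first exact: msA.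
  by move=> x _; exact: csA.
have aesA k : \forall x \ae mu, s k x = sA k x.
  by move: aeA; apply: filterS => x Ax; rewrite /sA patchT// inE.
have LsA k : Lfun2 (sA k) by exact: (ae_eq_Lfun2 (Ls k) (msA k) (aesA k)).
(* Fatou's lemma for the squared distances to the m-th function of the subsequence. *)
have est m : (\int[mu]_x ((w x - sA m x) ^+ 2)%:E <= ((8^-1 : R) ^+ m)%:E)%E.
  pose f k x := ((sA (k + m)%N x - sA m x) ^+ 2)%:E.
  rewrite (_ : \int[mu]_x _ = \int[mu]_x limn_einf (f^~ x))%E; last first.
    apply: eq_integral => x _.
    suff cf : f k x @[k --> \oo] --> ((w x - sA m x) ^+ 2)%:E by rewrite (cvg_limn_einf_sup cf).1.
    apply: cvg_EFin; first by exact: nearW.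
    rewrite /f /comp/=; rewrite expr2; under eq_fun do rewrite expr2.
    have H : sA (k + m)%N x @[k --> \oo] --> w x.
      by rewrite (cvg_shiftn m (fun k => sA k x)); exact: csA.
    by apply: cvgM; apply: cvgB => //; exact: cvg_cst.
  apply: (le_trans (fatou mu measurableT _ _)).
  - move=> k; apply/measurable_EFinP/measurable_funX; exact: measurable_funB.
  - by move=> k x _; rewrite lee_fin sqr_ge0.
  have fE k : (\int[mu]_x f k x <= ((8^-1 : R) ^+ m)%:E)%E.
    have Lkm := Lfun2B (Ls (k + m)%N) (Ls m).
    rewrite -(ae_eq_integral_sqr (Lfun2_measurable Lkm)).
    - by rewrite integral_sqr// lee_fin ip_partialB ?Pm ?leq_addl.
    - exact: measurable_funB.
    - by apply: filterS2 (aesA (k + m)%N) (aesA m) => x -> ->.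
  rewrite limn_einf_lim; apply: lime_le; first exact: is_cvg_einfs.
  apply: nearW => k; apply: le_trans (fE k); apply: ereal_inf_lbound.
  by exists k => /=.
have LwA m : Lfun2 (fun x => w x - sA m x).
  apply: Lfun2I; first exact: measurable_funB.
  by rewrite (le_lt_trans (est m))// ltry.
have Lw : Lfun2 w.
  by have := Lfun2D (LwA 0%N) (LsA 0%N); under eq_fun do rewrite subrK.
have w0 x : (forall j, phi j x = 0) -> w x = 0.
  move=> px; apply/cvg_lim => //; rewrite (_ : (fun k => sA k x) = fun=> 0).
    exact: cvg_cst.
  apply/funext => k; rewrite /sA /patch; case: ifP => // _.
  by rewrite /s /partial big1// => j _; rewrite px mulr0.
exists w; split => // i.
have key m : (i < m)%N -> (ip w (phi i) - c i) ^+ 2 <= (8^-1 : R) ^+ m.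
  move=> im; have -> : ip w (phi i) - c i = ip (fun x => w x - sA m x) (phi i).
    rewrite ipBl// -(ae_eq_ipl (Ls m) (msA m) (Lphi i) (aesA m)) ip_partial_phi.
    by rewrite (leq_trans im (kP m)).
  apply: (le_trans (cauchy_schwarz (LwA m) (Lphi i))).
  rewrite phiE eqxx mulr1; have := est m.
  by rewrite integral_sqr// lee_fin.
apply/eqP; rewrite -subr_eq0 -sqrf_eq0; apply/eqP/le_anti; rewrite sqr_ge0 andbT.
have c8 : (8^-1 : R) ^+ m @[m --> \oo] --> (0 : R).
  by apply: cvg_expr; rewrite gtr0_norm ?invr_gt0// invf_lt1// ltr1n.
rewrite -[leRHS](cvg_lim _ c8)//; apply: limr_ge; first by apply/cvg_ex; exists 0.
by near=> m; apply: key; near: m; exact: nbhs_infty_gt.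
Unshelve. all: by end_near.
Qed.
End Lfun2.

(** * Expansions in an orthonormal basis of L^2(Omega) *)

Local Opaque ip.

Lemma cvg0_sqrt (R : realType) (a : nat -> R) : (forall n, 0 <= a n) ->
  (Num.sqrt (a n))%:E @[n --> \oo] --> 0%E -> a n @[n --> \oo] --> 0.
Proof.
move=> a0 /fine_cvgP[_] H.
rewrite (_ : (fun n => a n) = fun n => Num.sqrt (a n) * Num.sqrt (a n)).
  by rewrite -(mulr0 0); apply: cvgM; exact: H.
by apply/funext => n; rewrite -expr2 sqr_sqrtr.
Qed.

Section L2Omega.
Context {R : realType} {d : nat} (Omega : set 'rV[R]_d).
Local Notation mu := (lebesgue_rV R d).
Implicit Types (v w : 'rV[R]_d -> R) (c : nat -> R).

Lemma restrictM v w : (fun x => v x * w x) \_ Omega =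
  (fun x => (v \_ Omega) x * (w \_ Omega) x).
Proof. by apply/funext => x; rewrite /patch; case: ifP => // _; rewrite mul0r. Qed.

Lemma restrictD v w : (fun x => v x + w x) \_ Omega =
  (fun x => (v \_ Omega) x + (w \_ Omega) x).
Proof. by apply/funext => x; rewrite /patch; case: ifP => // _; rewrite addr0. Qed.

Lemma restrictB v w : (fun x => v x - w x) \_ Omega =
  (fun x => (v \_ Omega) x - (w \_ Omega) x).
Proof. by apply/funext => x; rewrite /patch; case: ifP => // _; rewrite subr0. Qed.

Lemma restrictZ a v : (fun x => a * v x) \_ Omega =
  (fun x => a * (v \_ Omega) x).
Proof. by apply/funext => x; rewrite /patch; case: ifP => // _; rewrite mulr0. Qed.

Lemma innerE v w : inner Omega v w = ip mu (v \_ Omega) (w \_ Omega).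
Proof. by rewrite /inner Rintegral_mkcond restrictM. Qed.

Lemma L2D v w : L2 Omega v -> L2 Omega w -> L2 Omega (fun x => v x + w x).
Proof. by rewrite /L2 restrictD; exact: Lfun2D. Qed.

Lemma L2B v w : L2 Omega v -> L2 Omega w -> L2 Omega (fun x => v x - w x).
Proof. by rewrite /L2 restrictB; exact: Lfun2B. Qed.

Lemma L2Z a v : L2 Omega v -> L2 Omega (fun x => a * v x).
Proof. by rewrite /L2 restrictZ; exact: Lfun2Z. Qed.

Lemma innerC v w : inner Omega v w = inner Omega w v.
Proof. by rewrite !innerE ipC. Qed.

Lemma innerDl v v' w : L2 Omega v -> L2 Omega v' -> L2 Omega w ->
  inner Omega (fun x => v x + v' x) w = inner Omega v w + inner Omega v' w.
Proof. by move=> *; rewrite !innerE restrictD ipDl. Qed.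

Lemma innerBl v v' w : L2 Omega v -> L2 Omega v' -> L2 Omega w ->
  inner Omega (fun x => v x - v' x) w = inner Omega v w - inner Omega v' w.
Proof. by move=> *; rewrite !innerE restrictB ipBl. Qed.

Lemma innerZl a v w : L2 Omega v -> L2 Omega w ->
  inner Omega (fun x => a * v x) w = a * inner Omega v w.
Proof. by move=> *; rewrite !innerE restrictZ ipZl. Qed.

Lemma inner_ge0 v : 0 <= inner Omega v v.
Proof. by rewrite innerE ip_ge0. Qed.

Lemma L2normE v : L2 Omega v -> L2norm Omega v = (Num.sqrt (inner Omega v v))%:E.
Proof. by move=> Lv; rewrite /L2norm Lnorm2_ip// innerE. Qed.

Lemma L2norm_cvg0 (F : set_system R) {FF : Filter F} (h : R -> 'rV[R]_d -> R) :
  (\forall r \near F, L2 Omega (h r)) ->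
  (L2norm Omega (h r) @[r --> F] --> 0%E) <->
  (forall eps : R, 0 < eps -> \forall r \near F, inner Omega (h r) (h r) <= eps).
Proof.
move=> Lh; split => [+ eps e0|H].
  move=> /fine_cvgP[_] /cvgrPdist_le/(_ (Num.sqrt eps)).
  rewrite sqrtr_gt0 => /(_ e0) H; near=> r.
  have Lr : L2 Omega (h r) by near: r.
  have : `|0 - fine (L2norm Omega (h r))| <= Num.sqrt eps by near: r.
  by rewrite L2normE//= sub0r normrN ger0_norm ?sqrtr_ge0// ler_sqrt// ltW.
apply/fine_cvgP; split.
  by apply: filterS Lh => r Lr; rewrite L2normE.
apply/cvgrPdist_le => eps e0; near=> r.
have Lr : L2 Omega (h r) by near: r.
have : inner Omega (h r) (h r) <= eps ^+ 2.
  by near: r; apply: H; rewrite exprn_gt0.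
rewrite /= L2normE//= sub0r normrN ger0_norm ?sqrtr_ge0// => H1.
by rewrite -(ger0_norm (ltW e0)) -sqrtr_sqr ler_wsqrtr.
Unshelve. all: by end_near.
Qed.

Variable phi : nat -> 'rV[R]_d -> R.
Hypothesis Lphi : forall j, L2 Omega (phi j).
Hypothesis phiE : forall i j, inner Omega (phi i) (phi j) = (i == j)%:R.
Hypothesis phi_complete : forall v, L2 Omega v ->
  L2_series Omega phi (fun j => inner Omega v (phi j)) v.

Local Notation coef v j := (inner Omega v (phi j)).

Let phir j := phi j \_ Omega.

Let Lphir j : phir j \in Lfun mu 2%:E.
Proof. exact: Lphi. Qed.

Let phirE i j : ip mu (phir i) (phir j) = (i == j)%:R.
Proof. by rewrite -innerE. Qed.

Lemma restrict_partial c n : (fun x => \sum_(j < n) c j * phi j x) \_ Omega =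
  partial phir c n.
Proof.
apply/funext => x; rewrite /patch /partial big_mkord; case: ifP => xO.
  by apply: eq_bigr => j _; rewrite /phir /patch xO.
by rewrite big1// => j _; rewrite /phir /patch xO mulr0.
Qed.

Lemma L2norm_partial c n w : L2 Omega w ->
  L2norm Omega (fun x => \sum_(j < n) c j * phi j x - w x) =
  (Num.sqrt (inner Omega w w - \sum_(0 <= j < n) coef w j ^+ 2 +
     \sum_(0 <= j < n) (coef w j - c j) ^+ 2))%:E.
Proof.
move=> Lw; rewrite /L2norm restrictB restrict_partial Lnorm2_ip; last first.
  by apply: Lfun2B => //; exact: Lfun2_partial.
congr ((Num.sqrt _)%:E).
transitivity (ip mu (fun x => (w \_ Omega) x - partial phir c n x)
  (fun x => (w \_ Omega) x - partial phir c n x)).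
  by apply: eq_Rintegral => x _; ring.
rewrite ip_sub_partial//; congr (_ - _ + _); first by rewrite innerE.
  by apply: eq_bigr => j _; rewrite innerE.
by apply: eq_bigr => j _; rewrite innerE.
Qed.

Lemma bessel_l2 v : L2 Omega v -> l2_le (fun j => coef v j) (inner Omega v v).
Proof.
move=> Lv M; rewrite innerE; under eq_bigr do rewrite innerE.
exact: bessel.
Qed.

(** By completeness the defect in Bessel's inequality tends to 0. *)
Lemma parseval_cvg v : L2 Omega v ->
  \sum_(0 <= j < n) coef v j ^+ 2 @[n --> \oo] --> inner Omega v v.
Proof.
move=> Lv; have [_] := phi_complete Lv.
under eq_fun => n do rewrite (L2norm_partial (fun j => coef v j) n Lv).
move=> H; have {}H : inner Omega v v - \sum_(0 <= j < n) coef v j ^+ 2 @[n --> \oo] --> 0.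
  apply: cvg0_sqrt => [n|]; first by rewrite subr_ge0; exact: bessel_l2.
  move: H; under eq_fun => n.
    rewrite [X in _ + X]big1 ?addr0; first over.
    by move=> j _; rewrite subrr expr0n.
  by [].
have := cvgB (cvg_cst (inner Omega v v)) H; rewrite subr0.
rewrite (_ : (fun n => \sum_(0 <= j < n) _) = fun n => inner Omega v v - (inner Omega v v - \sum_(0 <= j < n) coef v j ^+ 2)).
  by apply.
by apply/funext => n; rewrite subKr.
Qed.

Lemma parseval_le v eps : L2 Omega v -> l2_le (fun j => coef v j) eps ->
  inner Omega v v <= eps.
Proof.
move=> Lv H; rewrite -(cvg_lim _ (parseval_cvg Lv))//.
by apply: limr_le; [apply/cvg_ex; exists (inner Omega v v); exact: parseval_cvg|exact: nearW].
Qed.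

Lemma coef_summable v : L2 Omega v -> square_summable (fun j => coef v j).
Proof. by move=> Lv; exists (inner Omega v v); exact: bessel_l2. Qed.

(** Riesz-Fischer for the extensions of the phi_j by 0; their sum vanishes outside Omega too. *)
Lemma L2_coef c : square_summable c ->
  exists2 w, L2 Omega w & forall j, coef w j = c j.
Proof.
move=> sc.
have [w [Lw wE w0]] := riesz_fischer Lphir phirE sc (square_summable_tail sc).
have wO : w \_ Omega = w.
  apply/funext => x; rewrite /patch; case: ifPn => // /negP xO; rewrite w0// => j.
  by rewrite /phir /patch; case: ifP.
by exists w => [|j]; [rewrite /L2 wO|rewrite innerE wO wE].
Qed.

Lemma L2_series_coef c w : L2 Omega w -> (forall j, coef w j = c j) ->
  L2_series Omega phi c w.
Proof.
move=> Lw cE; have := phi_complete Lw.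
by rewrite (_ : (fun j => coef w j) = c)//; exact/funext.
Qed.

Lemma eq_coef_ae v w : L2 Omega v -> L2 Omega w -> (forall j, coef v j = coef w j) ->
  v = w %[ae mu in Omega].
Proof.
move=> Lv Lw E; have LB := L2B Lv Lw.
have H : inner Omega (fun x => v x - w x) (fun x => v x - w x) = 0.
  apply/le_anti; rewrite inner_ge0 andbT; apply: parseval_le => // M.
  by rewrite big1// => j _; rewrite innerBl// E subrr expr0n.
rewrite innerE restrictB in H.
have := ae_eq_ip0 Lv Lw H; apply: filterS => x + Ox.
by rewrite !patchT ?inE.
Qed.

(** Parseval's identity reduces convergence in L^2(Omega) to bounds on partial sums. *)
Lemma L2_curve_cvg0 (F : set_system R) {FF : Filter F} (h : R -> 'rV[R]_d -> R) :
  (\forall r \near F, L2 Omega (h r)) ->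
  (L2norm Omega (h r) @[r --> F] --> 0%E) <->
  (forall eps : R, 0 < eps -> \forall r \near F, l2_le (fun j => coef (h r) j) eps).
Proof.
move=> Lh; rewrite (L2norm_cvg0 Lh); split => H eps e0.
  near=> r => M; apply: (@le_trans _ _ (inner Omega (h r) (h r))).
    by apply: bessel_l2; near: r.
  by near: r; exact: H.
near=> r; apply: parseval_le; first by near: r.
by near: r; exact: H.
Unshelve. all: by end_near.
Qed.

Variable lam : nat -> R.

Lemma Lsqnorm_le v (eps : R) :
  (Lsqnorm Omega lam phi v <= eps%:E)%E <-> l2_le (fun j => lam j * coef v j) eps.
Proof.
have g0 (j : nat) : (0 <= (lam j ^+ 2 * coef v j ^+ 2)%:E)%E.
  by rewrite lee_fin mulr_ge0 ?sqr_ge0.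
split => [H M|H].
  rewrite -lee_fin; apply: le_trans H.
  under eq_bigr do rewrite exprMn.
  by rewrite -sumEFin; apply: nneseries_lim_ge => n _ _; exact: g0.
apply: lime_le; first by apply: is_cvg_nneseries => n _ _; exact: g0.
apply: nearW => n; rewrite sumEFin lee_fin; apply: le_trans (H n).
by under [leRHS]eq_bigr do rewrite exprMn.
Qed.

Lemma Lsqnorm_ge0 v : (0 <= Lsqnorm Omega lam phi v)%E.
Proof. by apply: nneseries_ge0 => n _ _; rewrite lee_fin mulr_ge0 ?sqr_ge0. Qed.

Lemma energy_spaceE v : energy_space Omega lam phi v <->
  L2 Omega v /\ square_summable (fun j => lam j * coef v j).
Proof.
split => -[Lv H]; split => //.
  have Hf : Lsqnorm Omega lam phi v \is a fin_num by rewrite ge0_fin_numE// Lsqnorm_ge0.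
  by exists (fine (Lsqnorm Omega lam phi v)); apply/Lsqnorm_le; rewrite fineK.
by case: H => B /Lsqnorm_le H; rewrite (le_lt_trans H)// ltry.
Qed.

Lemma energy_curve_cvg0 (F : set_system R) {FF : Filter F} (h : R -> 'rV[R]_d -> R) :
  (forall eps : R, 0 < eps -> \forall r \near F, l2_le (fun j => lam j * coef (h r) j) eps) ->
  Lsqnorm Omega lam phi (h r) @[r --> F] --> 0%E.
Proof.
move=> H; apply/fine_cvgP; split.
  have := H _ ltr01; apply: filterS => r /Lsqnorm_le Hr.
  by rewrite ge0_fin_numE ?Lsqnorm_ge0// (le_lt_trans Hr)// ltry.
apply/cvgrPdist_le => eps e0; have := H _ e0; apply: filterS => r /Lsqnorm_le Hr.
rewrite /= sub0r normrN ger0_norm ?fine_ge0 ?Lsqnorm_ge0//.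
rewrite -lee_fin fineK//.
by rewrite ge0_fin_numE ?Lsqnorm_ge0// (le_lt_trans Hr)// ltry.
Qed.

End L2Omega.

Local Opaque mlk mittag_leffler ml_deriv Gamma.

(** * The solution kernels of a single mode *)

Section kernels.
Context {R : realType} (al : R).
Hypotheses (al0 : 0 < al) (al1 : al < 1).
Variable l : R.
Hypothesis l0 : 0 < l.

Let al1' : 0 < 1 - al. Proof. by rewrite subr_gt0. Qed.
Let o1 : 0 < 1 :> R := ltr01.

(** The kernel t^(al - 1) E_(al, al)(- l t^al) of the Duhamel integral. *)
Definition resK : R -> R := mlk al l al.
(** The solution E_(al, 1)(- l t^al) of the homogeneous Caputo equation. *)
Definition resE : R -> R := mlk al l 1.

Lemma lsing_resK : lsing al resK.
Proof. exact: (lsing_mlk al0 l al0). Qed.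

Lemma conv_gk_resK : conv (gk (1 - al)) resK = resE.
Proof. by rewrite /resK (conv_gk_mlk al0 l al1' al0) subrK. Qed.

Lemma resE_conv t : resE t = gk 1 t - l * conv (gk 1) resK t.
Proof.
have := mlk_rec al0 l t o1; rewrite /resK (conv_gk_mlk al0 l o1 al0) (addrC 1 al) /resE.
by move=> <-; rewrite addrK.
Qed.

Lemma resK_conv t : resK t = gk al t - l * conv (gk al) resK t.
Proof.
have := mlk_rec al0 l t al0; rewrite {2}/resK (conv_gk_mlk al0 l al0 al0).
by move=> <-; rewrite addrK.
Qed.

Lemma resKE t : 0 < t -> resK t = t `^ (al - 1) * mittag_leffler al al (- l * t `^ al).
Proof. by move=> t0; rewrite /resK (mlkE al0 l t al0) pkE. Qed.

Lemma resEE t : 0 < t -> resE t = mittag_leffler al 1 (- l * t `^ al).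
Proof.
by move=> t0; rewrite /resE (mlkE al0 l t o1) pkE// subrr powRr0 mul1r.
Qed.

Lemma resK_bounds t : 0 <= resK t <= gk al t.
Proof.
have [t0|t0] := leP t 0.
  by rewrite (lsing_le0 lsing_resK t0) gk_le0// !lexx.
have x0 : 0 < l * t `^ al by rewrite mulr_gt0// powR_gt0.
have /andP[m0 m1] := mittag_leffler_al_bounds al0 (ltW al1) x0.
have p0 : 0 <= t `^ (al - 1) by exact: powR_ge0.
rewrite (resKE t0) mulNr gkE (pkE _ t0).
by rewrite (mulr_ge0 p0 (ltW m0)) (ler_wpM2l p0 m1).
Qed.

Lemma resE_bounds t : 0 <= resE t <= gk 1 t.
Proof.
have [t0|t0] := leP t 0.
  have lE : lsing 1 resE := lsing_mlk al0 l o1.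
  by rewrite (lsing_le0 lE t0) gk_le0// !lexx.
have x0 : 0 < l * t `^ al by rewrite mulr_gt0// powR_gt0.
have /andP[m0 m1] := mittag_leffler_1_bounds al0 (ltW al1) x0.
by rewrite resEE// mulNr gk1// (ltW m0) m1.
Qed.

Lemma continuous_resK t : 0 < t -> {for t, continuous resK}.
Proof.
move=> t0; rewrite (_ : resK = fun t => pk al t * mittag_leffler al al (l * (- t `^ al))).
  apply: (@continuous_pk_comp R al (fun z => mittag_leffler al al (l * z)) al t _ t0).
  move=> z; apply: (@continuous_comp _ _ _ (fun z => l * z) (mittag_leffler al al)).
    by apply: cvgM; [exact: cvg_cst|exact: cvg_id].
  exact: (continuous_mittag_leffler al0 al0).
by apply/funext => x; rewrite /resK (mlkE al0 l x al0) mulNr mulrN.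
Qed.

Lemma resE_cvg : resE t @[t --> 0^'+] --> (1 : R).
Proof.
have lc : lsing (1 + al) (conv (gk 1) resK).
  by apply: lsing_conv => //; [exact: lsing_gk|exact: lsing_resK].
have H : 1 - l * conv (gk 1) resK t @[t --> 0^'+] --> (1 : R).
  rewrite -[X in _ --> X]subr0 -[X in _ - X](mulr0 l).
  apply: cvgB; first exact: cvg_cst.
  apply: cvgM; first exact: cvg_cst.
  by apply: (lsing_cvg0 _ lc); rewrite ltrDl.
apply: cvg_trans H; apply: near_eq_cvg; near=> t.
have t0 : 0 < t by near: t; exact: nbhs_right_gt.
by rewrite resE_conv gk1.
Unshelve. all: by end_near.
Qed.

(** The kernel resK multiplied by t^(1 - al), which is continuous up to 0. *)
Definition mlE t : R := mittag_leffler al al (- l * t `^ al).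
Definition dmlE t : R := ml_deriv al al (- l * t `^ al) * (- l * (al * t `^ (al - 1))).

Lemma is_derive_mlE (t : R) : 0 < t -> is_derive t 1 mlE (dmlE t).
Proof.
move=> t0; have d1 : is_derive t 1 (fun t : R => - l * t `^ al) (- l * (al * t `^ (al - 1))).
  exact: (is_deriveZ (- l) (is_derive1_powR al t0)).
have d2 := is_derive_mittag_leffler al0 (- l * t `^ al) al0.
exact: (@is_derive1_comp R (mittag_leffler al al) (fun t : R => - l * t `^ al) t _ _ d2 d1).
Qed.

Lemma mlE_bounds t : 0 < t -> 0 <= mlE t <= (Gamma al)^-1.
Proof.
move=> t0; have x0 : 0 < l * t `^ al by rewrite mulr_gt0// powR_gt0.
have /andP[m0 m1] := mittag_leffler_al_bounds al0 (ltW al1) x0.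
by rewrite /mlE mulNr (ltW m0) m1.
Qed.

Lemma mlE_resK t : 0 < t -> t `^ (1 - al) * resK t = mlE t.
Proof.
move=> t0; rewrite resKE// mulrA -powRD ?(gt_eqF t0) ?implybT//.
by rewrite addrA subrK subrr powRr0 mul1r.
Qed.

Lemma mlE_cvg : mlE t @[t --> 0^'+] --> (Gamma al)^-1.
Proof.
rewrite -(mittag_leffler0 al al0).
have H : - l * t `^ al @[t --> 0^'+] --> (0 : R).
  rewrite -[X in _ --> X](mulr0 (- l)); apply: cvgM; first exact: cvg_cst.
  exact: powR_cvg0.
have c := continuous_mittag_leffler al0 al0 (x := 0).
exact: (cvg_comp _ _ H c).
Qed.

Lemma dmlE_continuous t : 0 < t -> {for t, continuous dmlE}.
Proof.
move=> t0; have cp p : {for t, continuous (fun t : R => t `^ p)}.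
  by apply: derivable1_cont; have [] := is_derive1_powR p t0.
have c1 : {for t, continuous (fun t : R => - l * t `^ al)}.
  by apply: cvgM; [exact: cvg_cst|exact: cp].
apply: cvgM.
  exact: (cvg_comp _ _ c1 (continuous_ml_deriv al0 al0 (x := _))).
apply: cvgM; first exact: cvg_cst.
apply: cvgM; first exact: cvg_cst.
exact: cp.
Qed.

(** The factor l is absorbed by the energy norm of the datum; b bounds t away from the singularity
    at 0. *)
Lemma dmlE_bound (b t : R) : 0 < b <= t ->
  `|dmlE t| <= l * ((Gamma (al + al))^-1 * (al * b `^ (al - 1))).
Proof.
move=> /andP[b0 bt]; have t0 := lt_le_trans b0 bt.
have x0 : 0 < l * t `^ al by rewrite mulr_gt0// powR_gt0.
have /andP[m0 m1] := ml_deriv_bounds al0 (ltW al1) x0.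
have pbt : t `^ (al - 1) <= b `^ (al - 1).
  by apply: powR_anti => //; rewrite subr_le0 ltW.
rewrite /dmlE mulNr; move: m0 m1.
move: (ml_deriv _ _ _) (Gamma _)^-1 (t `^ (al - 1)) (b `^ (al - 1)) pbt (powR_ge0 t (al - 1)).
move=> m G p q pq p0 m0 mG.
rewrite normrM normrM normrM normrN (gtr0_norm m0) (gtr0_norm l0) (gtr0_norm al0) (ger0_norm p0).
rewrite mulrCA (ler_wpM2l (ltW l0))//.
apply: ler_pM => //; [exact: ltW|exact: mulr_ge0 (ltW al0) p0|].
by apply: ler_wpM2l; [exact: ltW|exact: pq].
Qed.

End kernels.

Local Opaque resK resE mlE dmlE.

(** * The coefficients of the two solutions *)

Section families.
Context {R : realType} (al T : R).
Hypotheses (al0 : 0 < al) (al1 : al < 1) (T0 : 0 < T).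
Variables (lam a c0 : nat -> R) (g : nat -> R -> R).
Hypothesis lam0 : 0 < lam 0%N.
Hypothesis lam_ge : forall j, lam 0%N <= lam j.
Hypothesis sla : square_summable (fun j => lam j * a j).
Hypothesis sc0 : square_summable c0.
Hypothesis cg : forall j, continuous (g j).
Hypothesis tg : equi_tails `[0, T]%classic (fun t j => g j t).

Let I : set R := `[0, T]%classic.
Let o1 : 0 < 1 :> R := ltr01.
Let lj j : 0 < lam j.
Proof. exact: lt_le_trans (lam_ge j). Qed.
Let K j := resK al (lam j).
Let e j := resE al (lam j).
Let F j := primitive (c0 j) (g j).
Let D j := conv (K j) (F j).
Let N j := conv (K j) (pos (g j)).
Let lK j : lsing al (K j) := lsing_resK al0 (lam j).
Let KE j : conv (gk (1 - al)) (K j) = e j := conv_gk_resK al0 al1 (lam j).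
Let eK j t : e j t = gk 1 t - lam j * conv (gk 1) (K j) t := resE_conv al0 (lam j) t.
Let cK j t : 0 < t -> {for t, continuous (K j)}.
Proof. exact: (@continuous_resK R al al0 (lam j) t). Qed.
Let Kb j t : 0 <= K j t <= gk al t.
Proof. exact: resK_bounds. Qed.
Let eb j t : 0 <= e j t <= gk 1 t.
Proof. exact: resE_bounds. Qed.

Lemma gk1_le1 t : gk 1 t <= 1 :> R.
Proof. by have [t0|t0] := leP t 0; [rewrite gk_le0|rewrite gk1]. Qed.

Let e_abs j t : `|e j t| <= 1.
Proof.
by have /andP[e0 e1] := eb j t; rewrite ger0_norm// (le_trans e1)// gk1_le1.
Qed.

(** The eigenvalues are bounded below by the first one. *)
Lemma equi_tails_lamV J (c : R -> nat -> R) :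
  equi_tails J (fun t j => lam j * c t j) -> equi_tails J c.
Proof.
move=> H; have := @equi_tailsM _ J _ (fun _ j => (lam j)^-1) (lam 0%N)^-1 _ _ H.
have -> : (fun t j => (lam j)^-1 * (lam j * c t j)) = c.
  by apply/funext => t; apply/funext => j; rewrite mulKf// gt_eqF.
apply; first by rewrite invr_ge0 ltW.
by move=> t j _; rewrite ger0_norm ?invr_ge0 ?(ltW (lj j))// lef_pV2 ?posrE.
Qed.

Lemma tails_primitive : equi_tails I (fun t j => F j t).
Proof.
apply: equi_tailsD.
  have := @equi_tailsM _ I _ (fun t _ => gk 1 t) 1 ler01 _ (equi_tails_cst I sc0).
  move=> H; apply: eq_equi_tails (H _); first by move=> t j _; rewrite mulrC.
  by move=> t _ _; rewrite ger0_norm ?gk_ge0// gk1_le1.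
apply: (@equi_tails_conv _ 1 T (fun _ => gk 1) g) => //.
  by move=> _; exact: measurable_gk.
by move=> j x; rewrite gk_ge0//= lexx.
Qed.

Lemma tails_dduhamel : equi_tails I (fun t j => N j t).
Proof.
by apply: (@equi_tails_conv _ al T K g) => // j; have [] := lK j.
Qed.

(** By lam_duhamel, lam_j D_j is a combination of F_j, c0_j and a convolution with the kernel e_j,
    which is at most 1 for all j. *)
Lemma tails_lam_duhamel : equi_tails I (fun t j => lam j * D j t).
Proof.
have lD j t : lam j * D j t = F j t + (- e j t * c0 j) + (-1) * conv (e j) (pos (g j)) t.
  rewrite (lam_duhamel al0 al1 (lK j) (KE j) (eK j) (c0 j) (cg (j := j))) -/(F j).
  by move: (F j t) (e j t) (conv _ _ t) => x y z; ring.
apply: (@eq_equi_tails _ I (fun t j => F j t + (- e j t * c0 j) + (-1) * conv (e j) (pos (g j)) t)) => [t j _|].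
  by rewrite lD.
apply: equi_tailsD; first (apply: equi_tailsD; first exact: tails_primitive).
  apply: (@equi_tailsM _ I (fun=> c0) (fun t j => - e j t) 1 ler01) => [t j _|].
    by rewrite normrN.
  exact: equi_tails_cst.
apply: (@equi_tailsM _ I _ (fun _ _ => -1) 1 ler01) => [t j _|]; first by rewrite normrN1.
apply: (@equi_tails_conv _ 1 T e g) => // j.
by have [] := lsing_e al0 al1 (lK j) (KE j).
Qed.

Lemma tails_duhamel : equi_tails I (fun t j => D j t).
Proof. exact: equi_tails_lamV tails_lam_duhamel. Qed.

Lemma duhamel_cvg0 j : D j t @[t --> 0^'+] --> (0 : R).
Proof.
by apply: (lsing_cvg0 _ (lsing_duhamel al0 (lK j) (c0 j) (cg (j := j)))); rewrite ltrDr.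
Qed.

Let dD j (t : R) : 0 < t -> is_derive t 1 (D j) (c0 j * K j t + N j t).
Proof. by move=> t0; exact: (is_derive_duhamel al0 (lK j) (@cK j) (c0 j) (cg (j := j)) t0). Qed.

Let cN j t : 0 < t -> {for t, continuous (N j)}.
Proof. by move=> t0; exact: (continuous_dduhamel al0 (lK j) (@cK j) (cg (j := j)) t0). Qed.

(** The kernels vanish at 0, so that the initial value has to be prescribed separately. *)
Definition caputo_coef t j : R := if 0 < t then a j * e j t + D j t else a j.

Definition caputo_dcoef t j : R := caputo_rate (lam j) (K j) (a j) (c0 j) (g j) t.

Lemma tails_lam_caputo : equi_tails I (fun t j => lam j * caputo_coef t j).
Proof.
pose m (t : R) (j : nat) : R := if 0 < t then e j t else 1.
pose n (t : R) (j : nat) : R := if 0 < t then 1 else 0.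
apply: (@eq_equi_tails _ I (fun t j => m t j * (lam j * a j) + n t j * (lam j * D j t))) => [t j _|].
  rewrite /m /n /caputo_coef; move: (e j t) (D j t) => x y; case: ifP => _; ring.
apply: equi_tailsD.
  apply: (@equi_tailsM _ I (fun=> fun j => lam j * a j) m 1 ler01) => [t j _|].
    by rewrite /m; case: ifP => _; rewrite ?normr1.
  exact: equi_tails_cst.
apply: (@equi_tailsM _ I _ n 1 ler01) => [t j _|]; last exact: tails_lam_duhamel.
by rewrite /n; case: ifP => _; rewrite ?normr1 ?normr0.
Qed.

Lemma tails_caputo : equi_tails I caputo_coef.
Proof. exact: equi_tails_lamV tails_lam_caputo. Qed.

Lemma is_derive_caputo_coef j (t : R) : 0 < t ->
  is_derive t 1 (caputo_coef^~ j) (caputo_dcoef t j).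
Proof.
move=> t0; have := is_derive_caputo al0 al1 (lK j) (@cK j) (KE j) (eK j) (a j) (c0 j) (cg (j := j)) t0.
apply: near_eq_is_derive; near=> x.
have x0 : 0 < x by near: x; exact: lt_nbhsr.
by rewrite /caputo_coef x0.
Unshelve. all: by end_near.
Qed.

(** At t = 0 only the limit from the right matters, and e_j tends to 1. *)
Lemma caputo_coef_cvg j t : I t -> caputo_coef r j @[r --> within I (nbhs t)] --> caputo_coef t j.
Proof.
rewrite /I/= in_itv/= => /andP[]; rewrite le_eqVlt => /predU1P[<- _|t0 _]; last first.
  apply: cvg_within_filter.
  by apply: derivable1_cont; have [] := is_derive_caputo_coef j t0.
have H : a j * e j t + D j t @[t --> 0^'+] --> a j.
  rewrite -[X in _ --> X]addr0; apply: cvgD; last exact: duhamel_cvg0.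
  rewrite -[X in _ --> X]mulr1; apply: cvgM; first exact: cvg_cst.
  exact: resE_cvg.
rewrite [X in _ --> X]/caputo_coef ltxx; apply/cvgrPdist_le => eps e0.
move/cvgrPdist_le : H => /(_ _ e0) H.
have {}H : \forall r \near nbhs (0 : R), 0 < r -> `|a j - (a j * e j r + D j r)| <= eps by [].
apply: filterS H => r Hr Ir; rewrite /caputo_coef.
by case: ltP Hr => [r0 Hr|r0 _]; [exact: Hr|rewrite subrr normr0 ltW].
Qed.

Lemma caputo_dcoef_continuous j t : 0 < t -> {for t, continuous (caputo_dcoef^~ j)}.
Proof.
move=> t0; apply: cvgD; last exact: cN.
by apply: cvgM; [exact: cvg_cst|exact: cK].
Qed.

Let K_abs b j t : 0 < b -> b <= t -> `|K j t| <= gk al b.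
Proof.
move=> b0 bt; have /andP[k0 k1] := Kb j t.
by rewrite ger0_norm// (le_trans k1)// (gk_anti al0 (ltW al1)).
Qed.

(** Away from 0 the kernel K_j is bounded by gk al b for all j. *)
Lemma tails_dcaputo b : 0 < b -> equi_tails `[b, T]%classic caputo_dcoef.
Proof.
move=> b0; have bI : `[b, T]%classic `<=` I.
  by move=> t; rewrite /I/= !in_itv/= => /andP[bt ->]; rewrite (le_trans (ltW b0)).
apply: equi_tailsD; last exact: equi_tailsS bI tails_dduhamel.
apply: (@eq_equi_tails _ _ (fun t j => K j t * (c0 j + (-1) * (lam j * a j)))) => [t j _|].
  by rewrite mulN1r mulrC.
apply: (@equi_tailsM _ _ (fun _ j => c0 j + (-1) * (lam j * a j)) _ (gk al b)).
- exact: gk_ge0.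
- by move=> t j; rewrite /= in_itv/= => /andP[bt _]; exact: K_abs.
- apply: equi_tailsD; first exact: equi_tails_cst.
  apply: (@equi_tailsM _ _ (fun _ j => lam j * a j) (fun _ _ => -1) 1 ler01) => [t j _|].
    by rewrite normrN1.
  exact: equi_tails_cst.
Qed.

(** The coefficients of t^(1 - al) u(t), extended to t = 0 by their limit. *)
Definition RL_coef t j : R :=
  if 0 < t then a j * mlE al (lam j) t + t `^ (1 - al) * D j t else a j / Gamma al.

Definition RL_dcoef t j : R := a j * dmlE al (lam j) t +
  (t `^ (1 - al) * (c0 j * K j t + N j t) + (1 - al) * t `^ (1 - al - 1) * D j t).

Let al1' : 0 < 1 - al. Proof. by rewrite subr_gt0. Qed.

Lemma RL_coefE t j : 0 < t -> RL_coef t j = t `^ (1 - al) * (a j * K j t + D j t).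
Proof.
move=> t0; rewrite /RL_coef t0 -(mlE_resK al0 (lam j) t0) -/(K j).
by move: (K j t) (D j t) (t `^ _) => x y z; ring.
Qed.

Lemma tails_lam_RL : equi_tails I (fun t j => lam j * RL_coef t j).
Proof.
pose m (t : R) (j : nat) : R := if 0 < t then mlE al (lam j) t else (Gamma al)^-1.
pose n (t : R) (j : nat) : R := if 0 < t then t `^ (1 - al) else 0.
have G0 : 0 < (Gamma al)^-1 by rewrite invr_gt0 Gamma_gt0.
apply: (@eq_equi_tails _ I (fun t j => m t j * (lam j * a j) + n t j * (lam j * D j t))) => [t j _|].
  rewrite /m /n /RL_coef; move: (mlE _ _ t) (D j t) ((Gamma al)^-1) (t `^ _) => x y z p.
  by case: ifP => _; ring.
apply: equi_tailsD.
  apply: (@equi_tailsM _ I (fun=> fun j => lam j * a j) m (Gamma al)^-1 (ltW G0)) => [t j _|].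
    rewrite /m; case: ltP => t0; last by rewrite gtr0_norm.
    by have /andP[m0 m1] := mlE_bounds al0 al1 (lj j) t0; rewrite ger0_norm.
  exact: equi_tails_cst.
apply: (@equi_tailsM _ I _ n (T `^ (1 - al)) (powR_ge0 _ _)) => [t j|]; last exact: tails_lam_duhamel.
rewrite /I/= in_itv/= => /andP[t0 tT]; rewrite /n; case: ifP => _; last by rewrite normr0 powR_ge0.
rewrite ger0_norm ?powR_ge0//.
by apply: ge0_ler_powR; rewrite ?nnegrE ?(ltW al1') ?(ltW T0).
Qed.

Lemma tails_RL : equi_tails I RL_coef.
Proof. exact: equi_tails_lamV tails_lam_RL. Qed.

Lemma is_derive_RL_coef j (t : R) : 0 < t ->
  is_derive t 1 (RL_coef^~ j) (RL_dcoef t j).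
Proof.
move=> t0.
have d1 := is_deriveZ (a j) (is_derive_mlE al0 (lam j) t0).
have d2 := is_deriveM (is_derive1_powR (1 - al) t0) (dD j t0).
have := is_deriveD d1 d2.
rewrite (_ : a j *: dmlE al (lam j) t + _ = RL_dcoef t j); last first.
  rewrite /RL_dcoef /GRing.scale/=.
  by move: (dmlE _ _ t) (K j t) (N j t) (D j t) (t `^ (1 - al)) (t `^ (1 - al - 1)) => x1 x2 x3 x4 x5 x6; ring.
apply: near_eq_is_derive; near=> x.
have x0 : 0 < x by near: x; exact: lt_nbhsr.
by rewrite /RL_coef x0.
Unshelve. all: by end_near.
Qed.

Lemma RL_coef_cvg j t : I t -> RL_coef r j @[r --> within I (nbhs t)] --> RL_coef t j.
Proof.
rewrite /I/= in_itv/= => /andP[]; rewrite le_eqVlt => /predU1P[<- _|t0 _]; last first.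
  apply: cvg_within_filter.
  by apply: derivable1_cont; have [] := is_derive_RL_coef j t0.
have H : a j * mlE al (lam j) t + t `^ (1 - al) * D j t @[t --> 0^'+] --> a j / Gamma al.
  rewrite -[X in _ --> X]addr0; apply: cvgD.
    apply: cvgM; first exact: cvg_cst.
    exact: mlE_cvg.
  rewrite -[X in _ --> X](mulr0 0); apply: cvgM; last exact: duhamel_cvg0.
  exact: powR_cvg0.
rewrite [X in _ --> X]/RL_coef ltxx; apply/cvgrPdist_le => eps e0.
move/cvgrPdist_le : H => /(_ _ e0) H.
have {}H : \forall r \near nbhs (0 : R), 0 < r -> `|a j / Gamma al - (a j * mlE al (lam j) r + r `^ (1 - al) * D j r)| <= eps by [].
apply: filterS H => r Hr Ir; rewrite /RL_coef.
by case: ltP Hr => [r0 Hr|r0 _]; [exact: Hr|rewrite subrr normr0 ltW].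
Qed.

Lemma RL_dcoef_continuous j t : 0 < t -> {for t, continuous (RL_dcoef^~ j)}.
Proof.
move=> t0; have cp p : {for t, continuous (fun t : R => t `^ p)}.
  by apply: derivable1_cont; have [] := is_derive1_powR p t0.
apply: cvgD.
  by apply: cvgM; [exact: cvg_cst|exact: dmlE_continuous].
apply: cvgD.
  apply: cvgM; first exact: cp.
  by apply: cvgD; [apply: cvgM; [exact: cvg_cst|exact: cK]|exact: cN].
apply: cvgM; first by apply: cvgM; [exact: cvg_cst|exact: cp].
by apply: derivable1_cont; have [] := dD j t0.
Qed.

(** The derivative of mlE is of size lam_j, which the energy norm of the datum compensates. *)
Lemma tails_dRL b : 0 < b -> equi_tails `[b, T]%classic RL_dcoef.
Proof.
move=> b0; have bI : `[b, T]%classic `<=` I.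
  by move=> t; rewrite /I/= !in_itv/= => /andP[bt ->]; rewrite (le_trans (ltW b0)).
have bp p t : `[b, T]%classic t -> `|t `^ p| <= b `^ p + T `^ p.
  rewrite /= in_itv/= => /andP[bt tT]; rewrite ger0_norm ?powR_ge0//.
  have t0 := lt_le_trans b0 bt.
  have [p0|p0] := leP 0 p.
    by rewrite ler_wpDl ?powR_ge0// ge0_ler_powR ?nnegrE ?(ltW t0) ?(ltW T0).
  by rewrite ler_wpDr ?powR_ge0// powR_anti// ltW.
have q0 p : 0 <= b `^ p + T `^ p by rewrite addr_ge0 ?powR_ge0.
apply: equi_tailsD.
  pose C := (Gamma (al + al))^-1 * (al * b `^ (al - 1)).
  have C0 : 0 <= C.
    by rewrite mulr_ge0 ?invr_ge0 ?mulr_ge0 ?powR_ge0 ?(ltW al0) ?(ltW (Gamma_gt0 _)) ?addr_gt0.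
  apply: (@eq_equi_tails _ _ (fun t j => (dmlE al (lam j) t / lam j) * (lam j * a j))) => [t j _|].
    by rewrite mulrA divfK ?gt_eqF// mulrC.
  apply: (@equi_tailsM _ _ (fun _ j => lam j * a j) _ C C0) => [t j|]; last exact: equi_tails_cst.
  rewrite /= in_itv/= => /andP[bt _].
  rewrite normrM normfV (gtr0_norm (lj j)) ler_pdivrMr// [leRHS]mulrC.
  by apply: dmlE_bound => //; rewrite b0.
apply: equi_tailsD.
  apply: (@equi_tailsM _ _ _ (fun t _ => t `^ (1 - al)) (b `^ (1 - al) + T `^ (1 - al))) => //.
    by move=> t _; exact: bp.
  apply: equi_tailsD; last exact: equi_tailsS bI tails_dduhamel.
  apply: (@eq_equi_tails _ _ (fun t j => K j t * c0 j)) => [t j _|]; first by rewrite mulrC.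
  apply: (@equi_tailsM _ _ (fun=> c0) _ (gk al b)); first exact: gk_ge0.
    by move=> t j; rewrite /= in_itv/= => /andP[bt _]; exact: K_abs.
  exact: equi_tails_cst.
apply: (@equi_tailsM _ _ _ (fun t _ => (1 - al) * t `^ (1 - al - 1)) ((1 - al) * (b `^ (1 - al - 1) + T `^ (1 - al - 1)))).
- by rewrite mulr_ge0 ?(ltW al1').
- by move=> t _ It; rewrite normrM (gtr0_norm al1') ler_wpM2l ?(ltW al1')// bp.
- exact: equi_tailsS bI tails_duhamel.
Qed.

(** The tails are small beyond some index, and each of the remaining coefficients is bounded. *)
Lemma primitive_l2_bounded : exists2 B : R, 0 <= B & forall t, I t -> l2_le (fun j => F j t) (B ^+ 2).
Proof.
have [n HN] := tails_primitive ltr01.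
have /choice[C HC] : forall j, exists C : R, forall t, I t -> F j t ^+ 2 <= C.
  move=> j; have [_ /(_ T)[C C0 HC]] := lsing_primitive (c0 j) (cg (j := j)).
  have pk1 t : pk 1 t <= 1 :> R.
    by have [t0|t0] := leP t 0; [rewrite pk_le0|rewrite pkE// subrr powRr0].
  exists (C ^+ 2) => t; rewrite /I/= in_itv/= => /andP[_ tT].
  rewrite -real_normK ?num_real// lerXn2r ?nnegrE//.
  by rewrite (le_trans (HC t tT))// ler_piMr.
pose S := \sum_(0 <= j < n) C j + 1.
have S0 : 0 <= S.
  rewrite addr_ge0//; apply: sumr_ge0 => j _.
  by apply: le_trans (sqr_ge0 _) (HC j 0 _); rewrite /I/= in_itv/= lexx ltW.
exists (Num.sqrt S); first exact: sqrtr_ge0.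
rewrite sqr_sqrtr// => t It M.
have h1 : \sum_(0 <= j < n) F j t ^+ 2 <= \sum_(0 <= j < n) C j.
  by apply: ler_sum => j _; exact: HC.
have [NM|MN] := leqP n M.
  by rewrite (@big_cat_nat _ _ _ n 0 M)//= lerD// HN.
apply: (@le_trans _ _ (\sum_(0 <= j < n) F j t ^+ 2)).
  by rewrite (@big_cat_nat _ _ _ M 0 n) ?(ltnW MN)//= lerDl sum_sqr_ge0.
by rewrite (le_trans h1)// lerDl.
Qed.

End families.

Local Opaque ip inner.

(** * Curves in L^2(Omega) and their integrals *)

Lemma near_withinI (T : Type) (F : set_system T) {FF : Filter F} (J P : set T) :
  J `<=` P -> \forall r \near within J F, P r.
Proof.
move=> JP; apply: (@filterS _ F _ setT); last exact: filterT.
by move=> x _ /JP.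
Qed.

Section curves.
Context {R : realType} {d : nat} (Omega : set 'rV[R]_d).
Local Notation mu := (lebesgue_rV R d).
Local Notation leb := (@lebesgue_measure R).
Implicit Types (v w : 'rV[R]_d -> R) (c : nat -> R).
Variable phi : nat -> 'rV[R]_d -> R.
Hypothesis Lphi : forall j, L2 Omega (phi j).
Hypothesis phiE : forall i j, inner Omega (phi i) (phi j) = (i == j)%:R.
Hypothesis phi_complete : forall v, L2 Omega v ->
  L2_series Omega phi (fun j => inner Omega v (phi j)) v.
Local Notation coef v j := (inner Omega v (phi j)).

(** Parseval's identity polarized. *)
Lemma inner_cvg v w : L2 Omega v -> L2 Omega w ->
  \sum_(0 <= j < n) coef v j * coef w j @[n --> \oo] --> inner Omega v w.
Proof.
move=> Lv Lw; have LD := L2D Lv Lw.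
have c1 := parseval_cvg Lphi phiE phi_complete Lv.
have c2 := parseval_cvg Lphi phiE phi_complete Lw.
have c3 := parseval_cvg Lphi phiE phi_complete LD.
have -> : inner Omega v w = 2^-1 * (inner Omega (fun x => v x + w x) (fun x => v x + w x) -
    inner Omega v v - inner Omega w w).
  have Dr z : L2 Omega z -> inner Omega z (fun x => v x + w x) = inner Omega z v + inner Omega z w.
    by move=> Lz; rewrite innerC innerDl// !(innerC Omega z).
  rewrite innerDl// !Dr// (innerC Omega w v).
  by move: (inner _ v v) (inner _ v w) (inner _ w w) => x y z; field.
rewrite (_ : (fun n => \sum_(0 <= j < n) coef v j * coef w j) = fun n => 2^-1 *
   (\sum_(0 <= j < n) inner Omega (fun x => v x + w x) (phi j) ^+ 2 -
    \sum_(0 <= j < n) coef v j ^+ 2 - \sum_(0 <= j < n) coef w j ^+ 2)).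
  apply: cvgM; first exact: cvg_cst.
  by apply: cvgB; [apply: cvgB|].
apply/funext => n; rewrite -!sumrB mulr_sumr; apply: eq_bigr => j _.
by rewrite innerDl//; move: (coef v j) (coef w j) => x y; field.
Qed.

(** The inner product is a limit of finite sums of products of coefficients. *)
Lemma measurable_curve (t : R) (h : nat -> R -> R) (g : R -> 'rV[R]_d -> R) p psi :
  (forall tau, 0 < tau < t -> L2 Omega (g tau)) ->
  (forall tau j, 0 < tau < t -> coef (g tau) j = h j tau) ->
  (forall j, measurable_fun `]0, t[%classic (h j)) ->
  (forall tau, 0 < tau < t -> L2 Omega (psi tau)) ->
  (forall tau j, 0 < tau < t -> coef (psi tau) j = p j tau) ->
  (forall j, measurable_fun `]0, t[%classic (p j)) ->
  measurable_fun `]0, t[%classic (fun tau => inner Omega (g tau) (psi tau)).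
Proof.
move=> Lg gh mh Lpsi psip mp.
apply: (@measurable_fun_cvg _ _ R _ (fun n tau => \sum_(0 <= j < n) h j tau * p j tau)).
  by move=> n; apply: measurable_sum => j; exact: measurable_funM.
move=> tau; rewrite /= in_itv/= => taut.
have := inner_cvg (Lg _ taut) (Lpsi _ taut).
by under eq_fun do under eq_bigr do rewrite gh// psip//.
Qed.

(** The integral, defined by duality, is computed coefficientwise by dominated convergence: the partial
    sums of the expansion of the inner product of g(tau) and psi are bounded by a multiple of
    B(tau). *)
Lemma L2_integral_coef (t : R) (h : nat -> R -> R) (B : R -> R) g w :
  (forall tau, 0 < tau < t -> L2 Omega (g tau)) ->
  (forall tau j, 0 < tau < t -> coef (g tau) j = h j tau) ->
  (forall j, measurable_fun `]0, t[%classic (h j)) ->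
  leb.-integrable `]0, t[%classic (EFin \o B) ->
  (forall tau, 0 < tau < t -> 0 < B tau) ->
  (forall tau, 0 < tau < t -> l2_le (fun j => h j tau) (B tau ^+ 2)) ->
  L2 Omega w ->
  (forall j, coef w j = \int[leb]_(tau in `]0, t[%classic) h j tau) ->
  L2_integral Omega 0 t g w.
Proof.
move=> Lg gh mh iB B0 hB Lw wh.
have mI : measurable (`]0, t[%classic : set R) by exact: measurable_itv.
have dom (k : R -> R) (C : R) : measurable_fun `]0, t[%classic k ->
    (forall tau, 0 < tau < t -> `|k tau| <= C * B tau) ->
    leb.-integrable `]0, t[%classic (EFin \o k).
  move=> mk kB; apply: (@integrable_norm_le _ _ R leb _ _ (fun tau => C * B tau) mI mk).
    by move=> tau; rewrite /= in_itv/=; exact: kB.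
  have := @integrableZl _ _ R leb _ mI C _ iB.
  by apply: eq_integrable => // x _ /=; rewrite EFinM.
have mgg : measurable_fun `]0, t[%classic (fun tau => inner Omega (g tau) (g tau)).
  exact: (measurable_curve Lg gh mh Lg gh mh).
have gg tau : 0 < tau < t -> inner Omega (g tau) (g tau) <= B tau ^+ 2.
  move=> taut; apply: (parseval_le Lphi phiE phi_complete (Lg _ taut)) => M.
  by under eq_bigr do rewrite gh//; exact: hB.
have ih j : leb.-integrable `]0, t[%classic (EFin \o h j).
  apply: (dom _ 1) => // tau taut; rewrite mul1r.
  rewrite -(ger0_norm (ltW (B0 _ taut))) -ler_sqr ?nnegrE// !real_normK ?num_real//.
  apply: le_trans (hB _ taut j.+1); rewrite big_nat_recr//= lerDr.
  by apply: sumr_ge0 => i _; exact: sqr_ge0.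
split => //.
- apply: (@eq_integrable _ _ _ leb _ mI (EFin \o (fun tau => Num.sqrt (inner Omega (g tau) (g tau))))).
    by move=> tau; rewrite inE/= in_itv/= => taut; rewrite L2normE//; exact: Lg.
  apply: (dom _ 1).
    have msq : measurable_fun setT (Num.sqrt : R -> R).
      by apply: continuous_measurable_fun; exact: sqrt_continuous.
    exact: (measurableT_comp msq mgg).
  move=> tau taut; rewrite mul1r ger0_norm ?sqrtr_ge0//.
  by rewrite -(ger0_norm (ltW (B0 _ taut))) -sqrtr_sqr ler_wsqrtr// gg.
move=> psi Lpsi.
pose p j (_ : R) := coef psi j.
pose P := inner Omega psi psi.
pose s n tau := \sum_(0 <= j < n) h j tau * coef psi j.
have ms n : measurable_fun `]0, t[%classic (s n).
  by apply: measurable_sum => j; apply: measurable_funM.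
have mgp : measurable_fun `]0, t[%classic (fun tau => inner Omega (g tau) psi).
  by apply: (measurable_curve Lg gh mh (psi := fun=> psi) (p := p)) => // j; exact: measurable_cst.
have sB n tau : 0 < tau < t -> `|s n tau| <= (1 + P) / 2 * B tau.
  move=> taut; have b0 := B0 _ taut.
  apply: (@le_trans _ _ (\sum_(0 <= j < n) ((2 * B tau)^-1 * h j tau ^+ 2 + B tau / 2 * coef psi j ^+ 2))).
    apply: (le_trans (ler_norm_sum _ _ _)); apply: ler_sum => j _.
    rewrite normrM -(real_normK (num_real (h j tau))) -(real_normK (num_real (coef psi j))).
    move: (B tau) b0 `|h j tau| `|coef psi j| => b b0 x y.
    have b1 : b != 0 by rewrite gt_eqF.
    rewrite -subr_ge0 (_ : _ - _ = (2 * b)^-1 * (x - b * y) ^+ 2); last by field.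
    by apply: mulr_ge0; [rewrite invr_ge0 mulr_ge0// ltW|exact: sqr_ge0].
  rewrite big_split/= -!mulr_sumr.
  have h1 : \sum_(0 <= j < n) h j tau ^+ 2 <= B tau ^+ 2 by exact: hB.
  have h2 : \sum_(0 <= j < n) coef psi j ^+ 2 <= P by exact: bessel_l2.
  move: h1 h2; move: (\sum_(0 <= j < n) h j tau ^+ 2) (\sum_(0 <= j < n) coef psi j ^+ 2).
  move: (B tau) b0 => b b0 S1 S2 h1 h2.
  have b1 : b != 0 by rewrite gt_eqF.
  apply: (@le_trans _ _ ((2 * b)^-1 * b ^+ 2 + b / 2 * P)).
    apply: lerD; (apply: ler_wpM2l; last by assumption).
      by rewrite invr_ge0 mulr_ge0// ltW.
    by rewrite divr_ge0// ltW.
  have -> : (2 * b)^-1 * b ^+ 2 + b / 2 * P = (1 + P) / 2 * b by field.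
  by [].
have [|||||ig _ cs] := @dominated_convergence _ _ R leb _ mI (fun n => EFin \o s n)
    (EFin \o (fun tau => inner Omega (g tau) psi)) (EFin \o (fun tau => (1 + P) / 2 * B tau)).
- by move=> n; apply/measurable_EFinP; exact: ms.
- by apply/measurable_EFinP; exact: mgp.
- apply: aeW => tau /=; rewrite in_itv/= => taut; apply: cvg_EFin; first exact: nearW.
  rewrite /comp/=; have := inner_cvg (Lg _ taut) Lpsi.
  by under eq_fun do under eq_bigr do rewrite gh//.
- have := @integrableZl _ _ R leb _ mI ((1 + P) / 2) _ iB.
  by apply: eq_integrable => // x _ /=; rewrite EFinM.
- apply: aeW => tau n /=; rewrite in_itv/= => taut; rewrite lee_fin; exact: sB.
split => //.
have E n : (\int[leb]_(tau in `]0%R, t[%classic) (EFin \o s n) tau =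
    (\sum_(0 <= j < n) coef w j * coef psi j)%:E)%E.
  have -> : (\int[leb]_(tau in `]0%R, t[%classic) (EFin \o s n) tau = (\int[leb]_(tau in `]0%R, t[%classic) s n tau)%:E)%E.
    rewrite /Rintegral fineK//; apply: integrable_fin_num => //.
    exact: (dom _ _ (ms n) (sB n)).
  congr EFin; rewrite /s.
  have isn m : leb.-integrable `]0, t[%classic (EFin \o (fun tau => \sum_(0 <= j < m) h j tau * coef psi j)).
    exact: (dom _ _ (ms m) (sB m)).
  elim: n => [|n IH].
    by under eq_Rintegral do rewrite big_geq//; rewrite big_geq// /Rintegral integral0.
  under eq_Rintegral do rewrite big_nat_recr//=.
  have ihp : leb.-integrable `]0, t[%classic (EFin \o (fun tau => h n tau * coef psi n)).
    have := @integrableZl _ _ R leb _ mI (coef psi n) _ (ih n).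
    by apply: eq_integrable => // tau _ /=; rewrite EFinM muleC.
  rewrite RintegralD; [|exact: mI|exact: isn|exact: ihp].
  rewrite IH big_nat_recr//=; congr (_ + _).
  by rewrite RintegralZr ?wh//.
move: cs; rewrite (_ : [sequence _]_n = fun n => (\sum_(0 <= j < n) coef w j * coef psi j)%:E); last first.
  by apply/funext => n /=; exact: E.
move=> cs; rewrite /Rintegral.
have cw : (\sum_(0 <= j < n) coef w j * coef psi j)%:E @[n --> \oo] --> (inner Omega w psi)%:E.
  by apply: cvg_EFin; [exact: nearW|exact: inner_cvg].
have e2 : limn (fun n => (\sum_(0 <= j < n) coef w j * coef psi j)%:E) = (inner Omega w psi)%:E.
  by apply: cvg_lim => //.
rewrite -[LHS]/(fine (inner Omega w psi)%:E) -e2; congr fine.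
by apply: cvg_lim => //; exact: cs.
Qed.

Lemma coef_cvg0 (F : set_system R) {FF : Filter F} (h : R -> 'rV[R]_d -> R) j :
  (\forall r \near F, L2 Omega (h r)) ->
  L2norm Omega (h r) @[r --> F] --> 0%E -> coef (h r) j @[r --> F] --> (0 : R).
Proof.
move=> Lh /(L2_curve_cvg0 Lphi phiE phi_complete Lh) H.
apply/cvgrPdist_le => eps e0; have e2 : 0 < eps ^+ 2 by rewrite exprn_gt0.
apply: filterS (H _ e2) => r /(_ j.+1).
rewrite big_nat_recr//= => Hr; rewrite sub0r normrN.
rewrite -(ger0_norm (ltW e0)) -ler_sqr ?nnegrE// !real_normK ?num_real//.
apply: le_trans Hr; rewrite lerDr.
by apply: sumr_ge0 => i _; exact: sqr_ge0.
Qed.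

Lemma coef_continuous (J : set R) (u : R -> 'rV[R]_d -> R) (t : R) j : L2_continuous Omega J u -> J t ->
  coef (u r) j @[r --> within J (nbhs t)] --> coef (u t) j.
Proof.
move=> cu Jt; have [Lt ct] := cu t Jt.
have Lu r : J r -> L2 Omega (u r) by move=> /cu[].
have Ln : \forall r \near within J (nbhs t), L2 Omega (fun x => u r x - u t x).
  by apply: near_withinI => r /Lu Lr; exact: L2B.
have H : coef (fun x => u r x - u t x) j @[r --> within J (nbhs t)] --> (0 : R) by exact: coef_cvg0.
apply/cvgrPdist_le => eps e0; move/cvgrPdist_le : H => /(_ _ e0) H.
near=> r; have Lr : L2 Omega (u r) by near: r; exact: near_withinI.
have : `|0 - coef (fun x => u r x - u t x) j| <= eps by near: r.
by rewrite sub0r normrN innerBl// distrC.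
Unshelve. all: by end_near.
Qed.

(** The difference quotients of the coefficients are the coefficients of the difference quotient. *)
Lemma coef_derive (J : set R) (u u' : R -> 'rV[R]_d -> R) (t : R) j :
  (forall r, J r -> L2 Omega (u r)) -> L2 Omega (u' t) -> nbhs t J ->
  L2norm Omega (fun x => (u r x - u t x) / (r - t) - u' t x)
    @[r --> within J (dnbhs t)] --> 0%E ->
  is_derive t 1 (fun r => coef (u r) j) (coef (u' t) j).
Proof.
move=> Lu Lt Jt H.
have Jt' : J t by exact: nbhs_singleton.
have JN : \forall r \near dnbhs t, J r by exact: cvg_within.
have LQ r : J r -> L2 Omega (fun x => (u r x - u t x) / (r - t) - u' t x).
  move=> Jr; apply: L2B => //.
  by under eq_fun do rewrite mulrC; apply: L2Z; apply: L2B; exact: Lu.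
have Ln : \forall r \near within J (dnbhs t), L2 Omega (fun x => (u r x - u t x) / (r - t) - u' t x).
  by apply: near_withinI => r; exact: LQ.
have c0 : coef (fun x => (u r x - u t x) / (r - t) - u' t x) j @[r --> within J (dnbhs t)] --> (0 : R).
  exact: coef_cvg0.
have QE r : J r -> coef (fun x => (u r x - u t x) / (r - t) - u' t x) j =
    (r - t)^-1 * (coef (u r) j - coef (u t) j) - coef (u' t) j.
  move=> Jr; have Lr := Lu _ Jr; have Ltt := Lu _ Jt'; have LB := L2B Lr Ltt.
  under eq_fun do rewrite mulrC.
  by rewrite innerBl ?innerZl ?innerBl//; exact: L2Z.
have cq : (r - t)^-1 * (coef (u r) j - coef (u t) j) @[r --> dnbhs t] --> coef (u' t) j.
  apply/cvgrPdist_le => eps e0; move/cvgrPdist_le : c0 => /(_ _ e0) {}H.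
  have {}H : \forall r \near dnbhs t, J r ->
    `|0 - coef (fun x => (u r x - u t x) / (r - t) - u' t x) j| <= eps by [].
  near=> r; have Jr : J r by near: r.
  rewrite distrC -QE//.
  have : `|0 - coef (fun x => (u r x - u t x) / (r - t) - u' t x) j| <= eps by move: Jr; near: r.
  by rewrite sub0r normrN.
have H' : h^-1 *: (((fun r => coef (u r) j) \o shift t) (h *: 1) - coef (u t) j) @[h --> 0^'] --> coef (u' t) j.
  apply/cvgrPdist_le => eps e0.
  move/cvgrPdist_le : cq => /(_ _ e0) /nbhs_ballP[dl /= dl0 Hd].
  apply/nbhs_ballP; exists dl => //= h; rewrite /ball/= sub0r normrN => hd h0.
  rewrite [h *: 1]mulr1.
  have := Hd (h + t); rewrite /ball/= opprD addrCA subrr addr0 normrN addrK; apply => //.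
  by rewrite -subr_eq0 addrK.
apply: DeriveDef; first by apply/cvg_ex; exists (coef (u' t) j).
exact: cvg_lim H'.
Unshelve. all: by end_near.
Qed.

End curves.

(** * From coefficients to curves and back *)

Section solutions.
Context {R : realType} {d : nat} (Omega : set 'rV[R]_d).
Local Notation mu := (lebesgue_rV R d).
Local Notation leb := (@lebesgue_measure R).
Implicit Types (v w : 'rV[R]_d -> R) (c : nat -> R).
Variable phi : nat -> 'rV[R]_d -> R.
Hypothesis Lphi : forall j, L2 Omega (phi j).
Hypothesis phiE : forall i j, inner Omega (phi i) (phi j) = (i == j)%:R.
Hypothesis phi_complete : forall v, L2 Omega v ->
  L2_series Omega phi (fun j => inner Omega v (phi j)) v.
Local Notation coef v j := (inner Omega v (phi j)).

Lemma L2_curve (J : set R) (c : R -> nat -> R) :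
  (forall t, J t -> square_summable (c t)) ->
  exists u : R -> 'rV[R]_d -> R,
    forall t, J t -> L2 Omega (u t) /\ forall j, coef (u t) j = c t j.
Proof.
move=> sc; have H t : exists w, J t -> L2 Omega w /\ forall j, coef w j = c t j.
  have [Jt|nJ] := pselect (J t); last by exists (fun=> 0).
  by have [w Lw wc] := L2_coef Lphi phiE (sc t Jt); exists w.
by have [u Hu] := choice H; exists u.
Qed.

Lemma coefB v w j : L2 Omega v -> L2 Omega w ->
  coef (fun x => v x - w x) j = coef v j - coef w j.
Proof. by move=> Lv Lw; rewrite innerBl. Qed.

Lemma coef_quotient v w z a j : L2 Omega v -> L2 Omega w -> L2 Omega z ->
  coef (fun x => (v x - w x) / a - z x) j = (coef v j - coef w j) / a - coef z j.
Proof.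
move=> Lv Lw Lz; have LB := L2B Lv Lw; have LZ := L2Z a^-1 LB.
have -> : (fun x => (v x - w x) / a - z x) = (fun x => a^-1 * (v x - w x) - z x).
  by apply/funext => x; rewrite mulrC.
by rewrite innerBl// innerZl// innerBl// (mulrC a^-1).
Qed.

Lemma L2_quotient v w z a : L2 Omega v -> L2 Omega w -> L2 Omega z ->
  L2 Omega (fun x => (v x - w x) / a - z x).
Proof.
move=> Lv Lw Lz; apply: L2B => //.
by under eq_fun do rewrite mulrC; apply: L2Z; exact: L2B.
Qed.

Lemma curve_cvg (F : set_system R) {FF : Filter F} (J : set R) (u : R -> 'rV[R]_d -> R)
    (c : R -> nat -> R) (t : R) :
  (forall r, J r -> L2 Omega (u r) /\ forall j, coef (u r) j = c r j) -> J t ->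
  (\forall r \near F, J r) ->
  (forall eps : R, 0 < eps -> \forall r \near F, l2_le (fun j => c r j - c t j) eps) ->
  L2norm Omega (fun x => u r x - u t x) @[r --> F] --> 0%E.
Proof.
move=> uc Jt FJ H; have [Lt tE] := uc t Jt.
apply/(L2_curve_cvg0 Lphi phiE phi_complete).
  by apply: filterS FJ => r /uc[Lr _]; exact: L2B.
move=> eps e0; apply: filterS2 FJ (H _ e0) => r /uc[Lr rE] {}H M.
by under eq_bigr do rewrite coefB// rE tE; exact: H.
Qed.

Lemma curve_l2_le (J : set R) (u : R -> 'rV[R]_d -> R) (t : R) :
  L2_continuous Omega J u -> J t -> forall eps : R, 0 < eps ->
  \forall r \near within J (nbhs t), l2_le (fun j => coef (u r) j - coef (u t) j) eps.
Proof.
move=> cu Jt eps e0; have [Lt ct] := cu t Jt.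
have JJ : \forall r \near within J (nbhs t), J r by exact: near_withinI.
have H : \forall r \near within J (nbhs t), l2_le (fun j => coef (fun x => u r x - u t x) j) eps.
  apply: ((L2_curve_cvg0 Lphi phiE phi_complete _).1 ct eps e0).
  by apply: filterS JJ => r /cu[Lr _]; exact: L2B.
apply: filterS2 JJ H => r /cu[Lr _] H M.
by have := H M; under eq_bigr do rewrite coefB//.
Qed.

Variable lam : nat -> R.

(** Each continuity or differentiability in the definition of the class becomes a pointwise property of
    the coefficients plus uniformly small tails. The derivative is obtained as a curve by
    Riesz-Fischer. *)
Lemma solution_class_coef (T : R) (u : R -> 'rV[R]_d -> R) (c dc : R -> nat -> R) : 0 < T ->
  (forall t, `[0, T]%classic t -> L2 Omega (u t) /\ forall j, coef (u t) j = c t j) ->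
  equi_tails `[0, T]%classic c ->
  equi_tails `[0, T]%classic (fun t j => lam j * c t j) ->
  (forall j t, `[0, T]%classic t -> c r j @[r --> within `[0, T]%classic (nbhs t)] --> c t j) ->
  (forall j (t : R), 0 < t -> is_derive t 1 (c^~ j) (dc t j)) ->
  (forall j (t : R), 0 < t -> {for t, continuous (dc^~ j)}) ->
  (forall b, 0 < b -> equi_tails `[b, T]%classic dc) ->
  solution_class Omega lam phi T u.
Proof.
move=> T0 uc tc tlc cc cd ccd tdc.
have sub : `]0, T]%classic `<=` (`[0, T]%classic : set R).
  by move=> t; rewrite /= !in_itv/= => /andP[/ltW -> ->].
have Lu r : `[0, T]%classic r -> L2 Omega (u r) by move=> /uc[].
have uE r j : `[0, T]%classic r -> coef (u r) j = c r j by move=> /uc[].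
split.
- move=> t It; split; first exact: Lu.
  have H1 : \forall r \near within `[0, T]%classic (nbhs t), `[0, T]%classic r by exact: near_withinI.
  apply: (curve_cvg uc It H1); apply: (equi_tails_cvg tc It H1) => j; exact: cc.
- move=> t It; have It' := sub _ It; split.
    apply/energy_spaceE; split; first exact: Lu.
    have := equi_tails_summable tlc It'.
    by move=> [B HB]; exists B => M; under eq_bigr do rewrite uE//; exact: HB.
  apply: energy_curve_cvg0 => eps e0.
  have H1 : \forall r \near within `]0, T]%classic (nbhs t), `[0, T]%classic r by exact: near_withinI.
  have cl j : (fun t j => lam j * c t j) r j @[r --> within `]0, T]%classic (nbhs t)] --> lam j * c t j.
    apply: cvgM; first exact: cvg_cst.
    apply: cvg_within_filter; apply: derivable1_cont.
    by move: It; rewrite /= in_itv/= => /andP[t0 _]; have [] := cd j t t0.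
  have H2 : \forall r \near within `]0, T]%classic (nbhs t),
      l2_le (fun j => lam j * c r j - lam j * c t j) eps.
    exact: (equi_tails_cvg tlc It' H1 cl e0).
  apply: filterS2 H1 H2 => r Ir H M.
  have Lr := Lu _ Ir; have Lt := Lu _ It'.
  by under eq_bigr do rewrite coefB// !uE// mulrBr; exact: H.
have sdc t : `]0, T]%classic t -> square_summable (dc t).
  rewrite /= in_itv/= => /andP[t0 tT].
  by apply: (equi_tails_summable (tdc t t0)); rewrite /= in_itv/= lexx.
have [u' Hu'] := L2_curve sdc.
have dcc t : `]0, T]%classic t -> forall eps : R, 0 < eps ->
    \forall r \near within `]0, T]%classic (nbhs t), l2_le (fun j => dc r j - dc t j) eps.
  rewrite /= in_itv/= => /andP[t0 tT].
  have t2 : 0 < t / 2 by rewrite divr_gt0.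
  apply: (equi_tails_cvg (tdc _ t2)).
  - by rewrite /= in_itv/= tT andbT; lra.
  - have : \forall r \near nbhs t, t / 2 < r by apply: lt_nbhsr; lra.
    by apply: filterS => r tr; rewrite /= !in_itv/= => /andP[_ ->]; rewrite ltW.
  - by move=> j; apply: cvg_within_filter; exact: ccd.
exists u'; split.
- move=> t It; have It' := sub _ It; split; first exact: Lu.
  have H1 : \forall r \near within `]0, T]%classic (nbhs t), `[0, T]%classic r by exact: near_withinI.
  have cl j : c r j @[r --> within `]0, T]%classic (nbhs t)] --> c t j.
    apply: cvg_within_filter; apply: derivable1_cont.
    by move: It; rewrite /= in_itv/= => /andP[t0 _]; have [] := cd j t t0.
  by apply: (curve_cvg uc It' H1); exact: (equi_tails_cvg tc It' H1 cl).
- move=> t It; have [Lt tE] := Hu' t It; split => //.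
  apply: (curve_cvg Hu' It); first exact: near_withinI.
  exact: dcc.
move=> t It; have It' := sub _ It; have [Lt tE] := Hu' t It.
have Q r : `]0, T]%classic r -> L2 Omega (fun x => (u r x - u t x) / (r - t) - u' t x).
  by move=> /sub Ir; apply: L2_quotient => //; exact: Lu.
apply/(L2_curve_cvg0 Lphi phiE phi_complete); first exact: near_withinI.
move=> eps e0.
have t0 : 0 < t by move: It; rewrite /= in_itv/= => /andP[].
have H2 : \forall r \near within `]0, T]%classic (dnbhs t),
    l2_le (fun j => (c r j - c t j) / (r - t) - dc t j) eps.
  exact: (l2_derive t0 cd (dcc t It) It e0).
have H1 : \forall r \near within `]0, T]%classic (dnbhs t), `]0, T]%classic r by exact: near_withinI.
apply: filterS2 H1 H2 => r /sub Ir H M.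
have Lr := Lu _ Ir; have Ltt := Lu _ It'.
by under eq_bigr do rewrite coef_quotient// !uE// tE; exact: H.
Qed.

(** g_j is the coefficient of the derivative of f, frozen outside [0, T]; Dini's theorem gives the tails
    and the fundamental theorem of calculus the primitive. *)
Lemma source_primitive (T : R) (f : R -> 'rV[R]_d -> R) : 0 < T ->
  L2_C1 Omega `[0, T]%classic f ->
  exists g : nat -> R -> R, [/\ forall j, continuous (g j),
    equi_tails `[0, T]%classic (fun t j => g j t) &
    forall j t, 0 < t < T -> coef (f t) j = primitive (coef (f 0) j) (g j) t].
Proof.
move=> T0 [f' [cf cf' df]].
have Lf t : `[0, T]%classic t -> L2 Omega (f t) by move=> /cf[].
have Lf' t : `[0, T]%classic t -> L2 Omega (f' t) by move=> /cf'[].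
have I0 : (`[0, T]%classic : set R) 0 by rewrite /= in_itv/= lexx ltW.
pose g j := (fun t => coef (f' t) j) \o clamp T.
have gE j t : 0 <= t <= T -> g j t = coef (f' t) j by move=> tT; rewrite /g/= clampE.
have cg j : continuous (g j).
  apply: continuous_comp_clamp => // t tT.
  by apply: (coef_continuous Lphi phiE phi_complete cf'); rewrite /= in_itv.
exists g; split => //.
  apply: (@eq_equi_tails _ _ (fun t j => coef (f' t) j)) => [t j|].
    by rewrite /= in_itv/= => tT; rewrite gE.
  apply: l2_continuous_equi_tails => t tT; have It : `[0, T]%classic t by rewrite /= in_itv.
    by apply: (coef_summable Lphi phiE); exact: Lf'.
  exact: curve_l2_le.
move=> j t /andP[t0 tT].
have dfj (x : R) : 0 < x <= t -> is_derive x 1 (fun t => coef (f t) j) (g j x).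
  move=> /andP[x0 xt]; have xT := le_lt_trans xt tT.
  have Ix : `[0, T]%classic x by rewrite /= in_itv/= !ltW.
  rewrite gE; last by rewrite (ltW x0) (ltW xT).
  apply: (coef_derive Lphi phiE phi_complete j Lf (Lf' _ Ix) _ (df _ Ix)).
  near=> y; rewrite /= in_itv/=; apply/andP; split; apply: ltW; near: y.
    exact: lt_nbhsr.
  exact: lt_nbhsl.
have c0 : coef (f x) j - coef (f 0) j @[x --> 0^'+] --> (0 : R).
  have H : coef (f x) j @[x --> within `[0, T]%classic (nbhs (0 : R))] --> coef (f 0) j.
    exact: (coef_continuous Lphi phiE phi_complete cf).
  rewrite -[X in _ --> X](subrr (coef (f 0) j)); apply: cvgB; last exact: cvg_cst.
  apply: cvg_trans H => A /=; rewrite /nbhs/= /within/= => HA.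
  have : \forall x \near nbhs (0 : R), x < T by exact: lt_nbhsl.
  rewrite /at_right /within/=; apply: filterS2 HA => x HA xT x0.
  by apply: HA; rewrite /= in_itv/= !ltW.
have d2 (x : R) : 0 < x <= t -> is_derive x 1 (fun t => coef (f t) j - coef (f 0) j) (g j x).
  move=> xt; have := is_deriveB (dfj x xt) (is_derive_cst (coef (f 0) j) x (1 : R)).
  by rewrite subr0.
have ig : leb.-integrable `[0, t]%classic (EFin \o g j).
  apply: continuous_compact_integrable; first exact: segment_compact.
  by apply: continuous_in_subspaceT => x _; exact: cg.
have FTC := FTC_improper0 t0 (fun x _ => cg j x) d2 c0 ig.
rewrite /primitive gk1// mulr1 conv_gk1E; last by move=> x x0; rewrite pos_le0.
have -> : \int[leb]_(x in `]0, t[%classic) pos (g j) x = \int[leb]_(x in `]0, t[%classic) g j x.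
  by apply: eq_Rintegral => x; rewrite inE/= in_itv/= => /andP[x0 _]; rewrite posE.
have -> : \int[leb]_(x in `]0, t[%classic) g j x = \int[leb]_(x in `[0, t]%classic) g j x.
  rewrite Rintegral_itv_obnd_cbnd.
    rewrite Rintegral_itv_bndo_bndc//.
    apply: (integrableS _ _ _ ig) => //.
    by move=> x /=; rewrite !in_itv/= => /andP[-> /ltW ->].
  apply: (integrableS _ _ _ ig) => //.
  by move=> x /=; rewrite !in_itv/= => /andP[/ltW -> /ltW ->].
by rewrite FTC addrC subrK.
Unshelve. all: by end_near.
Qed.

End solutions.

(** * Uniqueness *)

Section uniqueness_aux.
Context {R : realType} {d : nat} (Omega : set 'rV[R]_d).
Local Notation mu := (lebesgue_rV R d).
Implicit Types (v w z : 'rV[R]_d -> R).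

Lemma restrict_eq v w : (forall x, Omega x -> v x = w x) -> v \_ Omega = w \_ Omega.
Proof.
move=> vw; apply/funext => x; rewrite /patch; case: ifPn => // xO.
by apply: vw; rewrite inE in xO.
Qed.

Lemma L2_eq_on v w : (forall x, Omega x -> v x = w x) -> L2 Omega v -> L2 Omega w.
Proof. by move=> /restrict_eq; rewrite /L2 => ->. Qed.

Lemma inner_eq_on v w z : (forall x, Omega x -> v x = w x) ->
  inner Omega v z = inner Omega w z.
Proof. by move=> /restrict_eq vw; rewrite !innerE vw. Qed.

Lemma inner_ae_eq v w z : L2 Omega v -> L2 Omega w -> L2 Omega z ->
  v = w %[ae mu in Omega] -> inner Omega v z = inner Omega w z.
Proof.
move=> Lv Lw Lz vw; rewrite !innerE; apply: ae_eq_ipl => //.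
  exact: (Lfun2_measurable Lw).
move: vw; apply: filterS => x vw; rewrite /patch; case: ifPn => // xO.
by apply: vw; rewrite inE in xO.
Qed.
End uniqueness_aux.

Lemma cvg_within_left0 (R : realType) (T : R) (w : R -> R) : 0 < T ->
  (forall t, 0 < t < T -> w t = 0) ->
  w r @[r --> within `[0, T]%classic (nbhs T)] --> w T -> w T = 0.
Proof.
move=> T0 w0 cw.
have H : w r @[r --> T^'-] --> w T.
  apply: cvg_trans cw => A /=; rewrite /nbhs/= /within/= => HA.
  have : \forall x \near nbhs T, 0 < x by exact: lt_nbhsr.
  rewrite /at_left /within/=; apply: filterS2 HA => x HA x0 xT.
  by apply: HA; rewrite /= in_itv/= !ltW.
have H0 : w r @[r --> T^'-] --> (0 : R).
  apply: (@cvg_trans _ ((fun=> 0 : R) @ T^'-)); last exact: cvg_cst.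
  apply: near_eq_cvg; near=> r.
  apply/esym/w0; apply/andP; split; last by near: r; exact: nbhs_left_lt.
  by near: r; exact: nbhs_left_gt.
by rewrite -(cvg_lim _ H)// (cvg_lim _ H0).
Unshelve. all: by end_near.
Qed.

Section uniqueness.
Context {R : realType} {d : nat} (Omega : set 'rV[R]_d) (al T : R).
Hypotheses (al0 : 0 < al) (al1 : al < 1) (T0 : 0 < T).
Local Notation mu := (lebesgue_rV R d).
Local Notation leb := (@lebesgue_measure R).
Variable phi : nat -> 'rV[R]_d -> R.
Hypothesis Lphi : forall j, L2 Omega (phi j).
Hypothesis phiE : forall i j, inner Omega (phi i) (phi j) = (i == j)%:R.
Hypothesis phi_complete : forall v, L2 Omega v ->
  L2_series Omega phi (fun j => inner Omega v (phi j)) v.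
Local Notation coef v j := (inner Omega v (phi j)).
Variables (lam : nat -> R) (u0 : 'rV[R]_d -> R) (f : R -> 'rV[R]_d -> R).
Hypothesis Lu0 : L2 Omega u0.
Implicit Types (u : R -> 'rV[R]_d -> R).

(** Interior points have ]0, T] as a neighbourhood, so that limits within ]0, T] are limits. *)
Lemma solution_class_scalar u j : solution_class Omega lam phi T u ->
  exists dw : R -> R, [/\
    forall t, 0 <= t <= T -> coef (u r) j @[r --> within `[0, T]%classic (nbhs t)] --> coef (u t) j,
    forall t, 0 < t < T -> {for t, continuous dw} &
    forall t : R, 0 < t < T -> is_derive t 1 (fun r => coef (u r) j) (dw t)].
Proof.
move=> [cu _ [u' [cu1 cu' du]]].
have Lu r : `]0, T]%classic r -> L2 Omega (u r) by move=> /cu1[].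
have Lu' r : `]0, T]%classic r -> L2 Omega (u' r) by move=> /cu'[].
have In (t : R) : 0 < t < T -> nbhs t `]0, T]%classic.
  move=> /andP[t0 tT]; have H1 : \forall x \near t, 0 < x by exact: lt_nbhsr.
  have H2 : \forall x \near t, x < T by exact: lt_nbhsl.
  by apply: filterS2 H1 H2 => x x0 xT; rewrite /= in_itv/= x0 ltW.
exists (fun t => coef (u' t) j); split => t tT.
- by apply: (coef_continuous Lphi phiE phi_complete cu); rewrite /= in_itv.
- have It := nbhs_singleton (In t tT).
  have H : coef (u' r) j @[r --> within `]0, T]%classic (nbhs t)] --> coef (u' t) j.
    exact: (coef_continuous Lphi phiE phi_complete cu' It).
  apply: cvg_trans H => A /=; rewrite /nbhs/= /within/= => HA.
  by apply: filterS2 HA (In t tT) => x; apply.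
- have It := nbhs_singleton (In t tT).
  exact: (coef_derive Lphi phiE phi_complete j Lu (Lu' _ It) (In t tT) (du _ It)).
Qed.

(** Each coefficient of the difference solves the homogeneous scalar problem. The equation is only
    required before T; the endpoint follows by continuity. *)
Lemma caputo_solution_unique u u2 :
  caputo_solution Omega lam phi al T u0 f u ->
  caputo_solution Omega lam phi al T u0 f u2 ->
  forall t, 0 <= t <= T -> u2 t = u t %[ae mu in Omega].
Proof.
move=> [su eu iu] [su2 eu2 iu2] t tT.
have Lu r : 0 <= r <= T -> L2 Omega (u r).
  by move=> rT; have [cu _ _] := su; have [] := cu r; rewrite //= in_itv.
have Lu2 r : 0 <= r <= T -> L2 Omega (u2 r).
  by move=> rT; have [cu _ _] := su2; have [] := cu r; rewrite //= in_itv.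
apply: (eq_coef_ae Lphi phiE phi_complete) => // [||j]; [exact: Lu2|exact: Lu|].
have [dw [cw cdw dwE]] := solution_class_scalar j su.
have [dw2 [cw2 cdw2 dwE2]] := solution_class_scalar j su2.
have z0 : (0 : R) <= 0 <= T by rewrite lexx ltW.
pose w r := coef (u2 r) j - coef (u r) j.
(* The integral in the Caputo derivative, with the derivative replaced by the coefficient of the
   derivative of the curve. *)
have cpt (v : R -> 'rV[R]_d -> R) (dv : R -> R) r :
    (forall t : R, 0 < t < T -> is_derive t 1 (fun r => coef (v r) j) (dv t)) ->
    spectral_equation Omega lam phi (caputo_deriv al) T f v -> 0 < r < T ->
    leb.-integrable `]0, r[%classic (EFin \o (fun x => dv x / (r - x) `^ al)) /\
    (Gamma (1 - al))^-1 * \int[leb]_(x in `]0, r[%classic) (dv x / (r - x) `^ al) =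
    coef (f r) j - lam j * coef (v r) j.
  move=> dvE ev rT; have [l [_ il lE] Hl] := ev r j rT.
  have E x : x \in (`]0, r[%classic : set R) ->
      derive1 (fun t => coef (v t) j) x / (r - x) `^ al = dv x / (r - x) `^ al.
    rewrite inE/= in_itv/= => /andP[x0 xr]; congr (_ / _).
    have xT : 0 < x < T by case/andP: rT => _ rT; rewrite x0 (lt_trans xr).
    by rewrite derive1E; have [_ ->] := dvE x xT.
  split.
    by apply: eq_integrable il => // x Hx; rewrite /= E.
  by rewrite -Hl addrK lE; congr (_ * _); apply: eq_Rintegral => x Hx; rewrite E.
have w00 : w 0 = 0.
  rewrite /w (inner_ae_eq (Lu2 _ z0) Lu0 (Lphi j) iu2).
  by rewrite (inner_ae_eq (Lu _ z0) Lu0 (Lphi j) iu) subrr.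
have cww r : 0 <= r <= T -> w s @[s --> within `[0, T]%classic (nbhs r)] --> w r.
  by move=> rT; apply: cvgB; [exact: cw2|exact: cw].
have wz : forall r, 0 < r < T -> w r = 0.
  have lK := lsing_resK al0 (lam j).
  have KK := resK_conv al0 (lam j).
  apply: (@caputo_unique R al al0 al1 (lam j) _ lK KK w (fun r => dw2 r - dw r) T T0 cww w00).
  - by move=> r rT; apply: cvgB; [exact: cdw2|exact: cdw].
  - by move=> r rT; exact: (is_deriveB (dwE2 r rT) (dwE r rT)).
  - move=> r rT; have [i1 _] := cpt _ _ _ dwE2 eu2 rT; have [i2 _] := cpt _ _ _ dwE eu rT.
    have mI : measurable (`]0, r[%classic : set R) by exact: measurable_itv.
    have := @integrableB _ _ R leb _ mI _ _ i1 i2.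
    by apply: eq_integrable => // x _; rewrite /= mulrBl EFinB.
  - move=> r rT; have [i1 e1] := cpt _ _ _ dwE2 eu2 rT; have [i2 e2] := cpt _ _ _ dwE eu rT.
    under eq_Rintegral do rewrite mulrBl.
    rewrite RintegralB//.
    rewrite mulrBr e1 e2 /w.
    by move: (coef (f r) j) (coef (u2 r) j) (coef (u r) j) => a b c; ring.
suff : w t = 0 by move=> /eqP; rewrite subr_eq0 => /eqP.
case/andP: tT; rewrite le_eqVlt => /predU1P[<-//|t0].
rewrite le_eqVlt => /predU1P[->|tT]; last by apply: wz; rewrite t0.
apply: (cvg_within_left0 T0 wz); apply: cww.
by rewrite lexx ltW.
Qed.

(** Multiplying by t^(al - 1) recovers u from the regular curve v. *)
Lemma RL_solution_class u : 
  (exists2 v, solution_class Omega lam phi T v &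
     forall t x, 0 < t <= T -> Omega x -> v t x = t `^ (1 - al) * u t x) ->
  exists2 v, solution_class Omega lam phi T v & forall t, 0 < t <= T ->
    L2 Omega (u t) /\ forall j, coef (u t) j = pk al t * coef (v t) j.
Proof.
move=> [v sv vu]; exists v => // t tT; have /andP[t0 _] := tT.
have p1 : t `^ (al - 1) * t `^ (1 - al) = 1.
  rewrite -powRD ?(gt_eqF t0) ?implybT//.
  by rewrite addrA subrK subrr powRr0.
have Lv : L2 Omega (v t).
  by have [cv _ _] := sv; have [] := cv t => //; rewrite /= in_itv/= ltW//; case/andP: tT.
have uE x : Omega x -> t `^ (al - 1) * v t x = u t x.
  by move=> Ox; rewrite (vu _ _ tT Ox) mulrA p1 mul1r.
split; first by apply: (L2_eq_on uE); exact: L2Z.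
by move=> j; rewrite pkE// -(inner_eq_on _ uE) innerZl.
Qed.

(** The fractional integrals of two solutions can be subtracted because the definition of the fractional
    derivative includes their convergence. *)
Lemma RL_solution_unique u u2 :
  RL_solution Omega lam phi al T u0 f u ->
  RL_solution Omega lam phi al T u0 f u2 ->
  forall t, 0 < t <= T -> u2 t = u t %[ae mu in Omega].
Proof.
move=> [cu eu iu] [cu2 eu2 iu2] t tT.
have [v sv vu] := RL_solution_class cu.
have [v2 sv2 vu2] := RL_solution_class cu2.
have [Lut _] := vu t tT; have [Lu2t _] := vu2 t tT.
apply: (eq_coef_ae Lphi phiE phi_complete) => // j.
have [dw [cw _ _]] := solution_class_scalar j sv.
have [dw2 [cw2 _ _]] := solution_class_scalar j sv2.
pose z r := coef (v2 r) j - coef (v r) j.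
have cz r : 0 <= r <= T -> z s @[s --> within `[0, T]%classic (nbhs r)] --> z r.
  by move=> rT; apply: cvgB; [exact: cw2|exact: cw].
pose y := z \o clamp T.
have cy : continuous y by exact: continuous_comp_clamp.
pose w1 r := coef (u r) j; pose w2 r := coef (u2 r) j.
pose w r := w2 r - w1 r.
have wz r : 0 < r <= T -> w r = pk al r * z r.
  by move=> rT; rewrite /w /w2 /w1 (vu2 r rT).2 (vu r rT).2 mulrBr.
have RLB r : 0 < r < T -> RL_integral al w r = RL_integral al w2 r - RL_integral al w1 r.
  move=> rT; have [l1 [i1 _] _] := eu r j rT; have [l2 [i2 _] _] := eu2 r j rT.
  have {}i1 := nbhs_singleton i1; have {}i2 := nbhs_singleton i2.
  rewrite /RL_integral -mulrBr -RintegralB//; congr (_ * _).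
  by apply: eq_Rintegral => x _; rewrite -mulrBl.
have wz0 : forall r, 0 < r < T -> w r = 0.
  have lK := lsing_resK al0 (lam j).
  have KK := resK_conv al0 (lam j).
  apply: (@RL_unique R al al0 al1 (lam j) _ lK KK w y T T0 cy).
  - move=> r /andP[r0 rT]; rewrite wz; last by rewrite r0 ltW.
    by rewrite /y/= clampE// (ltW r0) ltW.
  - move=> r rT; have [l1 [_ d1] e1] := eu r j rT; have [l2 [_ d2] e2] := eu2 r j rT.
    have -> : - lam j * w r = l2 - l1.
      have -> : l2 = coef (f r) j - lam j * w2 r by rewrite -e2 addrK.
      have -> : l1 = coef (f r) j - lam j * w1 r by rewrite -e1 addrK.
      by rewrite /w; move: (coef (f r) j) (w1 r) (w2 r) => a b c; ring.
    have dd := is_deriveB d2 d1; apply: near_eq_is_derive dd.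
    case/andP: rT => r0 rT; near=> s; rewrite RLB//; apply/andP; split.
      by near: s; exact: lt_nbhsr.
    by near: s; exact: lt_nbhsl.
  - have H : RL_integral al w2 h - RL_integral al w1 h @[h --> 0^'+] --> (0 : R).
      rewrite -[X in _ --> X](subrr (coef u0 j)); apply: cvgB; [exact: iu2|exact: iu].
    apply: (@cvg_trans _ ((fun h => RL_integral al w2 h - RL_integral al w1 h) @ 0^'+)).
      2: exact: H.
    apply: near_eq_cvg; near=> s.
    rewrite RLB//; apply/andP; split; first by near: s; exact: nbhs_right_gt.
    by near: s; exact: nbhs_right_lt.
have zz : forall r, 0 < r < T -> z r = 0.
  move=> r rT; have := wz0 r rT; case/andP: rT => r0 rT.
  rewrite wz ?r0 ?ltW// => /eqP; rewrite mulf_eq0 => /orP[|/eqP//].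
  by rewrite pkE// gt_eqF// powR_gt0.
suff : z t = 0.
  move=> zt; have := wz t tT; rewrite zt mulr0 => /eqP.
  by rewrite subr_eq0 => /eqP.
case/andP: tT => t0; rewrite le_eqVlt => /predU1P[->|tT]; last by apply: zz; rewrite t0.
apply: (cvg_within_left0 T0 zz); apply: cz.
by rewrite lexx ltW.
Unshelve. all: by end_near.
Qed.

End uniqueness.

(** * Existence and the representation formulas *)

Section existence.
Context {R : realType} {d : nat} (Omega : set 'rV[R]_d) (al T : R).
Hypotheses (al0 : 0 < al) (al1 : al < 1) (T0 : 0 < T).
Local Notation mu := (lebesgue_rV R d).
Local Notation leb := (@lebesgue_measure R).
Variable phi : nat -> 'rV[R]_d -> R.
Hypothesis Lphi : forall j, L2 Omega (phi j).
Hypothesis phiE : forall i j, inner Omega (phi i) (phi j) = (i == j)%:R.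
Hypothesis phi_complete : forall v, L2 Omega v ->
  L2_series Omega phi (fun j => inner Omega v (phi j)) v.
Local Notation coef v j := (inner Omega v (phi j)).
Variable lam : nat -> R.
Hypothesis lam0 : 0 < lam 0%N.
Hypothesis lam_ge : forall j, lam 0%N <= lam j.
Variables (u0 : 'rV[R]_d -> R) (f : R -> 'rV[R]_d -> R) (g : nat -> R -> R).
Hypothesis eu0 : energy_space Omega lam phi u0.
Hypothesis Lf0 : L2 Omega (f 0).
Hypothesis cg : forall j, continuous (g j).
Hypothesis tg : equi_tails `[0, T]%classic (fun t j => g j t).
Hypothesis fg : forall j t, 0 < t < T -> coef (f t) j = primitive (coef (f 0) j) (g j) t.

Let lj j : 0 < lam j.
Proof. exact: lt_le_trans (lam_ge j). Qed.
Let a j := coef u0 j.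
Let c0 j := coef (f 0) j.
Let Lu0 : L2 Omega u0.
Proof. by case: eu0. Qed.
Let sla : square_summable (fun j => lam j * a j).
Proof. by have [_] := (energy_spaceE _ _ _ _).1 eu0. Qed.
Let sc0 : square_summable c0.
Proof. exact: (coef_summable Lphi phiE). Qed.
Let K j := resK al (lam j).
Let F j := primitive (c0 j) (g j).
Let D j := conv (K j) (F j).
Let lK j : lsing al (K j) := lsing_resK al0 (lam j).
Let KE j : conv (gk (1 - al)) (K j) = resE al (lam j) := conv_gk_resK al0 al1 (lam j).
Let eK j t : resE al (lam j) t = gk 1 t - lam j * conv (gk 1) (K j) t := resE_conv al0 (lam j) t.
Let lF j : lsing 1 (F j).
Proof. exact: lsing_primitive. Qed.
Let cK j t : 0 < t -> {for t, continuous (K j)}.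
Proof. exact: (@continuous_resK R al al0 (lam j) t). Qed.

(** The kernel of P_alpha(t - tau) applied to f(tau) is bounded by gk al (t - tau), uniformly over the
    modes, and f is bounded in L^2(Omega); this is the majorant b. *)
Lemma duhamel_coef t w : 0 <= t <= T -> L2 Omega w -> (forall j, coef w j = D j t) ->
  duhamel Omega lam phi al f t w.
Proof.
move=> /andP[t0 tT] Lw wD.
have [B B0 HB] := primitive_l2_bounded T0 sc0 cg tg.
pose h j tau := K j (t - tau) * F j tau.
(* B + 1 makes the majorant positive; the factor gk 1 is 1 on ]0, t[. *)
pose b tau := (B + 1) * (gk al (t - tau) * gk 1 tau).
have b0 tau : 0 < tau < t -> 0 < b tau.
  move=> /andP[tau0 taut]; rewrite /b gk1// mulr1 mulr_gt0//; first by rewrite ltr_wpDl.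
  by rewrite gk_gt0// subr_gt0.
have hb tau : 0 < tau < t -> l2_le (fun j => h j tau) (b tau ^+ 2).
  move=> /andP[tau0 taut] M; rewrite /b gk1// mulr1.
  have gt0 := gk_ge0 (t - tau) al0.
  apply: (@le_trans _ _ (\sum_(0 <= j < M) gk al (t - tau) ^+ 2 * F j tau ^+ 2)).
    apply: ler_sum => j _; rewrite /h exprMn ler_wpM2r ?sqr_ge0//.
    have /andP[k0 k1] := resK_bounds al0 al1 (lj j) (t - tau).
    by rewrite lerXn2r ?nnegrE.
  rewrite [leRHS]exprMn [leRHS]mulrC -mulr_sumr.
  apply: ler_wpM2l; first exact: sqr_ge0.
  apply: le_trans (HB tau _ M) _.
    by rewrite /= in_itv/= (ltW tau0) (le_trans (ltW taut)).
  by rewrite lerXn2r ?nnegrE ?addr_ge0// lerDl.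
have sh tau : `]0, t[%classic tau -> square_summable (fun j => h j tau).
  by rewrite /= in_itv/= => taut; exists (b tau ^+ 2); exact: hb.
have [G HG] := L2_curve Lphi phiE sh.
exists G.
  move=> tau taut; have [LG GE] := HG tau taut.
  apply: (L2_series_coef phi_complete LG) => j; rewrite GE /h.
  case/andP: taut => tau0 taut.
  rewrite /K resKE ?subr_gt0// fg// tau0 (lt_le_trans taut)//.
have mI : measurable (`]0, t[%classic : set R) by exact: measurable_itv.
apply: (L2_integral_coef Lphi phiE phi_complete (h := h) (B := b)) => //.
- by move=> tau taut; have [] := HG tau taut.
- by move=> tau j taut; have [_] := HG tau taut.
- move=> j; have ih := lsing_integrable t al0 ltr01 (lK j) (lF j).
  have /measurable_EFinP := measurable_int _ ih.
  exact: measurable_funTS.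
- have ib := lsing_integrable t al0 ltr01 (lsing_gk al0) (lsing_gk (@ltr01 R)).
  have := @integrableZl _ _ R leb _ measurableT (B + 1) _ ib.
  move=> H; have {}H := @integrableS _ _ R leb _ _ _ measurableT mI (@subsetT _ _) H.
  by apply: eq_integrable H => // x _; rewrite /= EFinM.
- move=> j; rewrite wD /D convE [RHS]Rintegral_mkcond; apply: eq_Rintegral => x _.
  rewrite /patch; case: ifPn => //; rewrite notin_setE/= in_itv/= => /negP.
  rewrite negb_and -!leNgt => /orP[x0|tx].
    by rewrite (lsing_le0 (lF j) x0) mulr0.
  by rewrite (lsing_le0 (lK j)) ?subr_le0// mul0r.
Qed.

Lemma duhamel_exists t : 0 <= t <= T -> exists2 w, L2 Omega w & forall j, coef w j = D j t.
Proof.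
move=> tT; apply: (L2_coef Lphi phiE).
apply: (equi_tails_summable (tails_duhamel al0 al1 T0 lam0 lam_ge sc0 cg tg)).
by rewrite /= in_itv.
Qed.

(** The curve with the coefficients of caputo_coef. In the representation formula the first term is
    obtained as the difference of the solution and the Duhamel integral. *)
Lemma caputo_exists : exists u : R -> 'rV[R]_d -> R,
  caputo_solution Omega lam phi al T u0 f u /\
  forall t, 0 <= t <= T -> H_C Omega lam phi al u0 f t (u t).
Proof.
have tU : equi_tails `[0, T]%classic (caputo_coef al lam a c0 g).
  exact: (tails_caputo al0 al1 T0 lam0 lam_ge sla sc0 cg tg).
have sU t : `[0, T]%classic t -> square_summable (caputo_coef al lam a c0 g t).
  by move=> It; exact: (equi_tails_summable tU It).
have [u Hu] := L2_curve Lphi phiE sU.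
have uE t j : 0 <= t <= T -> coef (u t) j = caputo_coef al lam a c0 g t j.
  by move=> tT; have [_] := Hu t tT.
have Lu t : 0 <= t <= T -> L2 Omega (u t) by move=> tT; have [] := Hu t tT.
have z0 : (0 : R) <= 0 <= T by rewrite lexx ltW.
exists u; split.
  split.
  - apply: (solution_class_coef Lphi phiE phi_complete T0 Hu tU) => //.
    + exact: (tails_lam_caputo al0 al1 T0 lam0 lam_ge sla sc0 cg tg).
    + by move=> j t It; exact: (caputo_coef_cvg al0 al1 cg It).
    + by move=> j t t0; exact: (is_derive_caputo_coef al0 al1 lam a c0 cg j t0).
    + by move=> j t t0; exact: (caputo_dcoef_continuous al0 cg t0).
    + by move=> b b0; exact: (tails_dcaputo al0 al1 T0 lam0 lam_ge sla sc0 cg tg b0).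
  - move=> t j /andP[t0 tT].
    pose rate := caputo_rate (lam j) (K j) (a j) (c0 j) (g j).
    exists (conv (gk (1 - al)) rate t).
      apply: (caputo_deriv_intro al0 al1).
        exact: (lsing_caputo_rate _ al0 (lK j) _ _ (cg (j := j))).
      move=> x /andP[x0 xt].
      have := is_derive_caputo_coef al0 al1 lam a c0 cg j x0.
      apply: near_eq_is_derive; near=> y; rewrite uE//.
      apply/andP; split; apply: ltW; near: y; first exact: lt_nbhsr.
      by apply: lt_nbhsl; exact: lt_trans tT.
    rewrite (caputo_equation al0 al1 (lK j) (KE j) (eK j) _ _ (cg (j := j))).
    rewrite fg ?t0// uE ?(ltW t0) ?(ltW tT)// /caputo_coef t0.
    by rewrite subrK.
  - apply: (eq_coef_ae Lphi phiE phi_complete) => //; first exact: Lu.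
    by move=> j; rewrite uE// /caputo_coef ltxx.
move=> t tT; have [b Lb bE] := duhamel_exists tT.
exists (fun x => u t x - b x), b; split; last by apply: aeW => x _; rewrite subrK.
  apply: (L2_series_coef phi_complete); first by apply: L2B => //; exact: Lu.
  move=> j; rewrite innerBl//; last exact: Lu.
  rewrite uE// bE /caputo_coef.
  case/andP: tT; rewrite le_eqVlt => /predU1P[<-{b Lb bE} _|t0 _].
    have lD := lsing_conv al0 ltr01 (lK j) (lF j).
    have D0 : D j 0 = 0 by exact: (lsing_le0 lD (lexx 0)).
    rewrite ltxx D0 subr0 powR0 ?gt_eqF// mulr0.
    by rewrite (mittag_leffler0 al ltr01) Gamma1 invr1 mul1r.
  by rewrite t0 addrK mulrC resEE.
exact: duhamel_coef.
Unshelve. all: by end_near.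
Qed.

(** Riesz-Fischer provides the regular curve t^(1 - al) u(t), and u is defined from it. *)
Lemma RL_exists : exists u : R -> 'rV[R]_d -> R,
  RL_solution Omega lam phi al T u0 f u /\
  forall t, 0 < t <= T -> H_R Omega lam phi al u0 f t (u t).
Proof.
have tU : equi_tails `[0, T]%classic (RL_coef al lam a c0 g).
  exact: (tails_RL al0 al1 T0 lam0 lam_ge sla sc0 cg tg).
have sU t : `[0, T]%classic t -> square_summable (RL_coef al lam a c0 g t).
  by move=> It; exact: (equi_tails_summable tU It).
have [v Hv] := L2_curve Lphi phiE sU.
pose u t x := t `^ (al - 1) * v t x.
have sub t : 0 < t <= T -> 0 <= t <= T by move=> /andP[/ltW -> ->].
have Lv t : 0 < t <= T -> L2 Omega (v t) by move=> /sub tT; have [] := Hv t tT.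
have Lu t : 0 < t <= T -> L2 Omega (u t) by move=> tT; apply: L2Z; exact: Lv.
have p1 t : 0 < t -> t `^ (al - 1) * t `^ (1 - al) = 1.
  move=> t0; rewrite -powRD ?(gt_eqF t0) ?implybT//.
  by rewrite addrA subrK subrr powRr0.
have uE t j : 0 < t <= T -> coef (u t) j = a j * K j t + D j t.
  move=> tT; have /andP[t0 _] := tT; have [_ vE] := Hv t (sub t tT).
  by rewrite innerZl ?vE ?(RL_coefE al0)// ?mulrA ?p1 ?mul1r//; exact: Lv.
have lsol j : lsing al (fun t => a j * K j t + D j t).
  apply: lsingD; first exact: lsingZ.
  by apply: (lsing_wk _ (lsing_duhamel al0 (lK j) (c0 j) (cg (j := j)))); rewrite lerDl.
exists u; split.
  split.
  - exists v; last first.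
      by move=> t x /andP[t0 _] _; rewrite /u mulrA (mulrC (t `^ (1 - al))) p1// mul1r.
    apply: (solution_class_coef Lphi phiE phi_complete T0 Hv tU) => //.
    + exact: (tails_lam_RL al0 al1 T0 lam0 lam_ge sla sc0 cg tg).
    + by move=> j t It; exact: (RL_coef_cvg al0 al1 cg It).
    + by move=> j t t0; exact: (is_derive_RL_coef al0 lam a c0 cg j t0).
    + by move=> j t t0; exact: (RL_dcoef_continuous al0 cg t0).
    + by move=> b b0; exact: (tails_dRL al0 al1 T0 lam0 lam_ge sla sc0 cg tg b0).
  - move=> t j /andP[t0 tT].
    exists (F j t - lam j * (a j * K j t + D j t)); last first.
      by rewrite uE ?t0 ?(ltW tT)// fg ?t0// subrK.
    apply: (@RL_deriv_intro R al al0 al1 _ (fun t => a j * K j t + D j t) t T) => //.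
    + by rewrite t0.
    + by move=> x /andP[x0 xT]; rewrite uE// x0 ltW.
    + exact: (is_derive_RL al0 al1 (lK j) (@cK j) (KE j) (eK j) _ _ (cg (j := j)) t0).
  - move=> j.
    have H : conv (gk (1 - al)) (fun t => a j * K j t + D j t) t @[t --> 0^'+] --> a j.
      exact: (RL_initial al0 al1 (lK j) (KE j) (resE_cvg al0 (lam j)) (c0 j) (cg (j := j))).
    apply: (@cvg_trans _ (conv (gk (1 - al)) (fun t => a j * K j t + D j t) t @[t --> 0^'+])).
      2: exact: H.
    apply: near_eq_cvg; near=> h; apply/esym.
    apply: (RL_integralE al0 al1 (lsol j)) => x /andP[x0 xh].
    rewrite uE// x0/= (le_trans (ltW xh))//; near: h; exact: nbhs_right_le.
move=> t tT; have /andP[t0 _] := tT; have [b Lb bE] := duhamel_exists (sub t tT).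
exists (fun x => u t x - b x), b; split; last by apply: aeW => x _; rewrite subrK.
  apply: (L2_series_coef phi_complete); first by apply: L2B => //; exact: Lu.
  move=> j; rewrite innerBl//; last exact: Lu.
  by rewrite uE// bE addrK mulrC /K resKE.
exact: (duhamel_coef (sub t tT)).
Unshelve. all: by end_near.
Qed.

End existence.

Theorem theorem2p3 (R : realType) (d : nat) (Omega : set 'rV[R]_d)
    (alpha T s gamma : R)
    (G : 'rV[R]_d -> 'rV[R]_d -> R)
    (lam : nat -> R) (phi : nat -> 'rV[R]_d -> R)
    (u0 : 'rV[R]_d -> R) (f : R -> 'rV[R]_d -> R) :
  (0 < d)%N -> bounded_smooth_domain Omega ->
  0 < alpha < 1 -> 0 < T -> 0 < s <= 1 -> 0 < gamma <= 1 ->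
  eigenbasis Omega G lam phi ->
  measurable_symmetric_kernel Omega G -> green_estimate Omega G s gamma ->
  green_normal_derivative Omega G s gamma ->
  green_regularizing Omega G gamma ->
  submarkovian Omega lam phi ->
  energy_space Omega lam phi u0 ->
  L2_C1 Omega `[0, T]%classic f ->
  (exists u : R -> 'rV[R]_d -> R,
    [/\ caputo_solution Omega lam phi alpha T u0 f u,
        forall u2, caputo_solution Omega lam phi alpha T u0 f u2 ->
          forall t, 0 <= t <= T ->
            u2 t = u t %[ae lebesgue_rV R d in Omega] &
        forall t, 0 <= t <= T -> H_C Omega lam phi alpha u0 f t (u t)]) /\
  (exists u : R -> 'rV[R]_d -> R,
    [/\ RL_solution Omega lam phi alpha T u0 f u,
        forall u2, RL_solution Omega lam phi alpha T u0 f u2 ->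
          forall t, 0 < t <= T ->
            u2 t = u t %[ae lebesgue_rV R d in Omega] &
        forall t, 0 < t <= T -> H_R Omega lam phi alpha u0 f t (u t)]).
Proof.
move=> _ _ /andP[al0 al1] T0 _ _ [Lphi phiE phi_complete [lam0 lam_homo] _] _ _ _ _ _ eu0 cf.
have lam_ge j : lam 0%N <= lam j by exact: lam_homo.
have [Lu0 _] := eu0.
have Lf0 : L2 Omega (f 0).
  by have [f' [cf0 _ _]] := cf; have [] := cf0 0; rewrite /= ?in_itv/= ?lexx ?ltW.
have [g [cg tg fg]] := source_primitive Lphi phiE phi_complete T0 cf.
split.
  have [u [su hu]] := caputo_exists al0 al1 T0 Lphi phiE phi_complete lam0 lam_ge eu0 Lf0 cg tg fg.
  exists u; split => // u2 su2.
  exact: (caputo_solution_unique al0 al1 T0 Lphi phiE phi_complete Lu0 su su2).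
have [u [su hu]] := RL_exists al0 al1 T0 Lphi phiE phi_complete lam0 lam_ge eu0 Lf0 cg tg fg.
exists u; split => // u2 su2.
exact: (RL_solution_unique al0 al1 T0 Lphi phiE phi_complete su su2).
Qed.
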